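(* Let $\mu\in\mathfrak{gl}_N^*$ be arbitrary. The algebra $\mathcal A_\mu\subset\mathcal U(\mathfrak{gl}_N)$ is generated by the family $\varpi(\partial_\mu^k\Phi_m)$ with $m=1,\dots,N$ and $k=0,1,\dots,m-1$; it is also generated by the family $\varpi(\partial_\mu^k\Psi_m)$ with $m=1,\dots,N$ and $k=0,1,\dots,m-1$.
   Context: $E=[E_{ij}]$ is the $N\times N$ matrix of standard basis elements of $\mathfrak{gl}_N$, regarded in $\mathcal S(\mathfrak{gl}_N)$. Define $\Phi_m,\Psi_m\in\mathcal S(\mathfrak{gl}_N)^{\mathfrak{gl}_N}$ by $\det(u+E)=u^N+\Phi_1u^{N-1}+\dots+\Phi_N$ and $\det(1-qE)^{-1}=1+\Psi_1q+\Psi_2q^2+\dots$. Identify $\mathcal S(\mathfrak{gl}_N)=\mathbb C[\mathfrak{gl}_N^*]$; $\partial_\mu H(x)=\frac{d}{dt}H(x+t\mu)|_{t=0}$. $\varpi:\mathcal S(\mathfrak g)\to\mathcal U(\mathfrak g)$ is the canonical symmetrisation map $Y_1\cdots Y_k\mapsto\frac1{k!}\sum_{\sigma\in\mathfrak S_k}Y_{\sigma(1)}\cdots Y_{\sigma(k)}$. Let $\mathfrak z(\widehat{\mathfrak{gl}}_N)\subset\mathcal U(t^{-1}\mathfrak{gl}_N[t^{-1}])$ be the Feigin–Frenkel centre (the centre of the universal affine vertex algebra at the critical level), and for $z\in\mathbb C^\times$ let $\varrho_{\mu,z}:\mathcal U(t^{-1}\mathfrak{gl}_N[t^{-1}])\to\mathcal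 U(\mathfrak{gl}_N)$ be the homomorphism $Xt^r\mapsto Xz^r+\delta_{r,-1}\mu(X)$. Then $\mathcal A_\mu=\varrho_{\mu,z}(\mathfrak z(\widehat{\mathfrak{gl}}_N))$, a commutative subalgebra independent of $z$. *)

(* Defs.v *)
From HB Require Import structures.
From mathcomp Require Import all_boot all_order all_algebra all_fingroup.
From mathcomp Require Import reals.
From mathcomp Require Import complex.
From mathcomp Require Import mpoly.

Set Implicit Arguments.
Unset Strict Implicit.
Unset Printing Implicit Defensive.

Import Order.TTheory GRing.Theory Num.Theory.
Local Open Scope ring_scope.

(* Free associative algebra C<X> : an element is a finite formal sum of      *)
(* words, represented as a list of (coefficient, word).  Two formal sums     *)
(* denote the same element iff all their word coefficients ([fa_coef]) agree.*)
Section FreeAlg.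
Variable C : fieldType.

Definition fa (X : Type) := seq (C * seq X).

Definition fa_zero (X : Type) : fa X := [::].
Definition fa_one (X : Type) : fa X := [:: (1, [::])].
Definition fa_const (X : Type) (c : C) : fa X := [:: (c, [::])].
Definition fa_letter (X : Type) (x : X) : fa X := [:: (1, [:: x])].
Definition fa_add (X : Type) (p q : fa X) : fa X := p ++ q.
Definition fa_scale (X : Type) (c : C) (p : fa X) : fa X :=
  [seq (c * cw.1, cw.2) | cw <- p].
Definition fa_sub (X : Type) (p q : fa X) : fa X := fa_add p (fa_scale (-1) q).
Definition fa_mul (X : Type) (p q : fa X) : fa X :=
  [seq (a.1 * b.1, a.2 ++ b.2) | a <- p, b <- q].

Definition fa_coef (X : eqType) (p : fa X) (w : seq X) : C :=
  \sum_(cw <- p | cw.2 == w) cw.1.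

Definition in_ideal (X : eqType) (I : Type) (rels : I -> fa X) (p : fa X) : Prop :=
  exists s : seq (fa X * I * fa X),
    forall w, fa_coef p w =
      fa_coef (flatten [seq fa_mul (fa_mul t.1.1 (rels t.1.2)) t.2 | t <- s]) w.

Definition fa_equiv (X : eqType) (I : Type) (rels : I -> fa X) (p q : fa X) : Prop :=
  in_ideal rels (fa_sub p q).

Definition fa_hom (X Y : Type) (f : X -> fa Y) (p : fa X) : fa Y :=
  flatten [seq fa_scale cw.1 (foldr (fun x acc => fa_mul (f x) acc) (fa_one Y) cw.2)
          | cw <- p].

Definition gen_by (X : eqType) (I : Type) (rels_ : Type) (rels : rels_ -> fa X)
   (F : I -> fa X) (u : fa X) : Prop :=
  exists q : fa I, fa_equiv rels u (fa_hom F q).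

End FreeAlg.

Section GlN.
Variable R : realType.
Local Notation C := (R[i]).
Variable N : nat.

Local Notation delta a b := ((a == b)%:R : C).

(* U(gl_N) = C< E_ij > / ([E_ij,E_kl] = d_kj E_il - d_il E_kj);
   the generator E_ij is the letter  mxvec_index i j : 'I_(N*N). *)
Definition GL := 'I_(N * N).
Definition E (i j : 'I_N) : GL := mxvec_index i j.

Definition gl_rel (r : 'I_N * 'I_N * 'I_N * 'I_N) : fa C GL :=
  let: (i, j, k, l) := r in
  [:: (1, [:: E i j; E k l]); (-1, [:: E k l; E i j]);
      (- delta k j, [:: E i l]); (delta i l, [:: E k j])].

(* U(t^{-1} gl_N[t^{-1}]): the letter (i, j, n) stands for E_ij t^{-(n+1)}. *)
Definition LP := ('I_N * 'I_N * nat)%type.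

Definition loop_rel (r : LP * LP) : fa C LP :=
  let: ((i, j, a), (k, l, b)) := r in
  [:: (1, [:: (i, j, a); (k, l, b)]); (-1, [:: (k, l, b); (i, j, a)]);
      (- delta k j, [:: (i, l, (a + b).+1)]); (delta i l, [:: (k, j, (a + b).+1)])].

(* Action of E_ij t^r (r >= 0) of gl_N[t] on the vacuum module at the critical
   level V_{-N}(gl_N) = U(t^{-1}gl_N[t^{-1}]) |0>, where
   [E_ij[r], E_kl[s]] = d_kj E_il[r+s] - d_il E_kj[r+s]
                        + K r d_{r,-s} (d_kj d_il - d_ij d_kl / N),  K = -N,
   and gl_N[t] |0> = 0.  A word w stands for the vector w|0>. *)
Fixpoint vac_act (w : seq LP) (x : 'I_N * 'I_N * nat) {struct w} : fa C LP :=
  match w with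
  | [::] => [::]
  | y :: w' =>
    let: (i, j, r) := x in
    let: (k, l, n) := y in
    let rest := [seq (cw.1, y :: cw.2) | cw <- vac_act w' x] in
    let br :=
      if (r < n.+1)%N then
        [:: (delta k j, (i, l, (n - r)%N) :: w'); (- delta i l, (k, j, (n - r)%N) :: w')]
      else
        fa_scale (delta k j) (vac_act w' (i, l, (r - n.+1)%N)) ++
        fa_scale (- delta i l) (vac_act w' (k, j, (r - n.+1)%N)) ++
        (if r == n.+1 then
           [:: ((r%:R : C) * (delta i j * delta k l - N%:R * delta k j * delta i l), w')]
         else [::])
    in br ++ rest
  end.

Definition vac_act_lin (x : 'I_N * 'I_N * nat) (v : fa C LP) : fa C LP :=
  flatten [seq fa_scale cw.1 (vac_act cw.2 x) | cw <- v].

(* The Feigin--Frenkel centre z(gl_N^) = { v in V_{-N}(gl_N) | gl_N[t] v = 0 },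
   viewed inside U(t^{-1}gl_N[t^{-1}]) *)
Definition FF_centre (v : fa C LP) : Prop :=
  forall x : 'I_N * 'I_N * nat, in_ideal loop_rel (vac_act_lin x v).

Definition rho (mu : 'I_N -> 'I_N -> C) (z : C) (x : LP) : fa C GL :=
  let: (i, j, n) := x in
  [:: ((z ^+ n.+1)^-1, [:: E i j]); ((n == 0)%:R * mu i j, [::])].

Definition A_mu (mu : 'I_N -> 'I_N -> C) (z : C) (u : fa C GL) : Prop :=
  exists v, FF_centre v /\ fa_equiv gl_rel u (fa_hom (rho mu z) v).

(* S(gl_N) = C[x_ij] with x_ij = E_ij, as multivariate polynomials in N*N
   variables (variable index mxvec_index i j). *)
Definition Smx : 'M[{mpoly C[N * N]}]_N := \matrix_(i, j) 'X_(E i j).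

Definition det_uE : {poly {mpoly C[N * N]}} :=
  \det (\matrix_(i, j) ('X *+ (i == j) + (Smx i j)%:P)).
Definition Phi (m : nat) : {mpoly C[N * N]} := det_uE`_(N - m)%N.

(* det(1 - qE) as a polynomial in q, and Psi_m = coefficients of its inverse
   power series: Psi_0 = 1, Psi_t = - sum_{k<t} [q^(t-k)]det(1-qE) Psi_k. *)
Definition det_1qE : {poly {mpoly C[N * N]}} :=
  \det (\matrix_(i, j) ((i == j)%:R%:P - 'X * (Smx i j)%:P)).
Definition psi_next (s : seq {mpoly C[N * N]}) : seq {mpoly C[N * N]} :=
  rcons s (- \sum_(k < size s) det_1qE`_(size s - k) * s`_k).
Definition Psi (m : nat) : {mpoly C[N * N]} := (iter m psi_next [:: 1])`_m.

Definition dmu (mu : 'I_N -> 'I_N -> C) (H : {mpoly C[N * N]}) : {mpoly C[N * N]} :=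
  \sum_(i < N) \sum_(j < N) mu i j *: mderiv (E i j) H.

Definition mon_word (m : 'X_{1.. N * N}) : seq GL :=
  flatten [seq nseq (m k) k | k <- enum 'I_(N * N)].
Definition sym_mon (c : C) (m : 'X_{1.. N * N}) : fa C GL :=
  let w := mon_word m in
  [seq (((size w)`!%:R)^-1 * c, [seq tnth (in_tuple w) (s i) | i <- enum 'I_(size w)])
  | s : {perm 'I_(size w)} <- enum [set: {perm 'I_(size w)}]].
Definition varpi (p : {mpoly C[N * N]}) : fa C GL :=
  flatten [seq sym_mon (p@_m) m | m <- msupp p].

(* the index set {(m, k) : 1 <= m <= N, 0 <= k <= m - 1}, encoded as
   (m - 1, k) with k <= m - 1 *)
Definition MK := {mk : 'I_N * 'I_N | (mk.2 <= mk.1)%N}.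

Definition PhiFam (mu : 'I_N -> 'I_N -> C) (a : MK) : fa C GL :=
  varpi (iter (val a).2 (dmu mu) (Phi (val a).1.+1)).
Definition PsiFam (mu : 'I_N -> 'I_N -> C) (a : MK) : fa C GL :=
  varpi (iter (val a).2 (dmu mu) (Psi (val a).1.+1)).

End GlN.

(* Submission.v *)
(* Fix eps = -1 for the family Phi and eps = 1 for Psi.  Let a_i, b_j be two  *)

(* The two families are the cases [eps = -1] and [eps = 1] of [fA_mu_gen_by], and three results
   carry the argument.

   The centre is generated by the translates of the vectors [ssv] ([FF_ssv] and [FF_Gen]). These
   vectors are central because, at level -N, the central term produced by mode 1 cancels against the
   dimension N that [pr_kp] produces when the identity matrix is contracted. Conversely, by [pbw] a
   central vector has a well-defined symbol, killed by every [curr r i j]. By [slice_eq0] such a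
   polynomial is determined by its values on companion matrices, where it is a polynomial in the
   functions [elem]; [invariant_to_elem] turns this into an identity, and [FF_lifts] lifts the
   result back to the centre.

   The image of the centre under evaluation is generated by the elements [Gpq p q] with [q > 0] and
   [p + q <= N] ([imageP]). By [Rep_ssv] all translates of one [ssv] are combinations of the same
   coefficients [Hm], which [separate] recovers one by one. By [at_FW] the passage from [Hm] to
   [Gpq] is triangular with binomial coefficients on the diagonal, whatever [mu] is, so singular
   [mu] causes no difficulty.

   Finally, [varpi_dmu_sy] identifies [Gpq k (m - k)], up to a non-zero scalar, with the symmetrised
   derivative. It rests on [fPhiE] and [fPsiE], which express the coefficients of the two
   determinants as contractions in a Fock space. *)
(* commuting families of fermionic (eps = -1) or bosonic (eps = 1) creation   *)
(* operators and < . > the contraction of the a's with the b's.  With         *)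
(* L = sum_ij (delta_ij T + E_ij[-1]) a_i b_j, where T is the translation, the*)
(* vectors s_m = < L^m 1 > are Segal-Sugawara vectors: gl_N[t] is generated by*)
(* its modes 0 and 1 modulo the identity matrix, mode 0 acts by derivations,  *)
(* and mode 1 is handled by the Manin property of T + E[-1].                  *)
(* The T^n s_m with 1 <= m <= N generate the whole centre: by PBW, the symbol *)
(* of a central vector is a polynomial P on gl_N[s]/s^L killed by all the     *)
(* infinitesimal adjoint actions of gl_N[s].  The companion matrices over C[s]*)
(* form a slice, so P is a polynomial in the coefficients in s of the         *)
(* characteristic polynomial, which are the symbols of the T^n s_m (for       *)
(* eps = 1, up to Newton's relations).  Subtract a lift of P and induct on the*)
(* filtration degree.                                                         *)
(* Under rho, T becomes zeta^2 d/dzeta with zeta = 1/z, and rho (T^n s_m) is a*)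
(* combination of the coefficients H_(m,y) of zeta^y.  Varying n separates the*)
(* H_(m,y), and H_(m,y) is binomial(m, y) G_(m-y,y) plus a combination of the *)
(* G_(m-y,q) with q < y, where G_(p,q) = < M^p E^q 1 > for                    *)
(* M = sum mu_ij a_i b_j and E = sum E_ij a_i b_j.  As the products a_i b_j   *)
(* commute, G_(k,m-k) is a nonzero multiple of the symmetrisation of the k-th *)
(* mu-derivative of Phi_m or Psi_m.                                           *)
Require Import Defs.
From HB Require Import structures.
From mathcomp Require Import all_boot all_order all_algebra all_fingroup.
From mathcomp Require Import reals.
From mathcomp Require Import complex.
From mathcomp Require Import mpoly.
From mathcomp Require Import generic_quotient boolp functions.
From mathcomp Require Import ring zify.
Set Implicit Arguments.
Unset Strict Implicit.
Unset Printing Implicit Defensive.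
Import Order.TTheory GRing.Theory Num.Theory.
Local Open Scope ring_scope.

(** * Linear combinations in a module *)

(* The square-zero extension of C by a module W is a commutative ring in     *)
(* which W embeds, so that [ring] decides identities between linear          *)
(* combinations in W.                                                        *)
Section SquareZero.
Variables (C : comNzRingType) (W : lmodType C).

Definition sqz : Type := (C * W)%type.
HB.instance Definition _ := Choice.copy sqz (C * W)%type.
HB.instance Definition _ := GRing.Zmodule.copy sqz (C * W)%type.

Definition sqz_mul (x y : sqz) : sqz := (x.1 * y.1, x.1 *: y.2 + y.1 *: x.2).
Lemma sqz_mulA : associative sqz_mul.
Proof.
move=> [a x] [b y] [c z]; congr (_, _) => /=; first exact: mulrA.
by rewrite !scalerDr !scalerA addrA (mulrC c a) (mulrC c b).
Qed.
Lemma sqz_mulC : commutative sqz_mul.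
Proof. by move=> [a x] [b y]; congr (_, _) => /=; rewrite 1?mulrC 1?addrC. Qed.
Lemma sqz_mul1 : left_id (1, 0 : W) sqz_mul.
Proof. by move=> [a x]; congr (_, _) => /=; rewrite ?mul1r // scale1r scaler0 addr0. Qed.
Lemma sqz_mulD : left_distributive sqz_mul +%R.
Proof.
move=> [a x] [b y] [c z]; congr (_, _) => /=; first exact: mulrDl.
by rewrite scalerDl scalerDr !addrA; congr (_ + _); rewrite addrAC.
Qed.
HB.instance Definition _ :=
  GRing.Zmodule_isComPzRing.Build sqz sqz_mulA sqz_mulC sqz_mul1 sqz_mulD.

Definition sqz_emb (w : W) : sqz := (0, w).
Definition sqz_sc (c : C) : sqz := (c, 0).
Lemma sqz_emb_inj : injective sqz_emb. Proof. by move=> x y []. Qed.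
Lemma sqz_emb_additive : zmod_morphism sqz_emb.
Proof. by move=> x y; congr (_, _) => /=; rewrite subr0. Qed.
HB.instance Definition _ := GRing.isZmodMorphism.Build W sqz sqz_emb sqz_emb_additive.
Lemma sqz_sc_zmod : zmod_morphism sqz_sc.
Proof. by move=> x y; congr (_, _) => /=; rewrite subr0. Qed.
Lemma sqz_sc_mon : monoid_morphism sqz_sc.
Proof. by split=> // x y; congr (_, _) => /=; rewrite !scaler0 addr0. Qed.
HB.instance Definition _ := GRing.isZmodMorphism.Build C sqz sqz_sc sqz_sc_zmod.
HB.instance Definition _ := GRing.isMonoidMorphism.Build C sqz sqz_sc sqz_sc_mon.
Lemma sqz_embZ c w : sqz_emb (c *: w) = sqz_sc c * sqz_emb w.
Proof. by congr (_, _) => /=; rewrite ?mulr0 // scaler0 addr0. Qed.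
Lemma sqz_embD : {morph sqz_emb : x y / x + y}. Proof. exact: raddfD. Qed.
Lemma sqz_embN : {morph sqz_emb : x / - x}. Proof. exact: raddfN. Qed.
Lemma sqz_emb0 : sqz_emb 0 = 0. Proof. by []. Qed.
Definition sqz_embE := (sqz_embD, sqz_embN, sqz_emb0, sqz_embZ).
End SquareZero.

(* Abstracting the atoms first keeps [ring] from comparing them up to        *)
(* conversion.                                                               *)
Ltac lmod := apply: sqz_emb_inj; rewrite ?sqz_embE;
  repeat match goal with |- context [@sqz_emb ?C ?W ?x] =>
    let y := fresh "y" in set y := (@sqz_emb C W x); clearbody y end;
  ring.

(** * Algebras presented by generators and relations *)

Local Open Scope quotient_scope.

Section WordMaps.
Variables (C : fieldType) (X : eqType).

Definition lin (W : lmodType C) (g : seq X -> W) (p : fa C X) : W :=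
  \sum_(cw <- p) cw.1 *: g cw.2.

Section Lin.
Variables (W : lmodType C).
Implicit Types (g : seq X -> W) (p q : fa C X).

Lemma lin_nil g : lin g [::] = 0. Proof. exact: big_nil. Qed.
Lemma lin_cons g cw p : lin g (cw :: p) = cw.1 *: g cw.2 + lin g p.
Proof. exact: big_cons. Qed.
Lemma lin_cat g p q : lin g (p ++ q) = lin g p + lin g q.
Proof. exact: big_cat. Qed.
Lemma lin_scale g c p : lin g (fa_scale c p) = c *: lin g p.
Proof.
rewrite /lin /fa_scale big_map scaler_sumr; apply: eq_bigr => i _ /=.
by rewrite scalerA.
Qed.
Lemma lin_sub g p q : lin g (fa_sub p q) = lin g p - lin g q.
Proof. by rewrite /fa_sub /fa_add lin_cat lin_scale scaleN1r. Qed.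
Lemma lin_flatten (T : Type) g (F : T -> fa C X) s :
  lin g (flatten [seq F i | i <- s]) = \sum_(i <- s) lin g (F i).
Proof.
elim: s => [|i s IH] /=; first by rewrite big_nil lin_nil.
by rewrite lin_cat big_cons IH.
Qed.
Lemma lin_mul g p q :
  lin g (fa_mul p q) = lin (fun u => lin (fun v => g (u ++ v)) q) p.
Proof.
rewrite /fa_mul /allpairs_dep; elim: p => [|a p IH] /=; first by rewrite !lin_nil.
rewrite lin_cat IH lin_cons; congr (_ + _).
rewrite /lin big_map scaler_sumr; apply: eq_bigr => i _ /=.
by rewrite scalerA.
Qed.
Lemma lin_ext g g' p : (forall w, g w = g' w) -> lin g p = lin g' p.
Proof. by move=> e; apply: eq_bigr => i _; rewrite e. Qed.
Lemma lin_exchange (Y : Type) (q : seq (C * Y)) (h : seq X -> Y -> W) p :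
  lin (fun u => \sum_(b <- q) b.1 *: h u b.2) p =
  \sum_(b <- q) b.1 *: lin (fun u => h u b.2) p.
Proof.
rewrite /lin; under eq_bigr do rewrite scaler_sumr.
rewrite exchange_big /=; apply: eq_bigr => b _; rewrite scaler_sumr.
by apply: eq_bigr => a _; rewrite !scalerA mulrC.
Qed.

Lemma lin_support g p (s : seq (seq X)) : uniq s ->
  {subset [seq cw.2 | cw <- p] <= s} ->
  lin g p = \sum_(w <- s) fa_coef p w *: g w.
Proof.
move=> us; elim: p => [|a p IH] sub.
  by rewrite lin_nil big1 // => w _; rewrite /fa_coef big_nil scale0r.
rewrite lin_cons IH; last by move=> w h; apply: sub; rewrite inE h orbT.
have as_ : a.2 \in s by apply: sub; rewrite inE eqxx.
under [RHS]eq_bigr => w _.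
  rewrite /fa_coef big_cons -/(fa_coef p w).
  have -> : (if a.2 == w then a.1 + fa_coef p w else fa_coef p w)
          = (a.2 == w)%:R * a.1 + fa_coef p w.
    by case: ifP => _; rewrite ?mul1r ?mul0r ?add0r.
  rewrite scalerDl.
over.
rewrite big_split /=; congr (_ + _).
rewrite (bigD1_seq a.2) //= eqxx mul1r big1 ?addr0 // => w.
by rewrite eq_sym => /negPf ->; rewrite mul0r scale0r.
Qed.

(** Formal sums denote the same element exactly when their coefficients agree, so this makes [lin g]
    well defined on the free algebra. *)
Lemma lin_coef g p q : (forall w, fa_coef p w = fa_coef q w) -> lin g p = lin g q.
Proof.
move=> e; pose s := undup ([seq cw.2 | cw <- p] ++ [seq cw.2 | cw <- q]).
have us : uniq s by apply: undup_uniq.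
rewrite !(@lin_support _ _ s us); first by apply: eq_bigr => w _; rewrite e.
  by move=> w h; rewrite mem_undup mem_cat h orbT.
by move=> w h; rewrite mem_undup mem_cat h.
Qed.

Lemma linD g g' p : lin (fun w => g w + g' w) p = lin g p + lin g' p.
Proof. by rewrite /lin -big_split; apply: eq_bigr => i _; rewrite scalerDr. Qed.

Lemma linZ c g p : lin (fun w => c *: g w) p = c *: lin g p.
Proof.
by rewrite /lin scaler_sumr; apply: eq_bigr => i _; rewrite !scalerA mulrC.
Qed.

Lemma linB g g' p : lin (fun w => g w - g' w) p = lin g p - lin g' p.
Proof.
rewrite linD; congr (_ + _); rewrite -scaleN1r -linZ.
by apply: lin_ext => w; rewrite scaleN1r.
Qed.

Lemma lin0 p : lin (fun=> 0 : W) p = 0.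
Proof. by rewrite /lin big1 // => i _; rewrite scaler0. Qed.
End Lin.

Lemma lin_raddf (W W' : lmodType C) (f : {linear W -> W'}) (g : seq X -> W) p :
  f (lin g p) = lin (f \o g) p.
Proof. by rewrite /lin linear_sum; apply: eq_bigr => i _; rewrite linearZ. Qed.

Lemma fa_coefE p w : fa_coef p w = lin (fun v => (v == w)%:R : C^o) p :> C.
Proof.
rewrite /fa_coef /lin big_mkcond; apply: eq_bigr => i _.
by rewrite /GRing.scale /=; case: ifP => _; rewrite ?mulr1 ?mulr0.
Qed.

Variables (I : Type) (rels : I -> fa C X).

(** Every linear map out of an enveloping algebra below (modes, translation, symbol functionals,
    evaluation) is built by checking this condition on words and passing to the quotient by
    [descend]. *)
Definition kills (W : lmodType C) (g : seq X -> W) :=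
  forall r u v, lin (fun w => g (u ++ w ++ v)) (rels r) = 0.

Lemma lin_ideal (W : lmodType C) (g : seq X -> W) p :
  kills g -> in_ideal rels p -> lin g p = 0.
Proof.
move=> kg [s es]; rewrite (lin_coef _ es) lin_flatten big1 // => -[[a r] b] _ /=.
rewrite lin_mul lin_mul -[RHS](@lin0 W a); apply: lin_ext => u.
pose h w v := g ((u ++ w) ++ v).
rewrite (@lin_exchange W _ b h).
by rewrite big1 // => v _; rewrite /h; under lin_ext do rewrite -catA; rewrite kg scaler0.
Qed.

Lemma kills_equiv (W : lmodType C) (g : seq X -> W) p q :
  kills g -> fa_equiv rels p q -> lin g p = lin g q.
Proof.
by move=> kg /(lin_ideal kg) /eqP; rewrite lin_sub subr_eq0 => /eqP.
Qed.

Lemma in_ideal0 p : (forall w, fa_coef p w = 0) -> in_ideal rels p.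
Proof. by move=> h; exists [::] => w; rewrite h /fa_coef big_nil. Qed.

Lemma in_ideal_coef p q : (forall w, fa_coef p w = fa_coef q w) ->
  in_ideal rels p -> in_ideal rels q.
Proof. by move=> e [s hs]; exists s => w; rewrite -e. Qed.

Lemma in_idealD p q : in_ideal rels p -> in_ideal rels q -> in_ideal rels (p ++ q).
Proof.
move=> [s hs] [t ht]; exists (s ++ t) => w.
by rewrite map_cat flatten_cat !fa_coefE !lin_cat -!fa_coefE hs ht.
Qed.

Lemma in_idealZ c p : in_ideal rels p -> in_ideal rels (fa_scale c p).
Proof.
move=> [s hs]; exists [seq (fa_scale c t.1.1, t.1.2, t.2) | t <- s] => w.
rewrite fa_coefE lin_scale -fa_coefE hs -map_comp /comp /= !fa_coefE !lin_flatten.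
rewrite scaler_sumr; apply: eq_bigr => -[[a r] b] _ /=.
by rewrite !lin_mul lin_scale.
Qed.

Lemma in_idealMl p q : in_ideal rels p -> in_ideal rels (fa_mul q p).
Proof.
move=> [s hs]; exists [seq (fa_mul q t.1.1, t.1.2, t.2) | t <- s] => w.
rewrite fa_coefE lin_mul.
under lin_ext => u do rewrite (lin_coef _ hs) lin_flatten.
rewrite -map_comp /comp /= fa_coefE lin_flatten.
have -> : forall (F : _ -> _ -> C^o),
    lin (fun u => \sum_(i <- s) F u i) q = \sum_(i <- s) lin (fun u => F u i) q.
  move=> F; rewrite /lin exchange_big /=; apply: eq_bigr => i _.
  by rewrite scaler_sumr.
apply: eq_bigr => -[[a r] b] _ /=.
rewrite !lin_mul; apply: (@lin_ext C^o) => u; rewrite !lin_mul.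
do 3 (apply: lin_ext => ?); by rewrite !catA.
Qed.

Lemma in_idealMr p q : in_ideal rels p -> in_ideal rels (fa_mul p q).
Proof.
move=> [s hs]; exists [seq (t.1.1, t.1.2, fa_mul t.2 q) | t <- s] => w.
rewrite fa_coefE lin_mul (lin_coef _ hs) lin_flatten -map_comp /comp /=.
rewrite fa_coefE lin_flatten; apply: eq_bigr => -[[a r] b] _ /=.
rewrite !lin_mul; apply: (@lin_ext C^o) => ?; apply: lin_ext => ?; rewrite ?lin_mul.
do 2 (apply: lin_ext => ?); by rewrite !catA.
Qed.

Lemma in_ideal_rel r : in_ideal rels (rels r).
Proof.
exists [:: (fa_one C X, r, fa_one C X)] => w; rewrite /= cats0 !fa_coefE.
rewrite !lin_mul /fa_one /lin !big_seq1 /= scale1r; apply: eq_bigr => a _.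
by rewrite big_seq1 scale1r cats0.
Qed.

End WordMaps.

Section Quotient.
Variables (C : fieldType) (X : choiceType) (I : Type) (rels : I -> fa C X).
Local Notation FA := (fa C X).

Lemma fa_equiv_refl p : fa_equiv rels p p.
Proof.
by apply: in_ideal0 => w; rewrite fa_coefE lin_sub subrr.
Qed.
Lemma fa_equiv_sym p q : fa_equiv rels p q -> fa_equiv rels q p.
Proof.
move=> /(in_idealZ (-1)); apply: in_ideal_coef => w.
by rewrite !fa_coefE lin_scale !lin_sub scaleN1r opprB.
Qed.
Lemma fa_equiv_trans p q r :
  fa_equiv rels p q -> fa_equiv rels q r -> fa_equiv rels p r.
Proof.
move=> h1 h2; move: (in_idealD h1 h2); apply: in_ideal_coef => w.
by rewrite !fa_coefE lin_cat !lin_sub addrA subrK.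
Qed.

Definition eqv_rel : rel FA := fun p q => `[< fa_equiv rels p q >].
Lemma eqv_equiv : equiv_class_of eqv_rel.
Proof.
split.
- by move=> p; apply/asboolP/fa_equiv_refl.
- by move=> p q; apply/asboolP/asboolP; apply: fa_equiv_sym.
- by move=> q p r /asboolP h1 /asboolP h2; apply/asboolP/(fa_equiv_trans h1).
Qed.
Canonical eqv_canon := EquivRelPack eqv_equiv.

Definition Uq := {eq_quot eqv_canon}.
HB.instance Definition _ := Choice.on Uq.
HB.instance Definition _ := EqQuotient.on Uq.

Definition upi (p : FA) : Uq := \pi_Uq p.

Lemma upiP p q : upi p = upi q <-> fa_equiv rels p q.
Proof.
rewrite /upi; split; first by move/eqmodP/asboolP.
by move=> h; apply/eqmodP/asboolP.
Qed.

Lemma upi_repr u : upi (repr u) = u. Proof. exact: reprK. Qed.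

Lemma upi_coef p q : (forall w, fa_coef p w = fa_coef q w) -> upi p = upi q.
Proof.
by move=> e; apply/upiP/in_ideal0 => w; rewrite fa_coefE lin_sub -!fa_coefE e subrr.
Qed.

Definition uadd (u v : Uq) := upi (repr u ++ repr v).
Definition umul (u v : Uq) := upi (fa_mul (repr u) (repr v)).
Definition uscale c (u : Uq) := upi (fa_scale c (repr u)).
Definition uopp := uscale (-1).

Lemma repr_upi p : fa_equiv rels (repr (upi p)) p.
Proof. by apply/upiP; rewrite upi_repr. Qed.

Lemma upiD p q : uadd (upi p) (upi q) = upi (p ++ q).
Proof.
apply/upiP; move: (in_idealD (repr_upi p) (repr_upi q)); apply: in_ideal_coef => w.
by rewrite !fa_coefE lin_cat !lin_sub !lin_cat opprD addrACA.
Qed.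
Lemma upiZ c p : uscale c (upi p) = upi (fa_scale c p).
Proof.
apply/upiP; move: (in_idealZ c (repr_upi p)); apply: in_ideal_coef => w.
by rewrite !fa_coefE lin_scale !lin_sub !lin_scale scalerBr.
Qed.
Lemma upiM p q : umul (upi p) (upi q) = upi (fa_mul p q).
Proof.
apply/upiP; move: (in_idealD (in_idealMr (repr (upi q)) (repr_upi p))
   (in_idealMl p (repr_upi q))); apply: in_ideal_coef => w.
rewrite !fa_coefE lin_cat !lin_sub !lin_mul lin_sub.
under [X in _ + X](@lin_ext _ _ C^o) => u do rewrite lin_sub.
rewrite linB; by rewrite addrA subrK.
Qed.

Lemma uqW (P : Uq -> Prop) : (forall p, P (upi p)) -> forall u, P u.
Proof. by move=> h u; rewrite -(upi_repr u). Qed.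

Local Ltac ucoef := apply: upi_coef => w; rewrite !fa_coefE.

Lemma uaddA : associative uadd.
Proof. by elim/uqW=> p; elim/uqW=> q; elim/uqW=> r; rewrite !upiD catA. Qed.
Lemma uaddC : commutative uadd.
Proof. by elim/uqW=> p; elim/uqW=> q; rewrite !upiD; ucoef; rewrite !lin_cat addrC. Qed.
Lemma uadd0 : left_id (upi [::]) uadd.
Proof. by elim/uqW=> p; rewrite !upiD. Qed.
Lemma uaddN : left_inverse (upi [::]) uopp uadd.
Proof.
by elim/uqW=> p; rewrite /uopp upiZ upiD; ucoef; rewrite lin_cat lin_scale lin_nil scaleN1r addNr.
Qed.
HB.instance Definition _ := GRing.isZmodule.Build Uq uaddA uaddC uadd0 uaddN.

Lemma umulA : associative umul.
Proof.
elim/uqW=> p; elim/uqW=> q; elim/uqW=> r; rewrite !upiM; ucoef; rewrite !lin_mul.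
apply: (@lin_ext _ _ C^o) => u; rewrite !lin_mul; do 2 apply: lin_ext => ?; by rewrite catA.
Qed.
Lemma umul1 : left_id (upi (fa_one C X)) umul.
Proof.
elim/uqW=> p; rewrite !upiM; ucoef; rewrite !lin_mul /fa_one lin_cons lin_nil.
by rewrite scale1r addr0.
Qed.
Lemma umulr1 : right_id (upi (fa_one C X)) umul.
Proof.
elim/uqW=> p; rewrite !upiM; ucoef; rewrite !lin_mul; apply: (@lin_ext _ _ C^o) => u.
by rewrite /fa_one lin_cons lin_nil scale1r addr0 cats0.
Qed.
Lemma umulDl : left_distributive umul uadd.
Proof.
by elim/uqW=> p; elim/uqW=> q; elim/uqW=> r; rewrite !(upiM, upiD); ucoef;
  rewrite !(lin_mul, lin_cat).
Qed.
Lemma umulDr : right_distributive umul uadd.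
Proof.
elim/uqW=> p; elim/uqW=> q; elim/uqW=> r; rewrite !(upiM, upiD); ucoef.
by rewrite !(lin_mul, lin_cat) -linD; apply: (@lin_ext _ _ C^o) => u; rewrite lin_cat.
Qed.
HB.instance Definition _ := GRing.Zmodule_isPzRing.Build Uq umulA umul1 umulr1 umulDl umulDr.

Lemma uscaleA a b u : uscale a (uscale b u) = uscale (a * b) u.
Proof. by elim/uqW: u=> p; rewrite !upiZ; ucoef; rewrite !lin_scale scalerA. Qed.
Lemma uscale1 : left_id 1 uscale.
Proof. by elim/uqW=> p; rewrite !upiZ; ucoef; rewrite !lin_scale scale1r. Qed.
Lemma uscaleDr : right_distributive uscale uadd.
Proof. by move=> c; elim/uqW=> p; elim/uqW=> q; rewrite !(upiZ, upiD); ucoef;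
  rewrite !(lin_scale, lin_cat) scalerDr. Qed.
Lemma uscaleDl u : {morph (fun c => uscale c u) : a b / a + b >-> uadd a b}.
Proof. by elim/uqW: u=> p a b; rewrite !(upiZ, upiD); ucoef;
  rewrite !(lin_scale, lin_cat) scalerDl. Qed.
HB.instance Definition _ := GRing.Zmodule_isLmodule.Build C Uq
  uscaleA uscale1 uscaleDr uscaleDl.

Lemma uscaleAl (a : C) (u v : Uq) : a *: (u * v) = (a *: u) * v.
Proof.
elim/uqW: u=> p; elim/uqW: v=> q; rewrite /GRing.scale /= /GRing.mul /= !(upiM, upiZ).
by ucoef; rewrite !(lin_scale, lin_mul).
Qed.
Lemma uscaleAr (a : C) (u v : Uq) : a *: (u * v) = u * (a *: v).
Proof.
elim/uqW: u=> p; elim/uqW: v=> q; rewrite /GRing.scale /= /GRing.mul /= !(upiM, upiZ).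
ucoef; rewrite !(lin_scale, lin_mul) -linZ; apply: (@lin_ext _ _ C^o) => u.
by rewrite lin_scale.
Qed.

Lemma upi_cat p q : upi (p ++ q) = upi p + upi q.
Proof. by rewrite -upiD. Qed.
Lemma upi_scale c p : upi (fa_scale c p) = c *: upi p.
Proof. by rewrite -upiZ. Qed.
Lemma upi_mul p q : upi (fa_mul p q) = upi p * upi q.
Proof. by rewrite -upiM. Qed.
Lemma upi_nil : upi [::] = 0. Proof. by []. Qed.

Definition let_ (x : X) : Uq := upi (fa_letter C x).
Definition word (w : seq X) : Uq := \prod_(x <- w) let_ x.

Lemma word_nil : word [::] = 1. Proof. exact: big_nil. Qed.
Lemma word_cons x w : word (x :: w) = let_ x * word w. Proof. exact: big_cons. Qed.
Lemma word_cat v w : word (v ++ w) = word v * word w. Proof. exact: big_cat. Qed.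

Lemma upi_word c w : upi [:: (c, w)] = c *: word w.
Proof.
have -> : [:: (c, w)] = fa_scale c [:: (1, w)] by rewrite /= mulr1.
rewrite upi_scale; congr (_ *: _); elim: w => [|x w IH]; first by rewrite word_nil.
by rewrite word_cons -IH /let_ -upi_mul /fa_mul /= mulr1.
Qed.

Lemma upi_lin p : upi p = lin word p.
Proof.
elim: p => [|[c w] p IH]; first by rewrite upi_nil lin_nil.
by rewrite -cat1s upi_cat IH upi_word lin_cat lin_cons lin_nil addr0.
Qed.

Lemma upi_rel r : upi (rels r) = 0.
Proof.
rewrite -upi_nil; apply/upiP; move: (in_ideal_rel rels r); apply: in_ideal_coef => w.
by rewrite !fa_coefE lin_sub lin_nil subr0.
Qed.

Lemma upi_ideal p : upi p = 0 <-> in_ideal rels p.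
Proof.
rewrite -upi_nil; split=> [/upiP|h]; first apply: in_ideal_coef => w.
  by rewrite !fa_coefE lin_sub lin_nil subr0.
by apply/upiP; apply: in_ideal_coef h => w; rewrite !fa_coefE lin_sub lin_nil subr0.
Qed.

Section Descent.
Variables (W : lmodType C) (g : seq X -> W).

(** The proof of [kills] is an argument so that the linear structure can be attached to the term
    itself. *)
Definition descend of kills rels g := fun u : Uq => lin g (repr u).

Variable kg : kills rels g.
Local Notation dsc := (descend kg).

Lemma descend_upi p : dsc (upi p) = lin g p.
Proof. by apply: kills_equiv kg _; apply: repr_upi. Qed.

Lemma descend_word w : dsc (word w) = g w.
Proof. by rewrite -[word w]scale1r -upi_word descend_upi lin_cons lin_nil addr0 scale1r. Qed.

Lemma descend_linear : linear dsc.
Proof.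
move=> c; elim/uqW => p; elim/uqW=> q.
by rewrite -upi_scale -upi_cat !descend_upi lin_cat lin_scale.
Qed.
HB.instance Definition _ := GRing.isLinear.Build C Uq W _ (descend kg) descend_linear.
End Descent.

Lemma uq_ind (P : Uq -> Prop) :
  (forall c w, P (c *: word w)) -> (forall u v, P u -> P v -> P (u + v)) -> forall u, P u.
Proof.
move=> hw hD; elim/uqW=> p; elim: p => [|[c w] p IH].
  by rewrite upi_nil -(scale0r (word [::])); apply: hw.
by rewrite -cat1s upi_cat upi_word; apply: hD.
Qed.

Lemma kills_word : kills rels word.
Proof.
move=> r u v; transitivity (word u * upi (rels r) * word v).
  rewrite upi_lin /lin mulr_sumr mulr_suml; apply: eq_bigr => i _.
  by rewrite !word_cat -uscaleAr -uscaleAl mulrA.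
by rewrite upi_rel mulr0 mul0r.
Qed.

End Quotient.
Arguments word {C X I} rels w.
Arguments let_ {C X I} rels x.
Arguments upi {C X I} rels p.

#[global] Opaque uadd umul uscale uopp upi Uq.

(** * The vacuum module at the critical level *)

Section MatrixUnits.
Variables (C : fieldType) (N : nat).
Implicit Types (A B D : 'M[C]_N).

Definition mlin (W : lmodType C) (f : 'I_N -> 'I_N -> W) A :=
  \sum_i \sum_j A i j *: f i j.
Lemma mlin_linear (W : lmodType C) (f : 'I_N -> 'I_N -> W) : linear (mlin f).
Proof.
move=> c A B; rewrite /mlin scaler_sumr -big_split; apply: eq_bigr => i _ /=.
rewrite scaler_sumr -big_split; apply: eq_bigr => j _ /=.
by rewrite !mxE scalerDl scalerA.
Qed.
HB.instance Definition _ (W : lmodType C) (f : 'I_N -> 'I_N -> W) :=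
  GRing.isLinear.Build C 'M[C]_N W _ (mlin f) (mlin_linear f).
Lemma mlin_delta (W : lmodType C) (f : 'I_N -> 'I_N -> W) i j :
  mlin f (delta_mx i j) = f i j.
Proof.
rewrite /mlin (bigD1 i) //= (bigD1 j) //= mxE !eqxx scale1r !big1 ?addr0 //.
  move=> k /negPf ki; rewrite big1 // => l _; by rewrite mxE ki scale0r.
by move=> k /negPf ki; rewrite mxE ki andbF scale0r.
Qed.
Lemma linear_mx_eq (W : lmodType C) (f g : 'M[C]_N -> W) :
  linear f -> linear g ->
  (forall i j, f (delta_mx i j) = g (delta_mx i j)) -> f =1 g.
Proof.
move=> lf lg e A.
pose F : {linear 'M[C]_N -> W} := HB.pack f (GRing.isLinear.Build _ _ _ _ f lf).
pose G : {linear 'M[C]_N -> W} := HB.pack g (GRing.isLinear.Build _ _ _ _ g lg).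
rewrite -[f A]/(F A) -[g A]/(G A) [A]matrix_sum_delta !linear_sum.
apply: eq_bigr => i _; rewrite !linear_sum; apply: eq_bigr => j _.
by rewrite !linearZ /= e.
Qed.

Definition brk A B := A *m B - B *m A.
(** The invariant form of the central extension, multiplied by the critical level -N. The identity
    matrix lies in its kernel. *)
Definition kap A B : C := \tr A * \tr B - N%:R * \tr (A *m B).

Lemma brk_jacobi A B D : brk (brk A B) D - brk (brk A D) B = brk A (brk B D).
Proof.
rewrite /brk !(mulmxBl, mulmxBr) !mulmxA.
move: (A *m B *m D) (B *m A *m D) (D *m A *m B) (D *m B *m A) (A *m D *m B)
  (B *m D *m A) => a b c d e f.
by apply/matrixP => i j; rewrite !mxE; ring.
Qed.
Lemma brk_linear_l B : linear (brk^~ B).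
Proof.
move=> c A D; rewrite /brk mulmxDl mulmxDr -scalemxAl -scalemxAr scalerBr opprD.
by rewrite addrACA.
Qed.
Lemma brk_anti A B : brk A B = - brk B A. Proof. by rewrite /brk opprB. Qed.
Lemma brk_linear_r B : linear (brk B).
Proof.
move=> c A D; rewrite !(brk_anti B) brk_linear_l; by rewrite opprD scalerN.
Qed.
HB.instance Definition _ B := GRing.isLinear.Build C 'M[C]_N 'M[C]_N _ (brk B) (brk_linear_r B).

Lemma brkBr A B D : brk A (B - D) = brk A B - brk A D.
Proof. exact: linearB. Qed.
Lemma brkZr A c B : brk A (c *: B) = c *: brk A B.
Proof. exact: linearZ. Qed.

Lemma kap_linear_r A : linear (kap A : 'M[C]_N -> C^o).
Proof.
move=> c B D; rewrite /kap mulmxDr -scalemxAr !mxtraceD !mxtraceZ /GRing.scale /=.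
by ring.
Qed.
HB.instance Definition _ B := GRing.isLinear.Build C 'M[C]_N C^o _ (kap B) (kap_linear_r B).
Lemma kapBr A B D : kap A (B - D) = kap A B - kap A D.
Proof. by rewrite /kap mulmxBr; do !rewrite (@linearB _ _ _ _ (@mxtrace C N)) /=; ring. Qed.
Lemma kapZr A c B : kap A (c *: B) = c * kap A B.
Proof. by rewrite /kap -scalemxAr !mxtraceZ; ring. Qed.
Lemma kapC A B : kap A B = kap B A.
Proof. by rewrite /kap mxtrace_mulC mulrC. Qed.
Lemma kap_linear_l B c A D : kap (c *: A + D) B = c * kap A B + kap D B.
Proof. by rewrite !(kapC _ B) kap_linear_r. Qed.

(** By invariance the three values of [kap] are equal up to sign, and their coefficients then add up
    to [m + a + b]. This is the cocycle identity of the affine algebra. *)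
Lemma kap_inv A B D (a b m : int) : m + a + b = 0 ->
  (m + a)%:~R * kap (brk A B) D - (m + b)%:~R * kap (brk A D) B
  - m%:~R * kap A (brk B D) = 0.
Proof.
move=> e; have -> : m = - (a + b) by rewrite -[LHS](addrK (a + b)) addrA e add0r.
have trB (X Y : 'M[C]_N) : \tr (X - Y) = \tr X - \tr Y by rewrite linearB.
rewrite /kap /brk !mulmxBl !mulmxBr !mulmxA !trB.
have -> : \tr (B *m A *m D) = \tr (A *m D *m B) by rewrite -mulmxA mxtrace_mulC.
have -> : \tr (D *m A *m B) = \tr (A *m B *m D) by rewrite -mulmxA mxtrace_mulC.
rewrite (mxtrace_mulC B A) (mxtrace_mulC D A) (mxtrace_mulC D B).
by rewrite !rmorphD /= !rmorphN !rmorphD /=; ring.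
Qed.

Lemma delta_brk i j k l : brk (delta_mx i j) (delta_mx k l) =
  (k == j)%:R *: delta_mx i l - (i == l)%:R *: delta_mx k j.
Proof.
rewrite /brk !mul_delta_mx_cond (eq_sym j) (eq_sym l).
by rewrite !scaler_nat.
Qed.

End MatrixUnits.

(* [loop_rel], [vac_act] and [gl_rel] with the complex numbers replaced by an *)
(* arbitrary field: over R[i], conversion would unfold complex numbers.       *)
Section OverField.
Variables (C : fieldType) (N : nat).
Local Notation delta a b := ((a == b)%:R : C).

Definition floop_rel (r : LP N * LP N) : fa C (LP N) :=
  let: ((i, j, a), (k, l, b)) := r in
  [:: (1, [:: (i, j, a); (k, l, b)]); (-1, [:: (k, l, b); (i, j, a)]);
      (- delta k j, [:: (i, l, (a + b).+1)]); (delta i l, [:: (k, j, (a + b).+1)])].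

Fixpoint fvac_act (w : seq (LP N)) (x : 'I_N * 'I_N * nat) {struct w} : fa C (LP N) :=
  match w with
  | [::] => [::]
  | y :: w' =>
    let: (i, j, r) := x in
    let: (k, l, n) := y in
    let rest := [seq (cw.1, y :: cw.2) | cw <- fvac_act w' x] in
    let br :=
      if (r < n.+1)%N then
        [:: (delta k j, (i, l, (n - r)%N) :: w'); (- delta i l, (k, j, (n - r)%N) :: w')]
      else
        fa_scale (delta k j) (fvac_act w' (i, l, (r - n.+1)%N)) ++
        fa_scale (- delta i l) (fvac_act w' (k, j, (r - n.+1)%N)) ++
        (if r == n.+1 then
           [:: ((r%:R : C) * (delta i j * delta k l - N%:R * delta k j * delta i l), w')]
         else [::])
    in br ++ rest
  end.

Definition fgl_rel (r : 'I_N * 'I_N * 'I_N * 'I_N) : fa C (GL N) :=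
  let: (i, j, k, l) := r in
  [:: (1, [:: E i j; E k l]); (-1, [:: E k l; E i j]);
      (- delta k j, [:: E i l]); (delta i l, [:: E k j])].
End OverField.

Section VacuumModule.
Variables (C : fieldType) (N : nat).
Local Notation V := (Uq (@floop_rel C N)).
Local Notation word := (word (@floop_rel C N)).
Local Notation let_ := (let_ (@floop_rel C N)).
Implicit Types (A B D : 'M[C]_N).

Definition ell n : 'M[C]_N -> V := mlin (fun i j => let_ (i, j, n)).
HB.instance Definition _ n := GRing.Linear.on (ell n).
Lemma ellB n A B : ell n (A - B) = ell n A - ell n B.
Proof. exact: linearB. Qed.
Lemma ellZ n c A : ell n (c *: A) = c *: ell n A.
Proof. exact: linearZ. Qed.
Lemma ellP n c A B : ell n (c *: A + B) = c *: ell n A + ell n B.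
Proof. exact: linearP. Qed.
Lemma ell_delta i j n : ell n (delta_mx i j) = let_ (i, j, n).
Proof. exact: mlin_delta. Qed.

Lemma let_comm i j a k l b :
  let_ (i,j,a) * let_ (k,l,b) = let_ (k,l,b) * let_ (i,j,a) +
    ell (a + b).+1 (brk (delta_mx i j) (delta_mx k l)).
Proof.
have := upi_rel (@floop_rel C N) ((i,j,a),(k,l,b)).
rewrite /floop_rel upi_lin !lin_cons lin_nil /= !word_cons !word_nil !mulr1.
rewrite delta_brk linearB !linearZ /= !ell_delta scale1r scaleN1r addr0 scaleNr => h.
by apply/eqP; rewrite -subr_eq0 -h; apply/eqP; lmod.
Qed.

Lemma ell_comm A B a b :
  ell a A * ell b B = ell b B * ell a A + ell (a + b).+1 (brk A B).
Proof.
move: B; apply: linear_mx_eq => [c X Y|c X Y|k l].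
- by rewrite ellP mulrDr -uscaleAr.
- by rewrite brk_linear_r !ellP mulrDl -uscaleAl; lmod.
move: A; apply: linear_mx_eq => [c X Y|c X Y|i j].
- by rewrite ellP mulrDl -uscaleAl.
- by rewrite brk_linear_l !ellP mulrDr -uscaleAr; lmod.
by rewrite !ell_delta let_comm.
Qed.

(* The value on the vector w|0> of the mode A[m] of an element A of gl_N,    *)
(* for m of either sign.                                                     *)
Definition opw (m : int) (w : seq (LP N)) (A : 'M[C]_N) : V :=
  match m with
  | Posz r => mlin (fun i j => upi (@floop_rel C N) (fvac_act C w (i, j, r))) A
  | Negz n => ell n A * word w
  end.
Lemma opw_linear m w : linear (opw m w).
Proof.
case: m => [r|n] c A B; rewrite /opw linearP //.
by rewrite mulrDl -uscaleAl.
Qed.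
HB.instance Definition _ m w := GRing.isLinear.Build C 'M[C]_N V _ (opw m w) (opw_linear m w).

Lemma opwB m w A B : opw m w (A - B) = opw m w A - opw m w B.
Proof. exact: linearB. Qed.
Lemma opwZ m w c A : opw m w (c *: A) = c *: opw m w A.
Proof. exact: linearZ. Qed.

Lemma upi_map_cons y (p : fa C (LP N)) :
  upi (@floop_rel C N) [seq (cw.1, y :: cw.2) | cw <- p] = let_ y * upi (@floop_rel C N) p.
Proof.
rewrite !upi_lin /lin big_map mulr_sumr; apply: eq_bigr => a _ /=.
by rewrite word_cons uscaleAr.
Qed.

Lemma opw_delta_pos r k l w :
  opw (Posz r) w (delta_mx k l) = upi (@floop_rel C N) (fvac_act C w (k, l, r)).
Proof. exact: mlin_delta. Qed.

(** Moving [A[m]] past the first letter costs a bracket and a central term. For negative [m] this is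
    the commutation relation of the algebra, for the other [m] the recursion of [fvac_act]; having
    one formula for both signs lets the relations be checked uniformly. *)
Lemma opw_cons m A i j n w : opw m ((i,j,n) :: w) A =
  ell n (delta_mx i j) * opw m w A + opw (m + Negz n) w (brk A (delta_mx i j))
  + ((m + Negz n == 0)%:R * m%:~R * kap A (delta_mx i j)) *: word w.
Proof.
case: m => [r|p]; last first.
  have -> : Negz p + Negz n = Negz (p + n).+1 by [].
  rewrite /= mul0r mul0r scale0r addr0 word_cons -ell_delta.
  by rewrite !mulrA -mulrDl ell_comm.
move: A; apply: linear_mx_eq => [c X Y|c X Y|k l].
- exact: opw_linear.
- rewrite brk_linear_l !opw_linear kap_linear_l mulrDr -uscaleAr /GRing.scale /= -/GRing.scale.
  by lmod.
rewrite !opw_delta_pos delta_brk ell_delta /=.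
rewrite upi_cat upi_map_cons addrC -addrA; congr (_ + _).
rewrite linearB !linearZ /=.
have -> : Posz r + Negz n = Posz r - Posz n.+1 by rewrite NegzE.
case: ltnP => h.
  have -> : Posz r - Posz n.+1 = Negz (n - r) by rewrite NegzE; lia.
  rewrite /= !mul0r scale0r addr0 upi_lin !lin_cons lin_nil /=.
  by rewrite !word_cons addr0 scaleNr !ell_delta scalerN.
have -> : Posz r - Posz n.+1 = Posz (r - n.+1) by rewrite subzn.
rewrite scalerN !opw_delta_pos !upi_cat !upi_scale scaleNr -addrA; do 2 congr (_ + _).
have -> : (Posz (r - n.+1) == 0) = (r == n.+1) by lia.
case: eqP => _; last by rewrite !mul0r scale0r upi_nil.
rewrite upi_word mul1r; congr (_ *: _); rewrite /kap mul_delta_mx_cond.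
have trd (a b : 'I_N) : \tr (delta_mx a b : 'M[C]_N) = (a == b)%:R.
  rewrite /mxtrace (bigD1 a) //= mxE eqxx big1 ?addr0 // => c /negPf ca.
  by rewrite mxE ca.
rewrite !trd raddfMn /= trd -[_ *+ (l == i)]mulr_natl (eq_sym l); ring.
Qed.

Lemma opw_jacobi m A e1 e2 a b v :
  opw (m + Negz a + Negz b) v (brk (brk A e1) e2)
  - opw (m + Negz b + Negz a) v (brk (brk A e2) e1)
  - opw (m + Negz (a + b).+1) v (brk A (brk e1 e2)) = 0.
Proof.
have -> : m + Negz b + Negz a = m + Negz a + Negz b by rewrite addrAC.
have -> : m + Negz (a + b).+1 = m + Negz a + Negz b by rewrite -addrA.
by rewrite -!opwB brk_jacobi subrr; apply: linear0.
Qed.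

Definition cen m n A B : C := (m + Negz n == 0)%:R * m%:~R * kap A B.

Lemma cen_jacobi m A e1 e2 a b :
  cen (m + Negz a) b (brk A e1) e2 - cen (m + Negz b) a (brk A e2) e1
  - cen m (a + b).+1 A (brk e1 e2) = 0.
Proof.
rewrite /cen.
have -> : m + Negz b + Negz a = m + Negz a + Negz b by rewrite addrAC.
have -> : m + Negz (a + b).+1 = m + Negz a + Negz b by rewrite -addrA.
case: eqP => [e|_]; last by rewrite !mul0r !subrr.
by rewrite !mul1r; apply: kap_inv.
Qed.

(** Once both letters are passed, what remains is the Jacobi identity for [brk] and the cocycle
    identity for [cen]. *)
Lemma opw_rel m A i j a k l b v :
  lin (fun w => opw m (w ++ v) A) (@floop_rel C N ((i,j,a),(k,l,b))) = 0.
Proof.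
pose e1 : 'M[C]_N := delta_mx i j; pose e2 : 'M[C]_N := delta_mx k l.
have h3 : (k == j)%:R *: opw m ((i,l,(a+b).+1) :: v) A
    - (i == l)%:R *: opw m ((k,j,(a+b).+1) :: v) A =
  ell (a+b).+1 (brk e1 e2) * opw m v A + opw (m + Negz (a+b).+1) v (brk A (brk e1 e2))
    + cen m (a+b).+1 A (brk e1 e2) *: word v.
  rewrite !opw_cons -![_ * kap _ _]/(cen _ _ _ _) /e1 /e2 delta_brk.
  rewrite /cen !(brkBr, brkZr) !(opwB, opwZ, ellB, ellZ, kapBr, kapZr) !mulrBl -!uscaleAl.
  by lmod.
transitivity (opw m ((i,j,a) :: (k,l,b) :: v) A - opw m ((k,l,b) :: (i,j,a) :: v) A
  - ((k == j)%:R *: opw m ((i,l,(a+b).+1) :: v) A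
    - (i == l)%:R *: opw m ((k,j,(a+b).+1) :: v) A)).
  by rewrite /floop_rel !lin_cons lin_nil /= scale1r scaleN1r addr0; lmod.
rewrite h3 !opw_cons -![_ * kap _ _]/(cen _ _ _ _) -/e1 -/e2 !word_cons -!ell_delta -/e1 -/e2.
have := opw_jacobi m A e1 e2 a b v.
rewrite -addrA -opprD => /eqP; rewrite subr_eq0 => /eqP ->.
have := cen_jacobi m A e1 e2 a b.
rewrite -addrA -opprD => /eqP; rewrite subr_eq0 => /eqP ->.
rewrite !mulrDr !mulrA (ell_comm e1 e2) mulrDl -!uscaleAr.
by lmod.
Qed.

Lemma opw_kills m A : kills (@floop_rel C N) (fun w => opw m w A).
Proof.
move=> [[[i j] a] [[k l] b]] u v; elim: u m A => [|[[p q] n] u IH] m A.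
  exact: opw_rel.
rewrite (lin_ext (g' := fun w => ell n (delta_mx p q) * opw m (u ++ w ++ v) A +
   (opw (m + Negz n) (u ++ w ++ v) (brk A (delta_mx p q)) +
    cen m n A (delta_mx p q) *: word (u ++ w ++ v)))); last first.
  by move=> w; rewrite /= opw_cons addrA.
rewrite !linD linZ kills_word scaler0 addr0 IH addr0.
have -> : forall g, lin (fun w => ell n (delta_mx p q) * g w) (floop_rel C ((i, j, a), (k, l, b)))
   = ell n (delta_mx p q) * lin g (floop_rel C ((i, j, a), (k, l, b))).
  by move=> g; rewrite /lin mulr_sumr; apply: eq_bigr => x _; rewrite uscaleAr.
by rewrite IH mulr0.
Qed.

(* The operator A[m] on the vacuum module V, identified with the algebra of  *)
(* negative modes through u |-> u|0>.                                        *)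
Definition op m A : V -> V := descend (@opw_kills m A).
HB.instance Definition _ m A := GRing.Linear.on (op m A).

Lemma op_word m A w : op m A (word w) = opw m w A.
Proof. exact: descend_word. Qed.
Lemma opD m A u v : op m A (u + v) = op m A u + op m A v.
Proof. exact: linearD. Qed.
Lemma opZ m A c u : op m A (c *: u) = c *: op m A u.
Proof. exact: linearZ. Qed.
Lemma op0 m A : op m A 0 = 0.
Proof. exact: linear0. Qed.
Lemma op_linear_mx m u : linear (fun A => op m A u).
Proof.
move=> c A B; move: u; elim/uq_ind => [a w|u v hu hv].
  by rewrite !opZ !op_word opw_linear; lmod.
by rewrite !opD hu hv; lmod.
Qed.
Lemma op_neg n A u : op (Negz n) A u = ell n A * u.
Proof.
move: u; elim/uq_ind => [c w|u v hu hv]; last by rewrite opD hu hv mulrDr.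
by rewrite opZ op_word -uscaleAr.
Qed.
Lemma op_vac r A : op (Posz r) A 1 = 0.
Proof.
rewrite -[1](word_nil (@floop_rel C N)) op_word /= /mlin.
by rewrite big1 // => i _; rewrite big1 // => j _; rewrite upi_nil scaler0.
Qed.
Lemma op_ell m A n B u : op m A (ell n B * u) =
  ell n B * op m A u + op (m + Negz n) (brk A B) u + cen m n A B *: u.
Proof.
move: B; apply: linear_mx_eq => [c X Y|c X Y|i j].
- by rewrite ellP mulrDl -uscaleAl opD opZ.
- rewrite ellP brk_linear_r op_linear_mx /cen kap_linear_r mulrDl -uscaleAl /GRing.scale /= -/GRing.scale.
  by lmod.
move: u; elim/uq_ind => [c w|u v hu hv].
  rewrite -uscaleAr !opZ ell_delta -word_cons !op_word opw_cons -uscaleAr.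
  by rewrite ell_delta; rewrite -[_ * kap _ _]/(cen _ _ _ _); lmod.
by rewrite mulrDr !opD hu hv mulrDr; lmod.
Qed.

Definition cz (m m' : int) A B : C := (m + m' == 0)%:R * m%:~R * kap A B.
Lemma cz_pos (r s : nat) A B : cz (Posz r) (Posz s) A B = 0.
Proof.
rewrite /cz; case: r => [|r]; first by rewrite mulr0 mul0r.
by rewrite mul0r mul0r.
Qed.

Lemma kap_brk A B D : kap A (brk B D) = kap (brk A B) D.
Proof.
have trB (X Y : 'M[C]_N) : \tr (X - Y) = \tr X - \tr Y by rewrite linearB.
have e : \tr (B *m A *m D) = \tr (A *m D *m B) by rewrite -mulmxA mxtrace_mulC.
rewrite /kap /brk mulmxBl mulmxBr !trB !mulmxA e (mxtrace_mulC B D) (mxtrace_mulC B A).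
by ring.
Qed.

Lemma op_comm_neg m A n B u : op m A (op (Negz n) B u) =
  op (Negz n) B (op m A u) + op (m + Negz n) (brk A B) u + cz m (Negz n) A B *: u.
Proof. by rewrite !op_neg op_ell. Qed.

(** Induction on the word: when both operators have passed the first letter, the brackets match by
    the Jacobi identity and the central terms by invariance of [kap]. Negative [m] is [op_ell]. *)
Lemma op_comm (r : nat) m A B u : op (Posz r) A (op m B u) =
  op m B (op (Posz r) A u) + op (Posz r + m) (brk A B) u + cz (Posz r) m A B *: u.
Proof.
move: u A B r m; elim/uq_ind => [c w|u v hu hv]; last first.
  by move=> A B r m; rewrite !opD hu hv; lmod.
elim: w c => [|[[i j] n] w IH] c A B r [s|p]; try exact: op_comm_neg.
  by rewrite !opZ word_nil -PoszD !op_vac !op0 cz_pos scale0r !scaler0 !addr0.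
have {}IH A' B' r' m' := IH 1 A' B' r' m'.
rewrite scale1r in IH; rewrite !opZ word_cons -ell_delta.
set e := delta_mx i j; set u := word w.
have h1 := IH A (brk B e) r (Posz s + Negz n).
have h2 := IH B (brk A e) s (Posz r + Negz n).
rewrite -scalerDr cz_pos scale0r addr0 !op_ell !opD.
congr (_ *: _); rewrite !op_ell !opZ -/u in h1 h2 *; rewrite h1 h2 (IH A B r s) cz_pos -/u.
have -> : Posz s + (Posz r + Negz n) = Posz r + Posz s + Negz n by rewrite addrCA addrA.
have -> : Posz r + (Posz s + Negz n) = Posz r + Posz s + Negz n by rewrite addrA.
have jac : brk A (brk B e) = brk B (brk A e) + brk (brk A B) e.
  by rewrite -(brk_jacobi A B e) (brk_anti B (brk A e)) addrC.
have czj : cz (Posz r) (Posz s + Negz n) A (brk B e) =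
    cz (Posz s) (Posz r + Negz n) B (brk A e) + cen (Posz r + Posz s) n (brk A B) e.
  rewrite /cen /cz [Posz s + (_ + _)]addrCA !addrA !kap_brk (brk_anti B A).
  have -> : kap (- brk A B) e = - kap (brk A B) e.
    by rewrite kapC -scaleN1r kapZr mulN1r kapC.
  by rewrite rmorphD /=; ring.
have opMD X Y : op (Posz r + Posz s + Negz n) (X + Y) u =
    op (Posz r + Posz s + Negz n) X u + op (Posz r + Posz s + Negz n) Y u.
  by rewrite -{1}[X]scale1r op_linear_mx scale1r.
rewrite jac opMD czj scale0r addr0 !mulrDr.
by lmod.
Qed.
End VacuumModule.

(** * The Feigin-Frenkel centre *)

Section Translation.
Variables (C : fieldType) (N : nat).
Local Notation V := (Uq (@floop_rel C N)).
Local Notation word := (word (@floop_rel C N)).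
Local Notation let_ := (let_ (@floop_rel C N)).
Local Notation ell := (@ell C N).
Local Notation op := (@op C N).
Implicit Types (A B D : 'M[C]_N) (u v : V).

(** The translation operator, that is, the derivation induced by -d/dt, which sends [E_ij t^(-n-1)]
    to [(n+1) E_ij t^(-n-2)] and kills the vacuum. *)
Fixpoint derw (w : seq (LP N)) : V :=
  match w with
  | [::] => 0
  | (i, j, n) :: w' =>
    (n.+1%:R *: ell n.+1 (delta_mx i j)) * word w' + let_ (i, j, n) * derw w'
  end.

Lemma derw_kills : kills (@floop_rel C N) derw.
Proof.
move=> [[[i j] a] [[k l] b]] u v; elim: u => [|[[p q] n] u IH].
  rewrite /floop_rel !lin_cons lin_nil /= scale1r scaleN1r addr0.
  rewrite -!ell_delta; set e1 := delta_mx i j; set e2 := delta_mx k l.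
  set u := word v; set d := derw v; set s := (a + b).+1.
  have h n : (k == j)%:R *: ell n (delta_mx i l) - (i == l)%:R *: ell n (delta_mx k j) =
     ell n (brk e1 e2) by rewrite delta_brk ellB !ellZ.
  transitivity (a.+1%:R *: (ell a.+1 e1 * ell b e2 * u) +
     ell a e1 * (b.+1%:R *: (ell b.+1 e2 * u)) + ell a e1 * ell b e2 * d
     - (b.+1%:R *: (ell b.+1 e2 * ell a e1 * u) +
     ell b e2 * (a.+1%:R *: (ell a.+1 e1 * u)) + ell b e2 * ell a e1 * d)
     - (s.+1%:R *: (ell s.+1 (brk e1 e2) * u) + ell s (brk e1 e2) * d)).
    rewrite -!h !mulrBl -!uscaleAl !word_cons -!ell_delta -/e1 -/e2 !mulrDr !mulrA.
    by lmod.
  rewrite -!uscaleAr !mulrA (ell_comm e1 e2 a b) (ell_comm e1 e2 a.+1 b) (ell_comm e1 e2 a b.+1).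
  rewrite !mulrDl addnS addSn /s -(addn1 a) -(addn1 b) -(addn1 (a + b).+1).
  rewrite -(addn1 (a + b)) !natrD.
  by lmod.
have lmull (g : seq (LP N) -> V) x r : lin (fun w => x * g w) (@floop_rel C N r) =
   x * lin g (@floop_rel C N r).
  by rewrite /lin mulr_sumr; apply: eq_bigr => y _; rewrite uscaleAr.
rewrite [LHS]linD (lmull (fun w => word (u ++ w ++ v))) (lmull (fun w => derw (u ++ w ++ v))).
by rewrite IH kills_word !mulr0 addr0.
Qed.

Definition der : V -> V := descend derw_kills.
HB.instance Definition _ := GRing.Linear.on der.
Lemma derD u v : der (u + v) = der u + der v. Proof. exact: linearD. Qed.
Lemma der0 : der 0 = 0. Proof. exact: linear0. Qed.
Lemma derZ c u : der (c *: u) = c *: der u. Proof. exact: linearZ. Qed.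
Lemma der_word w : der (word w) = derw w. Proof. exact: descend_word. Qed.
Lemma der1 : der 1 = 0.
Proof. by rewrite -[1](word_nil (@floop_rel C N)) der_word. Qed.

Lemma der_ell n A u : der (ell n A * u) = n.+1%:R *: (ell n.+1 A * u) + ell n A * der u.
Proof.
move: A; apply: linear_mx_eq => [c X Y|c X Y|i j].
- by rewrite ellP mulrDl -uscaleAl derD derZ.
- by rewrite !ellP !mulrDl -!uscaleAl; lmod.
move: u; elim/uq_ind => [c w|u v hu hv].
  by rewrite derZ -!uscaleAr derZ ell_delta -word_cons !der_word /= -uscaleAl; lmod.
by rewrite !mulrDr !derD hu hv !mulrDr; lmod.
Qed.

Lemma op_der m A u : op m A (der u) = der (op m A u) + m%:~R *: op (m - 1) A u.
Proof.
move: u A m; elim/uq_ind => [c w|u v hu hv]; last first.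
  by move=> A m; rewrite !opD !derD !opD hu hv; lmod.
move=> A m; rewrite !derZ !opZ !derZ.
rewrite scalerA mulrC -scalerA -scalerDr; congr (_ *: _).
have neg p A' u : op (Negz p) A' (der u) = der (op (Negz p) A' u) + (Negz p)%:~R *: op (Negz p - 1) A' u.
  have -> : Negz p - 1 = Negz p.+1 by rewrite !NegzE -opprD -PoszD addn1.
  by rewrite !op_neg der_ell NegzE; lmod.
elim: w A m => [|[[i j] n] w IH] A [r|p]; try exact: neg.
  rewrite word_nil der1 op0 op_vac; case: r => [|r]; first by rewrite scale0r der0 addr0.
  have -> : Posz r.+1 - 1 = Posz r by rewrite -addn1 PoszD addrK.
  by rewrite op_vac scaler0 der0 addr0.
rewrite word_cons -ell_delta; set e := delta_mx i j; set u := word w.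
rewrite der_ell opD opZ !op_ell derD derZ derD der_ell !IH -/u.
have -> : Posz r + Negz n.+1 = Posz r + Negz n - 1 by rewrite !NegzE -[in LHS]addn1 PoszD opprD addrA.
have -> : Posz r - 1 + Negz n = Posz r + Negz n - 1 by rewrite addrAC.
(* Both central terms can be non-zero only at [r = n + 2], where their factors agree. *)
have ce : n.+1%:R * cen (Posz r) n.+1 A e = (Posz r)%:~R * cen (Posz r - 1) n A e.
  have e2 : Posz r + Negz n.+1 = Posz r - 1 + Negz n by rewrite [RHS]addrAC !NegzE -[in LHS]addn1 PoszD opprD addrA.
  rewrite /cen e2; case: eqP => [h|_]; last by rewrite !mul0r !mulr0.
  have -> : Posz r - 1 = Posz n.+1 by move/eqP: h; rewrite NegzE subr_eq0 => /eqP.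
  by rewrite !mul1r mulrCA.
have -> : (Posz r + Negz n)%:~R = (Posz r)%:~R - n.+1%:R :> C by rewrite rmorphD NegzE rmorphN.
rewrite [n.+1%:R *: (_ + _)]scalerDr scalerA ce !mulrDr -!uscaleAr.
by lmod.
Qed.

(** The identity commutes with every matrix and lies in the kernel of [kap], so its non-negative
    modes pass through all letters and kill the vacuum. *)
Lemma op_smx r u : op (Posz r) 1%:M u = 0.
Proof.
move: u r; elim/uq_ind => [c w|u v hu hv] r; last by rewrite opD hu hv addr0.
rewrite opZ; suff -> : op (Posz r) 1%:M (word w) = 0 by rewrite scaler0.
elim: w r => [|[[i j] n] w IH] r; first by rewrite word_nil op_vac.
rewrite word_cons -ell_delta op_ell IH mulr0 add0r.
have -> : brk 1%:M (delta_mx i j) = 0 :> 'M[C]_N by rewrite /brk mul1mx mulmx1 subrr.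
have -> : cen (Posz r) n 1%:M (delta_mx i j) = 0 :> C.
  by rewrite /cen /kap mul1mx mxtrace1 subrr mulr0.
have h m : op m 0 (word w) = 0.
  by have := @op_linear_mx C N m (word w) (-1) 0 0; rewrite scaler0 addr0 scaleN1r addNr.
by rewrite h scale0r addr0.
Qed.

Definition FFu v := forall r A, op (Posz r) A v = 0.

(** For central [v], right multiplication by [v] is the endomorphism of the vacuum module that sends
    the vacuum to [v]. Hence the centre is closed under products. *)
Lemma op_mulr m A u v : FFu v -> op m A (u * v) = op m A u * v.
Proof.
move=> fv; move: u A m; elim/uq_ind => [c w|u u' hu hu'] A m; last first.
  by rewrite mulrDl !opD hu hu' mulrDl.
rewrite -uscaleAl !opZ -uscaleAl; congr (_ *: _).
elim: w A m => [|[[i j] n] w IH] A [r|p].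
- by rewrite word_nil mul1r op_vac fv mul0r.
- by rewrite word_nil !op_neg mul1r mulr1.
- rewrite word_cons -ell_delta -mulrA !op_ell !IH !mulrDl -uscaleAl !mulrA.
  by [].
- by rewrite !op_neg mulrA.
Qed.

Lemma FF1 : FFu 1. Proof. by move=> r A; rewrite op_vac. Qed.
Lemma FFD u v : FFu u -> FFu v -> FFu (u + v).
Proof. by move=> fu fv r A; rewrite opD fu fv addr0. Qed.
Lemma FFZ c u : FFu u -> FFu (c *: u).
Proof. by move=> fu r A; rewrite opZ fu scaler0. Qed.
Lemma FFM u v : FFu u -> FFu v -> FFu (u * v).
Proof. by move=> fu fv r A; rewrite op_mulr // fu mul0r. Qed.
Lemma FF_der u : FFu u -> FFu (der u).
Proof.
move=> fu [|r] A; first by rewrite op_der fu der0 scale0r addr0.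
have e : Posz r.+1 - 1 = Posz r by rewrite -addn1 PoszD addrK.
by rewrite op_der e !fu der0 scaler0 addr0.
Qed.

(* gl_N[t] is generated by its modes 0 and 1 together with the modes of the *)
(* identity matrix, which act by zero. *)
Lemma FF_01 v : [pchar C] =i pred0 ->
  (forall A, op 0 A v = 0) -> (forall A, op 1 A v = 0) -> FFu v.
Proof.
move=> ch h0 h1; case=> [//|]; elim=> [//|r IH] A.
(* Mode 1 bracketed with mode [r + 1] gives mode [r + 2] of every commutator, without central
   term. *)
have hb A' B' : op (Posz r.+2) (brk A' B') v = 0.
  have := op_comm 1 (Posz r.+1) A' B' v.
  by rewrite IH !h1 !op0 -PoszD add1n cz_pos scale0r addr0 add0r => <-.
have lin0 c X Y := @op_linear_mx C N (Posz r.+2) v c X Y.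
have off i j : i != j -> op (Posz r.+2) (delta_mx i j) v = 0.
  move=> ij; rewrite -[RHS](hb (delta_mx i i) (delta_mx i j)) delta_brk eqxx.
  by rewrite (negPf ij) scale1r scale0r subr0.
have dif i j : op (Posz r.+2) (delta_mx i i) v = op (Posz r.+2) (delta_mx j j) v.
  have := hb (delta_mx i j) (delta_mx j i); rewrite delta_brk !eqxx !scale1r.
  by rewrite addrC -scaleN1r lin0 scaleN1r addrC => /eqP; rewrite subr_eq0 => /eqP.
apply: (linear_mx_eq (f := fun A => op (Posz r.+2) A v) (g := fun=> 0)) => [||i j].
- exact: op_linear_mx.
- by move=> c X Y; rewrite scaler0 addr0.
case: (eqVneq i j) => [<-|]; last exact: off.
(* The diagonal units all act alike, and their sum acts by zero. *)
have : op (Posz r.+2) 1%:M v = N%:R *: op (Posz r.+2) (delta_mx i i) v.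
  pose F : {linear 'M[C]_N -> V} := HB.pack (fun A => op (Posz r.+2) A v)
    (GRing.isLinear.Build _ _ _ _ (fun A => op (Posz r.+2) A v) (@op_linear_mx C N (Posz r.+2) v)).
  rewrite -[LHS]/(F 1%:M).
  have -> : 1%:M = \sum_(k < N) delta_mx k k :> 'M[C]_N.
    by rewrite -diag_const_mx diag_mx_sum_delta; apply: eq_bigr => k _; rewrite mxE scale1r.
  rewrite linear_sum (eq_bigr (fun=> op (Posz r.+2) (delta_mx i i) v)); last first.
    by move=> k _; apply: dif.
  by rewrite sumr_const card_ord scaler_nat.
rewrite op_smx => /esym/eqP; rewrite scaler_eq0 => /orP[|/eqP //].
by move/pcharf0P: ch => ->; rewrite (gtn_eqF (leq_ltn_trans (leq0n i) (ltn_ord i))).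
Qed.
End Translation.

(** * Fock spaces *)

(* Words in T graded by length serve as a model of the eps-symmetric Fock   *)
(* space (bosons for eps = 1, fermions for eps = -1): cr i and an i are the *)
(* creation and annihilation operators.                                     *)
Section OneMode.
Variables (C : comNzRingType) (T : eqType) (eps : C).

Fixpoint crw (W : lmodType C) (i : T) (g : seq T -> W) (s : seq T) : W :=
  match s with
  | [::] => 0
  | x :: s' => (x == i)%:R *: g s' + eps *: crw i (fun t => g (x :: t)) s'
  end.
Definition cr (W : lmodType C) i (g : seq T -> W) : seq T -> W := crw i g.
Definition an (W : lmodType C) i (g : seq T -> W) : seq T -> W := fun s => g (i :: s).

Section Basic.
Variable W : lmodType C.
Implicit Types (g h : seq T -> W).

Lemma an_cr k i g : an k (cr i g) = (k == i)%:R *: g + eps *: cr i (an k g).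
Proof. by apply/funext => s. Qed.

Lemma cr_linear i : linear (@cr W i).
Proof.
move=> c g h; apply/funext => s; rewrite /cr; elim: s g h => [|x s IH] g h /=.
  by rewrite -[RHS]/(c *: 0 + 0 : W) scaler0 addr0.
rewrite -[RHS]/(c *: ((x == i)%:R *: g s + eps *: crw i (fun t => g (x :: t)) s) +
   ((x == i)%:R *: h s + eps *: crw i (fun t => h (x :: t)) s)).
have -> : (c *: g + h) s = c *: g s + h s by [].
have -> : (fun t => (c *: g + h) (x :: t)) = c *: (fun t => g (x :: t)) + (fun t => h (x :: t)) by [].
rewrite IH -[(_ *: crw i _ + _) s]/(c *: crw i (fun t => g (x :: t)) s + crw i (fun t => h (x :: t)) s).
by lmod.
Qed.
HB.instance Definition _ i := GRing.isLinear.Build C (seq T -> W) (seq T -> W) _ (@cr W i) (cr_linear i).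
Lemma crD i g h : cr i (g + h) = cr i g + cr i h. Proof. exact: linearD. Qed.
Lemma crZ i c g : cr i (c *: g) = c *: cr i g. Proof. exact: linearZ. Qed.
Lemma an_linear i : linear (@an W i). Proof. by []. Qed.
HB.instance Definition _ i := GRing.isLinear.Build C (seq T -> W) (seq T -> W) _ (@an W i) (an_linear i).
End Basic.

Definition symw (W : lmodType C) (g : seq T -> W) :=
  forall p k l s, g (p ++ k :: l :: s) = eps *: g (p ++ l :: k :: s).

Lemma symw_an (W : lmodType C) k (g : seq T -> W) : symw g -> symw (an k g).
Proof. by move=> sg p i j s; apply: (sg (k :: p)). Qed.

Lemma symw_swap (W : lmodType C) k l (g : seq T -> W) :
  symw g -> an k (an l g) = eps *: an l (an k g).
Proof. by move=> sg; apply/funext => s; apply: (sg [::]). Qed.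

Hypothesis eps2 : eps * eps = 1.

Lemma epsK (W : lmodType C) (z : W) : eps *: (eps *: z) = z.
Proof. by rewrite scalerA eps2 scale1r. Qed.

Lemma cr_cr (W : lmodType C) i j (g : seq T -> W) : cr i (cr j g) = eps *: cr j (cr i g).
Proof.
apply/funext => s; elim: s g => [|x s IH] g.
  by rewrite -[RHS]/(eps *: (0 : W)) scaler0.
rewrite -[LHS]/((x == i)%:R *: cr j g s + eps *: cr i (an x (cr j g)) s).
rewrite -[X in _ = eps *: X]/((x == j)%:R *: cr i g s + eps *: cr j (an x (cr i g)) s).
rewrite !an_cr !crD !crZ.
rewrite -[X in _ + eps *: X = _]/((x == j)%:R *: cr i g s + eps *: cr i (cr j (an x g)) s).
rewrite -[X in _ = eps *: (_ + eps *: X)]/((x == i)%:R *: cr j g s + eps *: cr j (cr i (an x g)) s).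
by rewrite IH !scalerDr !epsK addrCA.
Qed.

Lemma symw_cr (W : lmodType C) i (g : seq T -> W) : symw g -> symw (cr i g).
Proof.
move=> sg p; elim: p g sg => [|x p IH] g sg k l s.
  rewrite /= -[LHS]/((k == i)%:R *: g (l :: s) + eps *: ((l == i)%:R *: g (k :: s) +
    eps *: cr i (an l (an k g)) s)).
  rewrite -[X in _ = eps *: X]/((l == i)%:R *: g (k :: s) + eps *: ((k == i)%:R *: g (l :: s) +
    eps *: cr i (an k (an l g)) s)).
  rewrite (symw_swap l k sg) crZ -[(eps *: cr i _) s]/(eps *: cr i (an k (an l g)) s).
  by rewrite !scalerDr !epsK addrCA.
rewrite /= -[LHS]/((x == i)%:R *: g (p ++ k :: l :: s) + eps *: cr i (an x g) (p ++ k :: l :: s)).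
rewrite -[X in _ = eps *: X]/((x == i)%:R *: g (p ++ l :: k :: s) + eps *: cr i (an x g) (p ++ l :: k :: s)).
by rewrite (sg p) (IH (an x g) (symw_an x sg)); lmod.
Qed.

Lemma cr_comp (W W' : lmodType C) (h : {linear W -> W'}) i (g : seq T -> W) :
  cr i (h \o g) = h \o cr i g.
Proof.
apply/funext => s; elim: s g => [|x s IH] g; first by rewrite /= linear0.
rewrite -[LHS]/((x == i)%:R *: h (g s) + eps *: cr i (h \o an x g) s) IH.
by rewrite -[RHS]/(h ((x == i)%:R *: g s + eps *: cr i (an x g) s)) linearD !linearZ.
Qed.
End OneMode.

Section TwoModes.
Variables (C : comNzRingType) (T : finType) (eps : C) (V : lmodType C).
Local Notation M := (seq T -> seq T -> V).
Implicit Types (f g : M) (i j k l : T).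

Definition ca i f : M := cr eps i f.
Definition cb j f : M := fun s => cr eps j (f s).
Definition da i f : M := an i f.
Definition db j f : M := fun s => an j (f s).
Definition lf (h : V -> V) f : M := fun s t => h (f s t).
Definition flip f : M := fun s t => f t s.

Lemma ca_linear i : linear (ca i). Proof. by move=> c f g; apply: cr_linear. Qed.
HB.instance Definition _ i := GRing.isLinear.Build C M M _ (ca i) (ca_linear i).
Lemma da_linear i : linear (da i). Proof. by []. Qed.
HB.instance Definition _ i := GRing.isLinear.Build C M M _ (da i) (da_linear i).
Lemma cb_linear j : linear (cb j).
Proof. by move=> c f g; apply/funext => s; apply: cr_linear. Qed.
HB.instance Definition _ j := GRing.isLinear.Build C M M _ (cb j) (cb_linear j).
Lemma db_linear j : linear (db j). Proof. by []. Qed.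
HB.instance Definition _ j := GRing.isLinear.Build C M M _ (db j) (db_linear j).
Lemma lf_linear (h : {linear V -> V}) : linear (lf h).
Proof. by move=> c f g; apply/funext => s; apply/funext => t; rewrite /lf linearP. Qed.
HB.instance Definition _ (h : {linear V -> V}) := GRing.isLinear.Build C M M _ (lf h) (lf_linear h).

Lemma caD i f g : ca i (f + g) = ca i f + ca i g. Proof. exact: linearD. Qed.
Lemma caZ i c f : ca i (c *: f) = c *: ca i f. Proof. exact: linearZ. Qed.
Lemma cbD i f g : cb i (f + g) = cb i f + cb i g. Proof. exact: linearD. Qed.
Lemma cbZ i c f : cb i (c *: f) = c *: cb i f. Proof. exact: linearZ. Qed.
Lemma caB i f g : ca i (f - g) = ca i f - ca i g. Proof. exact: linearB. Qed.
Lemma cbB i f g : cb i (f - g) = cb i f - cb i g. Proof. exact: linearB. Qed.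
Lemma ca0 i : ca i 0 = 0. Proof. exact: linear0. Qed.
Lemma cb0 i : cb i 0 = 0. Proof. exact: linear0. Qed.
Lemma ca_sum i (J : Type) (r : seq J) (F : J -> M) :
  ca i (\sum_(x <- r) F x) = \sum_(x <- r) ca i (F x).
Proof. exact: linear_sum. Qed.
Lemma cb_sum i (J : Type) (r : seq J) (F : J -> M) :
  cb i (\sum_(x <- r) F x) = \sum_(x <- r) cb i (F x).
Proof. exact: linear_sum. Qed.
Lemma lf_sum (h : {linear V -> V}) (J : Type) (r : seq J) (F : J -> M) :
  lf h (\sum_(x <- r) F x) = \sum_(x <- r) lf h (F x).
Proof. exact: linear_sum. Qed.
Lemma lfZ (h : {linear V -> V}) c f : lf h (c *: f) = c *: lf h f.
Proof. exact: linearZ. Qed.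
Lemma flip_ca i f : flip (ca i f) = cb i (flip f).
Proof.
apply/funext => s; apply/funext => t; rewrite /flip /ca /cb.
have evl : linear (fun h : seq T -> V => h s) by [].
pose ev : {linear (seq T -> V) -> V} := HB.pack (fun h : seq T -> V => h s)
  (GRing.isLinear.Build _ _ _ _ (fun h : seq T -> V => h s) evl).
by have := cr_comp eps ev i f => /(congr1 (fun h => h t)) /= <-.
Qed.
Lemma flipK f : flip (flip f) = f. Proof. by []. Qed.

Lemma da_ca k i f : da k (ca i f) = (k == i)%:R *: f + eps *: ca i (da k f).
Proof. exact: an_cr. Qed.
Lemma db_cb k i f : db k (cb i f) = (k == i)%:R *: f + eps *: cb i (db k f).
Proof. by apply/funext => s; rewrite /db /cb an_cr. Qed.
Lemma da_cb k j f : da k (cb j f) = cb j (da k f). Proof. by []. Qed.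
Lemma db_ca k j f : db k (ca j f) = ca j (db k f).
Proof.
have anl : linear (@an C T V k) by exact: an_linear.
pose h : {linear (seq T -> V) -> (seq T -> V)} := HB.pack (@an C T V k)
  (GRing.isLinear.Build _ _ _ _ (@an C T V k) anl).
exact: (esym (cr_comp eps h j f)).
Qed.
Lemma ca_cb i j f : ca i (cb j f) = cb j (ca i f).
Proof.
have l : linear (@cr C T eps V j) by exact: cr_linear.
pose h : {linear (seq T -> V) -> (seq T -> V)} := HB.pack (@cr C T eps V j)
  (GRing.isLinear.Build _ _ _ _ (@cr C T eps V j) l).
exact: (cr_comp eps h i f).
Qed.
Lemma lf_da (h : V -> V) k f : lf h (da k f) = da k (lf h f). Proof. by []. Qed.
Lemma lf_db (h : V -> V) k f : lf h (db k f) = db k (lf h f). Proof. by []. Qed.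
Lemma lf_cb (h : {linear V -> V}) k f : lf h (cb k f) = cb k (lf h f).
Proof. by apply/funext => s; apply: (esym (cr_comp eps h k (f s))). Qed.
Lemma lf_ca (h : {linear V -> V}) k f : lf h (ca k f) = ca k (lf h f).
Proof.
by rewrite -[ca k f]flipK flip_ca -[RHS]flipK flip_ca -lf_cb.
Qed.

Hypothesis eps2 : eps * eps = 1.
Lemma ca_ca i j f : ca i (ca j f) = eps *: ca j (ca i f). Proof. exact: cr_cr. Qed.
Lemma cb_cb i j f : cb i (cb j f) = eps *: cb j (cb i f).
Proof. by apply/funext => s; rewrite /cb cr_cr. Qed.

Definition symf f := symw eps f /\ (forall s, symw eps (f s)).

Lemma symf_flip f : symf f -> symf (flip f).
Proof.
move=> [sa sb]; split=> [p k l s|t p k l s]; last by rewrite /flip sa.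
by apply/funext => t; rewrite /flip sb.
Qed.
Lemma symf_da k f : symf f -> symf (da k f).
Proof. by move=> [sa sb]; split=> [|s]; [apply: symw_an | apply: sb]. Qed.
Lemma symf_db k f : symf f -> symf (db k f).
Proof. by move=> /symf_flip /(symf_da k) /symf_flip. Qed.
Lemma symf_cb k f : symf f -> symf (cb k f).
Proof.
move=> [sa sb]; split=> [p i j s|s]; last by apply: symw_cr.
by rewrite /cb sa linearZ.
Qed.
Lemma symf_ca k f : symf f -> symf (ca k f).
Proof. by move=> /symf_flip /(symf_cb k) /symf_flip; rewrite -flip_ca flipK. Qed.
Lemma symf_lf (h : {linear V -> V}) f : symf f -> symf (lf h f).
Proof.
move=> [sa sb]; split=> [p i j s|s p i j t].
  by apply/funext => t; rewrite /lf sa -[in LHS]/(eps *: f _ t) linearZ.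
by rewrite /lf sb linearZ.
Qed.
Lemma symf0 : symf 0.
Proof. by split=> [p i j s|s p i j t]; rewrite scaler0. Qed.
Lemma symfD f g : symf f -> symf g -> symf (f + g).
Proof.
move=> [sa sb] [sa' sb']; split=> [p i j s|s p i j t].
  by rewrite -![(f + g) _]/(f _ + g _) sa sa' scalerDr.
by rewrite -![(f + g) _ _]/(f _ _ + g _ _) sb sb' scalerDr.
Qed.
Lemma symf_sum (I : Type) (r : seq I) (F : I -> M) :
  (forall x : I, symf (F x)) -> symf (\sum_(x <- r) F x).
Proof.
by move=> h; elim/big_ind: _ => //; [exact: symf0 | exact: symfD].
Qed.

(* The contraction of the a-modes with the b-modes in degree n *)
Fixpoint pr (n : nat) f : V :=
  match n with
  | 0 => f [::] [::]
  | n'.+1 => \sum_x pr n' (da x (db x f))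
  end.
Arguments pr : simpl never.
Lemma prS n f : pr n.+1 f = \sum_x pr n (da x (db x f)). Proof. by []. Qed.
Lemma pr_linear n : linear (pr n).
Proof.
elim: n => [//|n IH] c f g; rewrite !prS scaler_sumr -big_split; apply: eq_bigr => x _ /=.
by rewrite -IH.
Qed.
HB.instance Definition _ n := GRing.isLinear.Build C M V _ (pr n) (pr_linear n).
Lemma prD n f g : pr n (f + g) = pr n f + pr n g. Proof. exact: linearD. Qed.
Lemma prB n f g : pr n (f - g) = pr n f - pr n g. Proof. exact: linearB. Qed.
Lemma prZ n c f : pr n (c *: f) = c *: pr n f. Proof. exact: linearZ. Qed.
Lemma pr_flip n f : pr n (flip f) = pr n f.
Proof. by elim: n f => // n IH f; rewrite !prS; apply: eq_bigr => x _; rewrite -IH. Qed.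
Lemma pr_lf (h : {linear V -> V}) n f : pr n (lf h f) = h (pr n f).
Proof.
elim: n f => // n IH f; rewrite !prS linear_sum; apply: eq_bigr => x _.
by rewrite -IH.
Qed.

(** Under the contraction, creating [a_i] amounts to annihilating [b_i]. The factor counts the
    positions of the new letter, which contribute equally by symmetry. *)
Lemma pr_ca n i f : symf f -> pr n.+1 (ca i f) = n.+1%:R *: pr n (db i f).
Proof.
have one m : \sum_x (x == i)%:R *: pr m (db x f) = pr m (db i f).
  rewrite (bigD1 i) //= eqxx scale1r big1 ?addr0 // => x /negPf ->.
  by rewrite scale0r.
elim: n f one => [|n IH] f one sf.
  rewrite prS scale1r -[RHS]one; apply: eq_bigr => x _.
  rewrite db_ca da_ca prD prZ; rewrite -[X in _ + X]/(eps *: 0).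
  by rewrite scaler0 addr0.
rewrite prS (eq_bigr (fun x => (x == i)%:R *: pr n.+1 (db x f) +
    n.+1%:R *: pr n (da x (db x (db i f))))) => [|x _]; last first.
  rewrite db_ca da_ca prD !prZ IH; last by apply/symf_da/symf_db.
    congr (_ + _); rewrite scalerA mulrC -scalerA; congr (_ *: _).
    have -> : db i (da x (db x f)) = eps *: da x (db x (db i f)).
      apply/funext => s; rewrite -[LHS]/(an i (an x (f (x :: s)))).
      by rewrite (symw_swap i x (proj2 sf (x :: s))).
    by rewrite prZ scalerA eps2 scale1r.
  move=> m; rewrite (bigD1 i) //= eqxx scale1r big1 ?addr0 // => y /negPf ->.
  by rewrite scale0r.
by rewrite big_split /= -scaler_sumr -prS one [in RHS]mulrSr scalerDl scale1r addrC.
Qed.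

Lemma pr_cb n i f : symf f -> pr n.+1 (cb i f) = n.+1%:R *: pr n (da i f).
Proof.
move=> /symf_flip sf; rewrite -[f]flipK -flip_ca pr_flip pr_ca // -pr_flip.
by [].
Qed.

Definition kp f : M := \sum_i ca i (cb i f).
Lemma kp_linear : linear kp.
Proof.
move=> c f g; rewrite /kp scaler_sumr -big_split; apply: eq_bigr => i _ /=.
by rewrite !linearP.
Qed.
HB.instance Definition _ := GRing.isLinear.Build C M M _ kp kp_linear.
Lemma kpD f g : kp (f + g) = kp f + kp g. Proof. exact: linearD. Qed.
Lemma kp0 : kp 0 = 0. Proof. exact: linear0. Qed.
Lemma kpB f g : kp (f - g) = kp f - kp g. Proof. exact: linearB. Qed.
Lemma kpZ c f : kp (c *: f) = c *: kp f. Proof. exact: linearZ. Qed.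
Lemma symf_kp f : symf f -> symf (kp f).
Proof. by move=> sf; apply: symf_sum => i; apply/symf_ca/symf_cb. Qed.

(** The new pair of equal indices either is contracted with itself, which gives the dimension, or is
    linked to one of the [n] others, each time with the sign [eps]. *)
Lemma pr_kp n f : symf f -> pr n.+1 (kp f) = (n.+1%:R * (#|T|%:R + eps * n%:R)) *: pr n f.
Proof.
move=> sf; rewrite /kp linear_sum (eq_bigr (fun i => n.+1%:R *: pr n f + (n.+1%:R * eps)*: pr n (cb i (db i f)))).
  rewrite big_split /= sumr_const -scaler_sumr; case: n => [|n].
    rewrite big1 ?scaler0 ?addr0 => [|i _]; last by [].
    by rewrite -scaler_nat scale1r mul1r mulr0 addr0.
  rewrite (eq_bigr (fun i => n.+1%:R *: pr n (da i (db i f)))) => [|i _]; last first.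
    by apply: pr_cb; apply: symf_db.
  rewrite -scaler_sumr -prS -scaler_nat.
  by lmod.
move=> i _; rewrite [LHS]/= pr_ca; last exact: symf_cb.
by rewrite db_cb eqxx scale1r prD prZ scalerDr scalerA.
Qed.

Lemma kp_ca l f : ca l (kp f) = eps *: kp (ca l f).
Proof.
rewrite /kp linear_sum scaler_sumr; apply: eq_bigr => i _ /=.
by rewrite ca_ca ca_cb.
Qed.
Lemma kp_cb l f : cb l (kp f) = eps *: kp (cb l f).
Proof.
rewrite /kp linear_sum scaler_sumr; apply: eq_bigr => i _ /=.
by rewrite -ca_cb cb_cb linearZ.
Qed.

Definition vac (v : V) : M := fun s t => if nilp s && nilp t then v else 0.
Lemma da_vac k v : da k (vac v) = 0. Proof. by []. Qed.
Lemma db_vac k v : db k (vac v) = 0.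
Proof. by apply/funext => s; apply/funext => t; rewrite /db /an /vac andbF. Qed.
Lemma symf_vac v : symf (vac v).
Proof.
have ea p k l s : vac v (p ++ k :: l :: s) = 0 by case: p.
have eb s p k l t : vac v s (p ++ k :: l :: t) = 0.
  by rewrite /vac; case: p => [|? ?]; rewrite andbF.
by split=> [p k l s|s p k l t]; rewrite ?ea ?eb scaler0.
Qed.

(* The operator sum_ij L_ij a_i b_j attached to a matrix of operators *)
Section LL.
Variable L : T -> T -> {linear V -> V}.

Definition LY k f : M := \sum_j cb j (lf (L k j) f).
Definition LZ l f : M := \sum_i ca i (lf (L i l) f).
Definition LL f : M := \sum_i ca i (LY i f).

Lemma LY_linear k : linear (LY k).
Proof.
move=> c f g; rewrite /LY scaler_sumr -big_split; apply: eq_bigr => i _ /=.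
by rewrite !linearP.
Qed.
HB.instance Definition _ k := GRing.isLinear.Build C M M _ (LY k) (LY_linear k).
Lemma LZ_linear k : linear (LZ k).
Proof.
move=> c f g; rewrite /LZ scaler_sumr -big_split; apply: eq_bigr => i _ /=.
by rewrite !linearP.
Qed.
HB.instance Definition _ k := GRing.isLinear.Build C M M _ (LZ k) (LZ_linear k).
Lemma LL_linear : linear LL.
Proof.
move=> c f g; rewrite /LL scaler_sumr -big_split; apply: eq_bigr => i _ /=.
by rewrite !linearP.
Qed.
HB.instance Definition _ := GRing.isLinear.Build C M M _ LL LL_linear.

Lemma LL_Z f : LL f = \sum_j cb j (LZ j f).
Proof.
rewrite /LL /LY /LZ; under eq_bigr do rewrite linear_sum.
rewrite exchange_big /=; apply: eq_bigr => j _; rewrite linear_sum.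
by apply: eq_bigr => i _; rewrite ca_cb.
Qed.

Lemma LL_sum f : LL f = \sum_i \sum_j ca i (cb j (lf (L i j) f)).
Proof. by apply: eq_bigr => i _; rewrite linear_sum. Qed.
Lemma LLD f g : LL (f + g) = LL f + LL g. Proof. exact: linearD. Qed.
Lemma LL0 : LL 0 = 0. Proof. exact: linear0. Qed.
Lemma LLB f g : LL (f - g) = LL f - LL g. Proof. exact: linearB. Qed.
Lemma LLZ c f : LL (c *: f) = c *: LL f. Proof. exact: linearZ. Qed.
Lemma ca_LY l k f : ca l (LY k f) = \sum_j ca l (cb j (lf (L k j) f)).
Proof. exact: linear_sum. Qed.
Lemma cb_LZ l k f : cb l (LZ k f) = \sum_i ca i (cb l (lf (L i k) f)).
Proof. by rewrite linear_sum; apply: eq_bigr => i _; rewrite /= ca_cb. Qed.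

Lemma symf_LY k f : symf f -> symf (LY k f).
Proof. by move=> sf; apply: symf_sum => i; apply/symf_cb/symf_lf. Qed.
Lemma symf_LL f : symf f -> symf (LL f).
Proof. by move=> sf; apply: symf_sum => i; apply/symf_ca/symf_LY. Qed.

Lemma LY_ca k l f : LY k (ca l f) = ca l (LY k f).
Proof. by rewrite /LY linear_sum; apply: eq_bigr => j _; rewrite /= lf_ca -ca_cb. Qed.
Lemma LY_da k l f : LY k (da l f) = da l (LY k f).
Proof. by rewrite /LY linear_sum; apply: eq_bigr => j _; rewrite /= lf_da da_cb. Qed.
Lemma LZ_cb k l f : LZ k (cb l f) = cb l (LZ k f).
Proof. by rewrite /LZ linear_sum; apply: eq_bigr => j _; rewrite /= lf_cb ca_cb. Qed.
Lemma LZ_db k l f : LZ k (db l f) = db l (LZ k f).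
Proof. by rewrite /LZ linear_sum; apply: eq_bigr => j _; rewrite /= lf_db db_ca. Qed.

Lemma da_LL k f : da k (LL f) = LY k f + eps *: LL (da k f).
Proof.
rewrite /LL linear_sum (eq_bigr (fun i => (k == i)%:R *: LY i f + eps *: ca i (LY i (da k f)))).
  rewrite big_split /= -scaler_sumr (bigD1 k) //= eqxx scale1r big1 ?addr0 // => i.
  by rewrite eq_sym => /negPf ->; rewrite scale0r.
by move=> i _; rewrite [LHS]/= da_ca LY_da.
Qed.
Lemma db_LL k f : db k (LL f) = LZ k f + eps *: LL (db k f).
Proof.
rewrite !LL_Z linear_sum (eq_bigr (fun i => (k == i)%:R *: LZ i f + eps *: cb i (LZ i (db k f)))).
  rewrite big_split /= -scaler_sumr (bigD1 k) //= eqxx scale1r big1 ?addr0 // => i.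
  by rewrite eq_sym => /negPf ->; rewrite scale0r.
by move=> i _; rewrite [LHS]/= db_cb LZ_db.
Qed.
Lemma ca_LL k f : ca k (LL f) = eps *: LL (ca k f).
Proof.
rewrite /LL linear_sum scaler_sumr; apply: eq_bigr => i _ /=.
by rewrite ca_ca LY_ca.
Qed.
Lemma cb_LL k f : cb k (LL f) = eps *: LL (cb k f).
Proof.
rewrite !LL_Z linear_sum scaler_sumr; apply: eq_bigr => i _ /=.
by rewrite cb_cb LZ_cb.
Qed.
Lemma LL_ca k f : LL (ca k f) = eps *: ca k (LL f).
Proof. by rewrite ca_LL scalerA eps2 scale1r. Qed.
Lemma LL_cb k f : LL (cb k f) = eps *: cb k (LL f).
Proof. by rewrite cb_LL scalerA eps2 scale1r. Qed.
Lemma LL_ab k l f : LL (ca k (cb l f)) = ca k (cb l (LL f)).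
Proof. by rewrite LL_ca LL_cb linearZ scalerA eps2 scale1r. Qed.
Lemma LL_kp f : LL (kp f) = kp (LL f).
Proof. by rewrite /kp linear_sum; apply: eq_bigr => i _; rewrite [LHS]/= LL_ab. Qed.

Definition FF (v : V) n : M := iter n LL (vac v).
Lemma symf_FF v n : symf (FF v n).
Proof. by elim: n => [|n IH]; [apply: symf_vac | apply: symf_LL]. Qed.

(** Each [LL] raises the degree by one, so the number operator has eigenvalue [n]. *)
Lemma degb_FF v n : \sum_j cb j (db j (FF v n)) = n%:R *: FF v n.
Proof.
elim: n => [|n IH]; first by rewrite scale0r big1 // => j _; rewrite db_vac linear0.
rewrite /= (eq_bigr (fun j => cb j (LZ j (FF v n)) + LL (cb j (db j (FF v n))))).
  by rewrite big_split /= -LL_Z -linear_sum IH linearZ /= mulrSr scalerDl scale1r addrC.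
by move=> j _; rewrite db_LL cbD cbZ cb_LL scalerA eps2 scale1r.
Qed.
Lemma dega_FF v n : \sum_j ca j (da j (FF v n)) = n%:R *: FF v n.
Proof.
elim: n => [|n IH]; first by rewrite scale0r big1 // => j _; rewrite da_vac linear0.
rewrite /= (eq_bigr (fun j => ca j (LY j (FF v n)) + LL (ca j (da j (FF v n))))).
  by rewrite big_split /= -linear_sum IH linearZ /= mulrSr scalerDl scale1r addrC.
by move=> j _; rewrite da_LL caD caZ ca_LL scalerA eps2 scale1r.
Qed.
End LL.

Lemma ab_comm i j k l f : ca i (cb j (ca k (cb l f))) = ca k (cb l (ca i (cb j f))).
Proof. by rewrite -!(ca_cb i) -!(ca_cb k) (ca_ca i k) (cb_cb j l) !caZ epsK. Qed.

(** The products [a_i b_j] commute for both signs, by [ab_comm], so only the operator entries could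
    obstruct. *)
Lemma LL_comm (L L' : T -> T -> {linear V -> V}) f :
  (forall i j k l u, L i j (L' k l u) = L' k l (L i j u)) -> LL L (LL L' f) = LL L' (LL L f).
Proof.
move=> cLL; rewrite !LL_sum.
transitivity (\sum_i \sum_j \sum_k \sum_l ca i (cb j (ca k (cb l (lf (L i j) (lf (L' k l) f)))))).
  apply: eq_bigr => i _; apply: eq_bigr => j _.
  rewrite lf_sum cb_sum ca_sum; apply: eq_bigr => k _.
  rewrite lf_sum cb_sum ca_sum; apply: eq_bigr => l _.
  by rewrite lf_ca lf_cb.
transitivity (\sum_i \sum_j \sum_k \sum_l ca k (cb l (ca i (cb j (lf (L' k l) (lf (L i j) f)))))).
  apply: eq_bigr => i _; apply: eq_bigr => j _; apply: eq_bigr => k _; apply: eq_bigr => l _.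
  rewrite ab_comm; congr (ca _ (cb _ (ca _ (cb _ _)))); apply/funext => s; apply/funext => t.
  exact: cLL.
under eq_bigr => i _ do rewrite exchange_big /=.
rewrite exchange_big /=; apply: eq_bigr => k _.
under eq_bigr => i _ do rewrite exchange_big /=.
rewrite exchange_big /=; apply: eq_bigr => l _.
rewrite lf_sum cb_sum ca_sum; apply: eq_bigr => i _.
rewrite lf_sum cb_sum ca_sum; apply: eq_bigr => j _.
by rewrite lf_ca lf_cb.
Qed.
End TwoModes.

#[global] Arguments pr : simpl never.

(** * Segal-Sugawara vectors *)

Section SegalSugawara.
Variables (C : fieldType) (N : nat) (eps : C).
Hypothesis eps1 : (eps == 1) || (eps == -1).
Local Notation V := (Uq (@floop_rel C N)).
Local Notation I := 'I_N.
Local Notation M := (seq I -> seq I -> V).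
Local Notation ell := (@ell C N).
Local Notation op := (@op C N).
Local Notation D i j := (delta_mx i j : 'M[C]_N).
Implicit Types (f g : M) (i j k l : I) (u : V).

Let eps2 : eps * eps = 1.
Proof. by case/orP: eps1 => /eqP ->; rewrite ?mulrNN mulr1. Qed.

(* [Lop] is T + E[-1] and [ssv m] is the trace of its m-th power over the     *)
(* antisymmetric (eps = -1) or symmetric (eps = 1) tensors, up to a factor.   *)
Definition Lop i j u : V := (i == j)%:R *: der u + ell 0 (D i j) * u.
Lemma Lop_linear i j : linear (Lop i j).
Proof. by move=> c u v; rewrite /Lop derD derZ mulrDr -uscaleAr; lmod. Qed.
HB.instance Definition _ i j := GRing.isLinear.Build C V V _ (Lop i j) (Lop_linear i j).

Lemma op_mxB m A B u : op m (A - B) u = op m A u - op m B u.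
Proof. by rewrite addrC -scaleN1r op_linear_mx scaleN1r addrC. Qed.
Lemma op_mxZ m c A u : op m (c *: A) u = c *: op m A u.
Proof.
rewrite -[c *: A]addr0 op_linear_mx -[in X in _ + X](subrr (0 : 'M[C]_N)) op_mxB subrr.
by rewrite addr0.
Qed.

Lemma op0_Lop k l i j u : op 0 (D k l) (Lop i j u) = Lop i j (op 0 (D k l) u)
  + (i == l)%:R *: Lop k j u - (k == j)%:R *: Lop i l u.
Proof.
have e0 : (Posz 0)%:~R *: op (Posz 0 - 1) (D k l) u = 0 by rewrite scale0r.
rewrite /Lop opD opZ op_der op_ell e0 addr0 delta_brk add0r op_neg ellB !ellZ mulrBl -!uscaleAl.
have -> : cen 0 0 (D k l) (D i j) = 0 by rewrite /cen mulr0 mul0r.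
rewrite scale0r addr0.
case: (eqVneq i l) => [->|il]; case: (eqVneq k j) => [->|kj].
- by rewrite eq_sym; lmod.
- by lmod.
- by rewrite eq_sym; lmod.
by lmod.
Qed.

(** Mode 1 meets the translation, which yields mode 0, and [E[-1]], which yields a bracket in mode 0
    and the central term at level -N. *)
Lemma op1_Lop k l i j u : op 1 (D k l) (Lop i j u) = Lop i j (op 1 (D k l) u)
  + (i == j)%:R *: op 0 (D k l) u + (i == l)%:R *: op 0 (D k j) u
  - (k == j)%:R *: op 0 (D i l) u
  + ((k == l)%:R * (i == j)%:R - N%:R * ((i == l)%:R * (k == j)%:R)) *: u.
Proof.
rewrite /Lop opD opZ op_der op_ell delta_brk subrr scale1r.
rewrite op_mxB !op_mxZ.
have -> : cen 1 0 (D k l) (D i j) = (k == l)%:R * (i == j)%:R - N%:R * ((i == l)%:R * (k == j)%:R).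
  rewrite /cen /kap !mul1r mul_delta_mx_cond.
  have trd (a b : I) : \tr (D a b) = (a == b)%:R.
    rewrite /mxtrace (bigD1 a) //= mxE eqxx big1 ?addr0 // => c /negPf ca.
    by rewrite mxE ca.
  by rewrite !trd raddfMn /= trd -[_ *+ (l == i)]mulr_natl (eq_sym l).
by lmod.
Qed.

(** The translation against [E[-1]] and [E[-1]] against itself both land in mode -2; the first gives
    the two diagonal terms. *)
Lemma Lop_comm i j k l u : Lop i j (Lop k l u) - Lop k l (Lop i j u) =
  (i == j)%:R *: (ell 1 (D k l) * u) - (k == l)%:R *: (ell 1 (D i j) * u)
  + (k == j)%:R *: (ell 1 (D i l) * u) - (i == l)%:R *: (ell 1 (D k j) * u).
Proof.
rewrite /Lop !derD !derZ !der_ell !mulrDr -!uscaleAr !mulrA (ell_comm (D i j)) mulrDl.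
rewrite delta_brk ellB !ellZ mulrBl -!uscaleAl.
by lmod.
Qed.

Local Notation ca := (@ca C I eps V).
Local Notation cb := (@cb C I eps V).
Local Notation da := (@da C I V).
Local Notation db := (@db C I V).
Local Notation LL := (LL eps (fun i j => Lop i j : {linear V -> V})).
Local Notation LY := (LY eps (fun i j => Lop i j : {linear V -> V})).
Local Notation LZ := (LZ eps (fun i j => Lop i j : {linear V -> V})).
Local Notation FF := (FF eps (fun i j => Lop i j : {linear V -> V}) 1).
Local Notation kp := (kp eps).

Definition Dkl k l f : M := ca l (da k f) - cb k (db l f).

Lemma sum_delta (W : lmodType C) (k : I) (F : I -> W) : \sum_i (i == k)%:R *: F i = F k.
Proof.
rewrite (bigD1 k) //= eqxx scale1r big1 ?addr0 // => i /negPf ->.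
by rewrite scale0r.
Qed.

Lemma lfE_Lop k l i j f : lf (op 0 (D k l)) (lf (Lop i j) f) =
  lf (Lop i j) (lf (op 0 (D k l)) f)
  + (i == l)%:R *: lf (Lop k j) f - (j == k)%:R *: lf (Lop i l) f.
Proof. by apply/funext => s; apply/funext => t; rewrite (eq_sym j); apply: op0_Lop. Qed.

Lemma lfE_LL k l f : lf (op 0 (D k l)) (LL f) = LL (lf (op 0 (D k l)) f)
  + ca l (LY k f) - cb k (LZ l f).
Proof.
rewrite !LL_sum lf_sum.
transitivity (\sum_i \sum_j (ca i (cb j (lf (Lop i j) (lf (op 0 (D k l)) f)))
  + (i == l)%:R *: ca i (cb j (lf (Lop k j) f))
  - (j == k)%:R *: ca i (cb j (lf (Lop i l) f)))).
  apply: eq_bigr => i _; rewrite lf_sum; apply: eq_bigr => j _.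
  by rewrite lf_ca lf_cb lfE_Lop cbB cbD !cbZ caB caD !caZ.
rewrite (eq_bigr (fun i => (\sum_j ca i (cb j (lf (Lop i j) (lf (op 0 (D k l)) f)))
   + (i == l)%:R *: ca i (LY k f)) - ca i (cb k (lf (Lop i l) f)))) => [|i _].
  by rewrite !big_split /= sumrN (sum_delta l (fun i => ca i (LY k f))) cb_LZ.
by rewrite !big_split /= sumrN (sum_delta k (fun j => ca i (cb j _))) -scaler_sumr ca_LY.
Qed.

(** [L] is invariant under gl_N acting on the module and on the Fock indices at once, so mode 0 can
    be traded for the action [Dkl] on the indices. *)
Lemma lfE_FF k l n : lf (op 0 (D k l)) (FF n) = Dkl k l (FF n).
Proof.
elim: n => [|n IH].
  rewrite /Dkl /= da_vac db_vac ca0 cb0 subr0.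
  apply/funext => s; apply/funext => t; rewrite /lf /vac.
  by case: ifP => _; rewrite ?op_vac ?op0.
rewrite /= lfE_LL IH /Dkl da_LL db_LL caD cbD caZ cbZ ca_LL // cb_LL //.
rewrite !scalerA eps2 !scale1r LLB.
by lmod.
Qed.

Local Notation Xo k l := (lf (op 1 (D k l))).

Lemma lfX_Lop k l i j f : Xo k l (lf (Lop i j) f) = lf (Lop i j) (Xo k l f)
  + (j == i)%:R *: lf (op 0 (D k l)) f + (i == l)%:R *: lf (op 0 (D k j)) f
  - (j == k)%:R *: lf (op 0 (D i l)) f
  + ((k == l)%:R * (j == i)%:R - N%:R * ((i == l)%:R * (j == k)%:R)) *: f.
Proof.
apply/funext => s; apply/funext => t; rewrite (eq_sym j k) (eq_sym j i).
exact: op1_Lop.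
Qed.

(** The commutator of mode 1 with [L] on [L^n 1], after mode 0 has been replaced by [Dkl]. *)
Definition Gkl k l n f : M := (1 + eps) *: kp (ca l (da k f))
  + (eps - 1) *: kp (cb k (db l f)) - (2%:R * eps * n%:R + N%:R) *: ca l (cb k f)
  + (k == l)%:R *: kp f.

Lemma lfX_LL_FF k l n : Xo k l (LL (FF n)) = LL (Xo k l (FF n)) + Gkl k l n (FF n).
Proof.
set f := FF n.
have E : Xo k l (LL f) = LL (Xo k l f) + kp (lf (op 0 (D k l)) f)
   + \sum_j ca l (cb j (lf (op 0 (D k j)) f)) - \sum_i ca i (cb k (lf (op 0 (D i l)) f))
   + (k == l)%:R *: kp f - N%:R *: ca l (cb k f).
  rewrite !LL_sum lf_sum.
  transitivity (\sum_i \sum_j (ca i (cb j (lf (Lop i j) (Xo k l f)))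
      + (j == i)%:R *: ca i (cb j (lf (op 0 (D k l)) f))
      + (i == l)%:R *: ca i (cb j (lf (op 0 (D k j)) f))
      - (j == k)%:R *: ca i (cb j (lf (op 0 (D i l)) f))
      + (j == i)%:R *: ((k == l)%:R *: ca i (cb j f))
      - (j == k)%:R *: ((i == l)%:R *: (N%:R *: ca i (cb j f))))).
    apply: eq_bigr => i _; rewrite lf_sum; apply: eq_bigr => j _.
    rewrite lf_ca lf_cb lfX_Lop !(cbB, cbD) !cbZ !(caB, caD) !caZ.
    by lmod.
  rewrite (eq_bigr (fun i => (\sum_j ca i (cb j (lf (Lop i j) (Xo k l f))))
      + ca i (cb i (lf (op 0 (D k l)) f))
      + (i == l)%:R *: (\sum_j ca i (cb j (lf (op 0 (D k j)) f)))
      - ca i (cb k (lf (op 0 (D i l)) f))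
      + (k == l)%:R *: ca i (cb i f)
      - (i == l)%:R *: (N%:R *: ca i (cb k f)))) => [|i _].
    rewrite !big_split /= !sumrN -scaler_sumr.
    rewrite (sum_delta l (fun i => \sum_j ca i _)) (sum_delta l (fun i => N%:R *: ca i _)).
    by [].
  rewrite !big_split /= !sumrN (sum_delta i (fun j => ca i (cb j _))).
  rewrite (sum_delta k (fun j => ca i (cb j _))) (sum_delta i (fun j => _ *: ca i _)).
  by rewrite (sum_delta k (fun j => _ *: (_ *: ca i _))) -scaler_sumr.
rewrite E lfE_FF -/f.
have -> : \sum_j ca l (cb j (lf (op 0 (D k j)) f)) = eps *: kp (ca l (da k f)) - (eps * n%:R) *: ca l (cb k f).
  transitivity (ca l (kp (da k f)) - eps *: ca l (cb k (\sum_j cb j (db j f)))).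
    rewrite /Submission.kp ca_sum cb_sum ca_sum scaler_sumr -sumrB; apply: eq_bigr => j _.
    rewrite lfE_FF /Dkl cbB caB -/f (cb_cb eps2 j k) caZ -ca_cb.
    by [].
  by rewrite degb_FF // -/f kp_ca // cbZ caZ scalerA.
have -> : \sum_i ca i (cb k (lf (op 0 (D i l)) f)) = (eps * n%:R) *: ca l (cb k f) - eps *: kp (cb k (db l f)).
  transitivity (eps *: cb k (ca l (\sum_i ca i (da i f))) - cb k (kp (db l f))).
    rewrite /Submission.kp cb_sum ca_sum cb_sum scaler_sumr -sumrB; apply: eq_bigr => i _.
    rewrite lfE_FF /Dkl cbB caB -/f !ca_cb (ca_ca eps2 i l) cbZ.
    by rewrite -(ca_cb _ i i).
  by rewrite dega_FF // -/f kp_cb // caZ cbZ -ca_cb scalerA.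
rewrite /Dkl /Gkl kpB.
by lmod.
Qed.

Definition al k l f : M := lf (op (Negz 1) (D k l)) f.

Lemma lf_Lop_comm i j k l f : lf (Lop i j) (lf (Lop k l) f) =
  lf (Lop k l) (lf (Lop i j) f) + ((j == i)%:R *: al k l f - (l == k)%:R *: al i j f
  + (j == k)%:R *: al i l f - (l == i)%:R *: al k j f).
Proof.
apply/funext => s; apply/funext => t; rewrite /al (eq_sym j i) (eq_sym l k) (eq_sym j k) (eq_sym l i).
move: (Lop_comm i j k l (f s t)); rewrite -!op_neg => /eqP; rewrite subr_eq addrC => /eqP h.
exact: h.
Qed.

(** The factor is zero for fermions. For bosons, exchanging two [b] operators makes the four error
    terms of [lf_Lop_comm] cancel in pairs. *)
Lemma manin_Y k f : (1 + eps) *: LL (LY k f) = (1 + eps) *: (eps *: LY k (LL f)).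
Proof.
case/orP: eps1 => /eqP e1; last by rewrite e1 subrr !scale0r.
congr (_ *: _).
have eK (x : M) : eps *: x = x by rewrite e1 scale1r.
have HD i j l (x y1 y2 y3 y4 : M) (c1 c2 c3 c4 : C) :
    ca i (cb j (cb l (x + (c1 *: y1 - c2 *: y2 + c3 *: y3 - c4 *: y4)))) =
    ca i (cb j (cb l x)) + (c1 *: ca i (cb j (cb l y1)) - c2 *: ca i (cb j (cb l y2))
      + c3 *: ca i (cb j (cb l y3)) - c4 *: ca i (cb j (cb l y4))).
  by rewrite !(cbB, cbD) !cbZ !(caB, caD) !caZ.
have -> : LL (LY k f) = \sum_i \sum_j \sum_l (ca i (cb j (cb l (lf (Lop k l) (lf (Lop i j) f))))
    + ((j == i)%:R *: ca i (cb j (cb l (al k l f))) - (l == k)%:R *: ca i (cb j (cb l (al i j f)))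
       + (j == k)%:R *: ca i (cb j (cb l (al i l f))) - (l == i)%:R *: ca i (cb j (cb l (al k j f))))).
  rewrite /Submission.LY LL_sum; apply: eq_bigr => i _; apply: eq_bigr => j _.
  rewrite lf_sum cb_sum ca_sum; apply: eq_bigr => l _.
  by rewrite lf_cb [in LHS]lf_Lop_comm HD.
have -> : eps *: LY k (LL f) = \sum_i \sum_j \sum_l ca i (cb j (cb l (lf (Lop k l) (lf (Lop i j) f)))).
  rewrite LL_sum /Submission.LY scaler_sumr.
  rewrite (eq_bigr (fun l => \sum_i \sum_j ca i (cb j (cb l (lf (Lop k l) (lf (Lop i j) f)))))).
    by rewrite exchange_big /=; apply: eq_bigr => i _; rewrite exchange_big.
  move=> l _; rewrite lf_sum cb_sum scaler_sumr; apply: eq_bigr => i _.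
  rewrite lf_sum cb_sum scaler_sumr; apply: eq_bigr => j _.
  by rewrite lf_ca lf_cb -ca_cb (cb_cb eps2 l j) caZ epsK.
apply: eq_bigr => i _.
under eq_bigr => j _ do rewrite big_split /=.
rewrite big_split /= -[RHS]addr0; congr (_ + _).
under eq_bigr => j _ do rewrite !big_split /= !sumrN -!scaler_sumr.
rewrite !big_split /= !sumrN.
rewrite (sum_delta i (fun j => \sum_l ca i (cb j (cb l (al k l f))))).
rewrite (sum_delta k (fun j => \sum_l ca i (cb j (cb l (al i l f))))).
under [X in _ - X + _ - _ = _]eq_bigr => j _ do rewrite (sum_delta k (fun l => ca i (cb j (cb l (al i j f))))).
under [X in _ - X = _]eq_bigr => j _ do rewrite (sum_delta i (fun l => ca i (cb j (cb l (al k j f))))).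
under [X in _ - X + _ - _ = _]eq_bigr => j _ do rewrite (cb_cb eps2) eK.
under [X in _ + _ - X = _]eq_bigr => j _ do rewrite (cb_cb eps2) eK.
by lmod.
Qed.

(** The counterpart for columns, with content for fermions: now exchanging two [a] operators
    produces the cancelling signs. *)
Lemma manin_Z l f : (eps - 1) *: LL (LZ l f) = (eps - 1) *: (eps *: LZ l (LL f)).
Proof.
case/orP: eps1 => /eqP e1; first by rewrite e1 subrr !scale0r.
congr (_ *: _).
have eN (x : M) : eps *: x = - x by rewrite e1 scaleN1r.
have HD i j k (x y1 y2 y3 y4 : M) (c1 c2 c3 c4 : C) :
    cb j (ca i (ca k (x + (c1 *: y1 - c2 *: y2 + c3 *: y3 - c4 *: y4)))) =
    cb j (ca i (ca k x)) + (c1 *: cb j (ca i (ca k y1)) - c2 *: cb j (ca i (ca k y2))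
      + c3 *: cb j (ca i (ca k y3)) - c4 *: cb j (ca i (ca k y4))).
  by rewrite !(caB, caD) !caZ !(cbB, cbD) !cbZ.
have -> : LL (LZ l f) = \sum_j \sum_i \sum_k (cb j (ca i (ca k (lf (Lop k l) (lf (Lop i j) f))))
    + ((i == j)%:R *: cb j (ca i (ca k (al k l f))) - (k == l)%:R *: cb j (ca i (ca k (al i j f)))
       + (k == j)%:R *: cb j (ca i (ca k (al i l f))) - (i == l)%:R *: cb j (ca i (ca k (al k j f))))).
  rewrite /Submission.LZ LL_sum exchange_big /=; apply: eq_bigr => j _; apply: eq_bigr => i _.
  rewrite lf_sum ca_cb ca_sum cb_sum; apply: eq_bigr => k _.
  by rewrite lf_ca [in LHS]lf_Lop_comm (eq_sym i j) (eq_sym k l) (eq_sym k j) (eq_sym i l) HD.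
have -> : eps *: LZ l (LL f) = \sum_j \sum_i \sum_k cb j (ca i (ca k (lf (Lop k l) (lf (Lop i j) f)))).
  rewrite LL_sum /Submission.LZ scaler_sumr.
  rewrite (eq_bigr (fun k => \sum_j \sum_i cb j (ca i (ca k (lf (Lop k l) (lf (Lop i j) f)))))).
    by rewrite exchange_big /=; apply: eq_bigr => i _; rewrite exchange_big.
  move=> k _; rewrite exchange_big lf_sum ca_sum scaler_sumr; apply: eq_bigr => j _.
  rewrite lf_sum ca_sum scaler_sumr; apply: eq_bigr => i _.
  by rewrite lf_ca lf_cb ca_cb (ca_cb _ k j) (ca_ca eps2 k i) cbZ epsK.
apply: eq_bigr => j _.
under eq_bigr => i _ do rewrite big_split /=.
rewrite big_split /= -[RHS]addr0; congr (_ + _).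
under eq_bigr => i _ do rewrite !big_split /= !sumrN -!scaler_sumr.
rewrite !big_split /= !sumrN.
rewrite (sum_delta j (fun i => \sum_k cb j (ca i (ca k (al k l f))))).
rewrite (sum_delta l (fun i => \sum_k cb j (ca i (ca k (al k j f))))).
under [X in _ - X + _ - _ = _]eq_bigr => i _ do rewrite (sum_delta l (fun k => cb j (ca i (ca k (al i j f))))).
under [X in _ + X - _ = _]eq_bigr => i _ do rewrite (sum_delta j (fun k => cb j (ca i (ca k (al i l f))))).
under [X in _ + X - _ = _]eq_bigr => i _ do rewrite (ca_ca eps2) cbZ eN.
under [X in _ - X + _ - _ = _]eq_bigr => i _ do rewrite (ca_ca eps2) cbZ eN.
rewrite !sumrN.
by lmod.
Qed.

(** By the Manin property, annihilation gives the same result at each of the [n + 1] factors [L]. *)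
Lemma da_FF k n : (1 + eps) *: da k (FF n.+1) = ((1 + eps) * n.+1%:R) *: LY k (FF n).
Proof.
elim: n => [|n IH]; first by rewrite /= da_LL da_vac LL0 scaler0 addr0 mulr1.
rewrite -[FF n.+2]/(LL (FF n.+1)) da_LL.
have h : eps *: ((1 + eps) *: LL (da k (FF n.+1))) = (n.+1%:R * (1 + eps)) *: LY k (FF n.+1).
  rewrite -LLZ IH LLZ [in LHS]mulrC -[in LHS]scalerA manin_Y -[LL (FF n)]/(FF n.+1).
  transitivity ((eps * eps * (n.+1%:R * (1 + eps))) *: LY k (FF n.+1)); first by lmod.
  by rewrite eps2 mul1r.
transitivity ((1 + eps) *: LY k (FF n.+1) + eps *: ((1 + eps) *: LL (da k (FF n.+1)))); first by lmod.
by rewrite h [n.+2%:R]mulrS; lmod.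
Qed.

Lemma db_FF k n : (eps - 1) *: db k (FF n.+1) = ((eps - 1) * n.+1%:R) *: LZ k (FF n).
Proof.
elim: n => [|n IH]; first by rewrite /= db_LL db_vac LL0 scaler0 addr0 mulr1.
rewrite -[FF n.+2]/(LL (FF n.+1)) db_LL.
have h : eps *: ((eps - 1) *: LL (db k (FF n.+1))) = (n.+1%:R * (eps - 1)) *: LZ k (FF n.+1).
  rewrite -LLZ IH LLZ [in LHS]mulrC -[in LHS]scalerA manin_Z -[LL (FF n)]/(FF n.+1).
  transitivity ((eps * eps * (n.+1%:R * (eps - 1))) *: LZ k (FF n.+1)); first by lmod.
  by rewrite eps2 mul1r.
transitivity ((eps - 1) *: LZ k (FF n.+1) + eps *: ((eps - 1) *: LL (db k (FF n.+1)))); first by lmod.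
by rewrite h [n.+2%:R]mulrS; lmod.
Qed.


(** The corrections [Gkl] are summed over the factors of [L^(m+1)]. By [da_FF] and [db_FF] they form
    arithmetic progressions, and doubling clears the halves. *)
Lemma lfX_FF k l m : Xo k l (FF m.+1) *+ 2 = m.+1%:R *: (
    (1 + eps) *: kp (ca l (da k (FF m))) + (eps - 1) *: kp (cb k (db l (FF m)))
    - (2%:R * (N%:R + eps * m%:R)) *: ca l (cb k (FF m)) + (2%:R * (k == l)%:R) *: kp (FF m)).
Proof.
elim: m => [|m IH].
  rewrite -[FF 1]/(LL (FF 0)) lfX_LL_FF.
  have -> : Xo k l (FF 0) = 0.
    apply/funext => s; apply/funext => t; rewrite /lf /= /vac.
    by case: ifP => _; rewrite ?op_vac ?op0.
  rewrite LL0.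
  by rewrite /Gkl -scaler_nat /= da_vac db_vac ca0 cb0 kp0; lmod.
rewrite -[FF m.+2]/(LL (FF m.+1)) lfX_LL_FF mulrnDl -scaler_nat -LLZ scaler_nat IH.
rewrite LLZ !(LLD, LLB, LLZ) !LL_kp // LL_ca // LL_cb // LL_ab // -[LL (FF m)]/(FF m.+1).
have hY : (1 + eps) *: (m.+1%:R *: (eps *: LL (da k (FF m)))) = (1 + eps) *: (m%:R *: da k (FF m.+1)).
  have h := da_FF k m; rewrite -[FF m.+1]/(LL (FF m)) da_LL in h *.
  move: h; move: (LY k _) (eps *: LL _) => y x h.
  transitivity (m.+1%:R *: ((1 + eps) *: (y + x) - (1 + eps) *: y)); first by lmod.
  transitivity (m.+1%:R *: ((1 + eps) *: (y + x)) - ((1 + eps) * m.+1%:R) *: y); first by lmod.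
  by rewrite -h mulrSr; lmod.
have hZ : (eps - 1) *: (m.+1%:R *: (eps *: LL (db l (FF m)))) = (eps - 1) *: (m%:R *: db l (FF m.+1)).
  have h := db_FF l m; rewrite -[FF m.+1]/(LL (FF m)) db_LL in h *.
  move: h; move: (LZ l _) (eps *: LL _) => y x h.
  transitivity (m.+1%:R *: ((eps - 1) *: (y + x) - (eps - 1) *: y)); first by lmod.
  transitivity (m.+1%:R *: ((eps - 1) *: (y + x)) - ((eps - 1) * m.+1%:R) *: y); first by lmod.
  by rewrite -h mulrSr; lmod.
transitivity (kp (ca l ((1 + eps) *: (m.+1%:R *: (eps *: LL (da k (FF m))))))
   + kp (cb k ((eps - 1) *: (m.+1%:R *: (eps *: LL (db l (FF m))))))
   - (m.+1%:R * (2%:R * (N%:R + eps * m%:R))) *: ca l (cb k (FF m.+1))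
   + (m.+1%:R * (2%:R * (k == l)%:R)) *: kp (FF m.+1)
   + Gkl k l m.+1 (FF m.+1) *+ 2).
  by rewrite !(caZ, cbZ) !kpZ; lmod.
rewrite hY hZ !(caZ, cbZ) !kpZ /Gkl [m.+2%:R]mulrSr [m.+1%:R]mulrSr -scaler_nat.
by lmod.
Qed.

Lemma pr_ada m k l : pr m (ca l (da k (FF m))) = pr m (cb k (db l (FF m))).
Proof.
have sF := symf_FF eps2 (fun i j => Lop i j : {linear V -> V}) 1 m.
case: m sF => [|m] sF; first by rewrite /= da_vac db_vac ca0 cb0.
by rewrite pr_ca // ?pr_cb //; [apply: symf_db | apply: symf_da].
Qed.

Definition ssv m : V := pr m (FF m).

(** Modes 0 and 1 suffice by [FF_01]. Mode 0 vanishes because both parts of [Dkl] have the same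
    contraction. For mode 1, contracting [lfX_FF] gives every term the factor [N + eps m], and the
    terms cancel. *)
Lemma FF_ssv m : [pchar C] =i pred0 -> FFu (ssv m).
Proof.
move=> ch; case: m => [|m]; first exact: FF1.
have sF n := symf_FF eps2 (fun i j => Lop i j : {linear V -> V}) 1 n.
apply: (FF_01 ch) => A.
  apply: (linear_mx_eq (f := fun A => op 0 A (ssv m.+1)) (g := fun=> 0)) => [||k l].
  - exact: op_linear_mx.
  - by move=> c Y Z; rewrite scaler0 addr0.
  by rewrite /ssv -pr_lf lfE_FF /Dkl prB pr_ada subrr.
apply: (linear_mx_eq (f := fun A => op 1 A (ssv m.+1)) (g := fun=> 0)) => [||k l].
- exact: op_linear_mx.
- by move=> c Y Z; rewrite scaler0 addr0.
have two (v : V) : v *+ 2 = 0 -> v = 0.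
  rewrite -scaler_nat => /eqP; rewrite scaler_eq0; move/pcharf0P: ch => -> /=.
  by move/eqP.
apply: two; rewrite /ssv -pr_lf -scaler_nat -prZ scaler_nat lfX_FF.
have s1 : symf eps (ca l (da k (FF m))) by apply/(symf_ca eps2)/symf_da.
have s2 : symf eps (cb k (db l (FF m))) by apply/(symf_cb eps2)/symf_db.
have s3 : symf eps (cb k (FF m)) by apply/(symf_cb eps2).
rewrite prZ !(prB, prD) !prZ (pr_kp eps2 m s1) (pr_kp eps2 m s2) (pr_kp eps2 m (sF m)).
rewrite card_ord (pr_ca eps2 m l s3).
rewrite db_cb prD !prZ pr_ada (eq_sym l).
by lmod.
Qed.
End SegalSugawara.

(** * Symbols *)

(* The top-degree symbol of an element of the enveloping algebra is well     *)
(* defined (the injectivity half of the Poincare-Birkhoff-Witt theorem).     *)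
(* In the faithful representation of the loop algebra on C[s]^N, take a      *)
(* functional F1 on matrices over s C[s], extended by 0 to scalars; its d-th *)
(* power under the convolution dual to the coproduct of the enveloping       *)
(* algebra kills words of length < d and is d! times the product of the      *)
(* values of F1 on words of length d.                                        *)
Section Symbols.
Variables (C : fieldType) (N : nat) (A : comAlgType C) (xi : LP N -> A).
Local Notation V := (Uq (@floop_rel C N)).
Local Notation word := (word (@floop_rel C N)).
Local Notation X := (LP N).

Fixpoint sg (x : X) (w : seq X) : A :=
  match w with
  | [::] => xi x
  | y :: w' => (x.1.2 == y.1.1)%:R * sg (x.1.1, y.1.2, (x.2 + y.2).+1) w'
  end.
Definition F1 (w : seq X) : A := if w is x :: w' then sg x w' else 0.

Lemma sg_merge z (x y : X) u v : sg z (u ++ x :: y :: v) =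
  (x.1.2 == y.1.1)%:R * sg z (u ++ (x.1.1, y.1.2, (x.2 + y.2).+1) :: v).
Proof.
elim: u z => [|t u IH] z /=; last by rewrite IH mulrCA.
by rewrite mulrCA addnS addSn addnA.
Qed.
Lemma F1_merge (x y : X) u v : F1 (u ++ x :: y :: v) =
  (x.1.2 == y.1.1)%:R * F1 (u ++ (x.1.1, y.1.2, (x.2 + y.2).+1) :: v).
Proof. by case: u => [|t u] //=; apply: sg_merge. Qed.

Lemma F1_kills : kills (@floop_rel C N) F1.
Proof.
move=> [[[i j] a] [[k l] b]] u v; rewrite /floop_rel !lin_cons lin_nil /= !F1_merge /=.
rewrite scale1r scaleN1r addr0 addnC (eq_sym j) (eq_sym l) !scaleNr.
by rewrite !scaler_nat !mulr_natl; lmod.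
Qed.

Fixpoint conv (w : seq X) (F G : seq X -> A) : A :=
  match w with
  | [::] => F [::] * G [::]
  | x :: w' => conv w' (fun t => F (x :: t)) G + conv w' F (fun t => G (x :: t))
  end.

Lemma conv_linl w c (F F' G : seq X -> A) :
  conv w (fun t => c *: F t + F' t) G = c *: conv w F G + conv w F' G.
Proof.
elim: w F F' G => [|x w IH] F F' G /=; first by rewrite mulrDl -scalerAl.
by rewrite !IH; lmod.
Qed.
Lemma conv_linr w c (F G G' : seq X -> A) :
  conv w F (fun t => c *: G t + G' t) = c *: conv w F G + conv w F G'.
Proof.
elim: w F G G' => [|x w IH] F G G' /=; first by rewrite mulrDr -scalerAr.
by rewrite !IH; lmod.
Qed.
Lemma conv0l w (G : seq X -> A) : conv w (fun=> 0) G = 0.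
Proof. by elim: w G => [|x w IH] G /=; rewrite ?mul0r // !IH addr0. Qed.
Lemma conv0r w (F : seq X -> A) : conv w F (fun=> 0) = 0.
Proof. by elim: w F => [|x w IH] F /=; rewrite ?mulr0 // !IH addr0. Qed.
Lemma conv_ext w (F F' G G' : seq X -> A) : F =1 F' -> G =1 G' -> conv w F G = conv w F' G'.
Proof.
elim: w F F' G G' => [|x w IH] F F' G G' e e' /=; first by rewrite e e'.
by congr (_ + _); apply: IH => t.
Qed.

(** Letters and their brackets are both primitive for the coproduct, so a relation splits into the
    same relation in either factor. *)
Lemma kills_conv (F G : seq X -> A) : kills (@floop_rel C N) F ->
  kills (@floop_rel C N) G -> kills (@floop_rel C N) (fun w => conv w F G).
Proof.
move=> kF kG r u v; elim: u F G kF kG => [|x u IH] F G kF kG; last first.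
  rewrite /= linD (IH (fun t => F (x :: t)) G) //; last first.
    by move=> r' u' v'; apply: (kF r' (x :: u')).
  by rewrite add0r IH // => r' u' v'; apply: (kG r' (x :: u')).
case: r => [[[i j] a] [[k l] b]]; rewrite /= /floop_rel !lin_cons lin_nil /=.
set x := (i,j,a); set y := (k,l,b); set p := (i, l, (a + b).+1); set q := (k, j, (a+b).+1).
have hF : conv v (fun t => F (x :: y :: t)) G - conv v (fun t => F (y :: x :: t)) G
   - (k == j)%:R *: conv v (fun t => F (p :: t)) G
   + (i == l)%:R *: conv v (fun t => F (q :: t)) G = 0.
  rewrite -[RHS](conv0l v G).
  rewrite -(@conv_ext v (fun t => 1 *: F (x :: y :: t) + (-1 *: F (y :: x :: t) +
     (- (k == j)%:R *: F (p :: t) + ((i == l)%:R *: F (q :: t) + 0)))) (fun=> 0) G G) //.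
    by rewrite !conv_linl conv0l; lmod.
  move=> t; have := kF ((i,j,a),(k,l,b)) [::] t.
  by rewrite /floop_rel !lin_cons lin_nil.
have hG : conv v F (fun t => G (x :: y :: t)) - conv v F (fun t => G (y :: x :: t))
   - (k == j)%:R *: conv v F (fun t => G (p :: t))
   + (i == l)%:R *: conv v F (fun t => G (q :: t)) = 0.
  rewrite -[RHS](conv0r v F).
  rewrite -(@conv_ext v F F (fun t => 1 *: G (x :: y :: t) + (-1 *: G (y :: x :: t) +
     (- (k == j)%:R *: G (p :: t) + ((i == l)%:R *: G (q :: t) + 0)))) (fun=> 0)) //.
    by rewrite !conv_linr conv0r; lmod.
  move=> t; have := kG ((i,j,a),(k,l,b)) [::] t.
  by rewrite /floop_rel !lin_cons lin_nil.
rewrite -[RHS]addr0 -[X in _ = X + _]hF -[X in _ = _ + X]hG.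
by lmod.
Qed.

Fixpoint Sd (d : nat) : seq X -> A :=
  match d with
  | 0 => fun w => if w is [::] then 1 else 0
  | d'.+1 => fun w => conv w F1 (Sd d')
  end.

Lemma Sd_kills d : kills (@floop_rel C N) (Sd d).
Proof.
elim: d => [|d IH]; last exact: kills_conv F1_kills IH.
move=> [[[i j] a] [[k l] b]] u v; rewrite /floop_rel !lin_cons lin_nil /=.
have e t w : (if u ++ t :: w is [::] then 1 else 0) = 0 :> A by case: u.
by rewrite !e !scaler0 !addr0.
Qed.

Definition vanb k (F : seq X -> A) := forall w, (size w < k)%N -> F w = 0.
Lemma vanb_conv k l F G : vanb k F -> vanb l G -> vanb (k + l) (fun w => conv w F G).
Proof.
move=> vF vG w; elim: w k l F G vF vG => [|x w IH] k l F G vF vG /=.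
  case: k vF => [|k] vF; last by rewrite vF // mul0r.
  by rewrite add0n => h; rewrite vG // mulr0.
move=> h; rewrite (IH k.-1 l) //; last 2 first.
- by move=> t ht; apply: vF => /=; lia.
- by lia.
rewrite (IH k l.-1) ?addr0 //; last by lia.
by move=> t ht; apply: vG => /=; lia.
Qed.

(** Only splittings that send a single letter to [F1] survive for reasons of length, and each of the
    [d + 1] letters can be that one. *)
Lemma conv_top d g G : vanb d G ->
  (forall w, size w = d -> G w = g * \prod_(x <- w) xi x) ->
  forall w, size w = d.+1 -> conv w F1 G = (d.+1%:R * g) * \prod_(x <- w) xi x.
Proof.
move=> vG tG w; elim: w d g G vG tG => [//|x w IH] d g G vG tG [sw] /=.
rewrite big_cons.
have -> : conv w (sg x) G = xi x * (g * \prod_(y <- w) xi y).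
  case: w sw {IH} => [|y w] sw.
    by rewrite /= tG // -sw.
  rewrite /= (@vanb_conv 0 d _ G) //; last by rewrite -sw.
  rewrite add0r -tG //.
  have : forall (w0 : seq X) (H : seq X -> A), vanb (size w0) H -> conv w0 (sg x) H = xi x * H w0.
    elim=> [//|z w0 IH] H vH /=.
    rewrite (@vanb_conv 0 (size w0).+1 _ H) // add0r IH // => t ht; exact: vH.
  by move=> -> // t ht; apply: vG; rewrite -sw /=.
case: d vG tG sw => [|d] vG tG sw.
  by case: w sw {IH} => // _; rewrite /= mul0r addr0 !big_nil; ring.
rewrite (IH d (g * xi x)) //.
- by rewrite [in RHS]mulrSr; ring.
- by move=> t ht; apply: vG.
by move=> t ht; rewrite tG ?big_cons /= ?ht //; ring.
Qed.

Lemma Sd_spec d : vanb d (Sd d) /\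
  (forall w, size w = d -> Sd d w = (d`!)%:R * \prod_(x <- w) xi x).
Proof.
elim: d => [|d [IH1 IH2]]; split=> //.
- by move=> [|//] _; rewrite big_nil mulr1.
- rewrite -add1n; apply: vanb_conv => //.
  by case.
by move=> w sw; rewrite /= (conv_top IH1 IH2 sw) factS natrM.
Qed.

Hypothesis chC : [pchar C] =i pred0.

Definition sy d (p : fa C X) : A :=
  lin (fun w => if size w == d then \prod_(x <- w) xi x else 0) p.

Definition fil d (u : V) : Prop := exists p : fa C X,
  upi (@floop_rel C N) p = u /\ all (fun cw => (size cw.2 <= d)%N) p.

(* u lies in filtration degree d with symbol P, and its component of degree  *)
(* d involves only the modes E_ij[-n-1] with n < B. *)
Definition okw B d (w : seq X) :=
  (size w <= d)%N && ((size w == d) ==> all (fun x => (x.2 < B)%N) w).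
Definition hs B d (u : V) (P : A) : Prop := exists p : fa C X,
  [/\ upi (@floop_rel C N) p = u, all (fun cw => okw B d cw.2) p & sy d p = P].

Lemma okw_size B d w : okw B d w -> (size w <= d)%N. Proof. by case/andP. Qed.

Lemma hs_fil B d u P : hs B d u P -> fil d u.
Proof.
by move=> [p [e a _]]; exists p; split=> //; apply: sub_all a => cw /okw_size.
Qed.

(** The functional [Sd d] factors through the quotient and equals [d!] times the degree [d] part, so
    the characteristic is what allows dividing. *)
Lemma pbw d (p : fa C X) : all (fun cw => (size cw.2 <= d)%N) p ->
  upi (@floop_rel C N) p = 0 -> sy d p = 0.
Proof.
move=> ap /upi_ideal/(lin_ideal (Sd_kills d)); have [S1 S2] := Sd_spec d.
have -> : lin (Sd d) p = (d`!)%:R *: sy d p.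
  rewrite /sy /lin scaler_sumr; apply: eq_big_seq => cw hcw.
  rewrite scalerA mulrC -scalerA; congr (_ *: _).
  move/allP: ap => /(_ _ hcw); rewrite leq_eqVlt => /orP[/eqP e|lt].
    by rewrite e eqxx S2 // mulr_natl scaler_nat.
  by rewrite S1 // ltn_eqF // scaler0.
move/eqP; rewrite scaler_eq0 => /orP[|/eqP //].
by move/pcharf0P: chC => ->; rewrite (gtn_eqF (fact_gt0 d)).
Qed.

Lemma hs_uniq B B' d u P Q : hs B d u P -> hs B' d u Q -> P = Q.
Proof.
move=> [p [e1 a1 <-]] [q [e2 a2 <-]]; apply/eqP; rewrite -subr_eq0 /sy -lin_sub.
apply/eqP; apply: pbw; last by rewrite /fa_sub /fa_add upi_cat upi_scale e1 e2 scaleN1r subrr.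
rewrite /fa_sub /fa_add all_cat /fa_scale all_map; apply/andP; split.
  by apply: sub_all a1 => cw /okw_size.
by apply: sub_all a2 => cw /okw_size.
Qed.

Lemma hs_mono B B' d u P : (B <= B')%N -> hs B d u P -> hs B' d u P.
Proof.
move=> BB [p [e a h]]; exists p; split=> //; apply: sub_all a => cw /andP[s1 s2].
rewrite /okw s1 /=; apply/implyP => e1; move/implyP: s2 => /(_ e1).
by apply: sub_all => x hx; apply: leq_trans hx BB.
Qed.

Lemma filD d u v : fil d u -> fil d v -> fil d (u + v).
Proof.
move=> [p [e1 a1]] [q [e2 a2]]; exists (p ++ q); split; first by rewrite upi_cat e1 e2.
by rewrite all_cat a1.
Qed.
Lemma filZ d c u : fil d u -> fil d (c *: u).
Proof.
move=> [p [e1 a1]]; exists (fa_scale c p); split; first by rewrite upi_scale e1.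
by rewrite /fa_scale all_map.
Qed.
Lemma fil0 d : fil d 0. Proof. by exists [::]. Qed.
Lemma fil_word w : fil (size w) (word w).
Proof. by exists [:: (1, w)]; split; [rewrite upi_word scale1r | rewrite /= leqnn]. Qed.
Lemma fil_mono d d' u : (d <= d')%N -> fil d u -> fil d' u.
Proof.
move=> dd [p [e a]]; exists p; split=> //; apply: sub_all a => cw h; exact: leq_trans h dd.
Qed.
Lemma filM d e u v : fil d u -> fil e v -> fil (d + e) (u * v).
Proof.
move=> [p [<- a]] [q [<- b]]; exists (fa_mul p q); split; first by rewrite upi_mul.
apply/allP => cw /allpairsP[[x y] [hx hy ->]] /=; rewrite size_cat.
by move/allP: a => /(_ _ hx) h1; move/allP: b => /(_ _ hy) h2; exact: leq_add.
Qed.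
Lemma fil_map (f : V -> V) d u : linear f ->
  (forall w, fil (size w) (f (word w))) -> fil d u -> fil d (f u).
Proof.
move=> lf h [p [<- a]].
pose F : {linear V -> V} := HB.pack f (GRing.isLinear.Build _ _ _ _ f lf).
rewrite upi_lin -[f _]/(F _) lin_raddf /lin.
elim: p a => [|cw p IH]; first by rewrite big_nil => _; apply: fil0.
rewrite big_cons /= => /andP[a1 a2]; apply: filD; last exact: IH.
by apply: filZ; apply: fil_mono a1 (h cw.2).
Qed.
Lemma fil_ell n D : fil 1 (ell n D).
Proof.
rewrite -[ell n D]/(\sum_i \sum_j D i j *: let_ (@floop_rel C N) (i,j,n)).
have fs (J : Type) (r : seq J) (F : J -> V) : (forall x, fil 1 (F x)) -> fil 1 (\sum_(x <- r) F x).
  by move=> h; elim/big_ind: _ => //; [apply: fil0 | apply: filD].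
apply: (fs) => i; apply: (fs) => j; apply: filZ.
by have := fil_word [:: (i,j,n)]; rewrite word_cons word_nil mulr1.
Qed.
Lemma fil_op r D d u : fil d u -> fil d (op (Posz r) D u).
Proof.
apply: fil_map => [|w]; first by move=> c x y; rewrite opD opZ.
elim: w r D => [|[[k l] n] w IH] r D.
  by rewrite word_nil op_vac; apply: fil0.
rewrite word_cons -ell_delta op_ell; apply: filD; last first.
  by apply: filZ; apply: fil_mono (fil_word w) => /=.
apply: filD; first exact: filM (fil_ell _ _) (IH _ _).
case: (Posz r + Negz n) => m; first by apply: fil_mono (IH _ _) => /=.
by rewrite op_neg; exact: filM (fil_ell _ _) (fil_word _).
Qed.
Lemma fil_der d u : fil d u -> fil d (der u).
Proof.
apply: fil_map => [|w]; first by move=> c x y; rewrite derD derZ.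
elim: w => [|[[k l] n] w IH]; first by rewrite word_nil der1; apply: fil0.
rewrite word_cons -ell_delta der_ell; apply: filD; last exact: filM (fil_ell _ _) IH.
by apply: filZ; exact: filM (fil_ell _ _) (fil_word _).
Qed.

Lemma hs_lower B d d' u : (d < d')%N -> fil d u -> hs B d' u 0.
Proof.
move=> dd [p [e a]]; exists p; split=> //.
  apply: sub_all a => cw /= h; have h' := leq_ltn_trans h dd.
  by rewrite /okw (ltnW h') ltn_eqF.
rewrite /sy /lin big_seq big1 // => cw hcw.
by move/allP: a => /(_ _ hcw) /= h; rewrite ltn_eqF ?scaler0 // (leq_ltn_trans h).
Qed.

Lemma hsD B d u v P Q : hs B d u P -> hs B d v Q -> hs B d (u + v) (P + Q).
Proof.
move=> [p [e1 a1 <-]] [q [e2 a2 <-]]; exists (p ++ q); split.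
- by rewrite upi_cat e1 e2.
- by rewrite all_cat a1.
- by rewrite /sy lin_cat.
Qed.
Lemma hsZ B d c u P : hs B d u P -> hs B d (c *: u) (c *: P).
Proof.
move=> [p [e1 a1 <-]]; exists (fa_scale c p); split.
- by rewrite upi_scale e1.
- by rewrite /fa_scale all_map.
- by rewrite /sy lin_scale.
Qed.
Lemma hs0 B d : hs B d 0 0.
Proof. by exists [::]; split=> //; rewrite /sy lin_nil. Qed.
Lemma hsB B d u v P Q : hs B d u P -> hs B d v Q -> hs B d (u - v) (P - Q).
Proof.
by move=> h1 h2; rewrite -(scaleN1r v) -(scaleN1r Q); apply: hsD h1 (hsZ _ h2).
Qed.
Lemma hsZ0 B d c u : hs B d u 0 -> hs B d (c *: u) 0.
Proof. by move=> /(hsZ c); rewrite scaler0. Qed.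
Lemma hs_word B w : all (fun x => (x.2 < B)%N) w -> hs B (size w) (word w) (\prod_(x <- w) xi x).
Proof.
move=> aw; exists [:: (1, w)]; split; first by rewrite upi_word scale1r.
  by rewrite /= /okw leqnn aw implybT.
by rewrite /sy lin_cons lin_nil eqxx scale1r addr0.
Qed.
Lemma hs1 B : hs B 0 1 1.
Proof. by have := @hs_word B [::] isT; rewrite word_nil big_nil. Qed.

Lemma hsM B d e u v P Q : hs B d u P -> hs B e v Q -> hs B (d + e) (u * v) (P * Q).
Proof.
move=> [p [<- a <-]] [q [<- b <-]]; exists (fa_mul p q); split.
- by rewrite upi_mul.
- apply/allP => cw /allpairsP[[x y] [hx hy ->]] /=; rewrite /okw size_cat all_cat.
  move/allP: a => /(_ _ hx) /andP[/= h1 h1']; move/allP: b => /(_ _ hy) /andP[/= h2 h2'].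
  rewrite leq_add //=; apply/implyP => /eqP h.
  move/implyP: h1' => ->; first by move/implyP: h2' => -> //; apply/eqP; lia.
  by apply/eqP; lia.
rewrite /sy lin_mul /lin mulr_suml; apply: eq_big_seq => x hx.
rewrite -scalerAl mulr_sumr; congr (_ *: _); apply: eq_big_seq => y hy.
rewrite -scalerAr; congr (_ *: _).
move/allP: a => /(_ _ hx) /okw_size h1; move/allP: b => /(_ _ hy) /okw_size h2.
rewrite size_cat big_cat /=.
move: (size x.2) (size y.2) h1 h2 => sx sy h1 h2.
have [e1|n1] := eqVneq sx d; have [e2|n2] := eqVneq sy e.
- by rewrite e1 e2 eqxx.
- by rewrite mulr0 ifN //; lia.
- by rewrite mul0r ifN //; lia.
- by rewrite mul0r ifN //; lia.
Qed.

(** Words of full length must be mapped compatibly with symbols; for shorter ones it is enough that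
    [f] preserves the filtration. *)
Lemma hs_map B B' (f : V -> V) (Df : {linear A -> A}) d u P : linear f ->
  (forall w, fil (size w) (f (word w))) ->
  (forall w, all (fun x => (x.2 < B)%N) w ->
     hs B' (size w) (f (word w)) (Df (\prod_(x <- w) xi x))) ->
  hs B d u P -> hs B' d (f u) (Df P).
Proof.
move=> lf hf h [p [<- a <-]].
pose F : {linear V -> V} := HB.pack f (GRing.isLinear.Build _ _ _ _ f lf).
rewrite upi_lin -[f _]/(F _) /sy !lin_raddf /lin.
elim: p a => [|cw p IH] a.
  by rewrite !big_nil; apply: hs0.
rewrite !big_cons /=; move: a => /= /andP[/andP[a1 a1'] a2].
apply: hsD; last exact: IH.
apply: hsZ; case: eqP => [e|ne].
  by rewrite -e; apply: h; move/implyP: a1'; apply; apply/eqP.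
rewrite linear0; apply: hs_lower (hf cw.2); rewrite ltn_neqAle a1 andbT; exact/eqP.
Qed.

Lemma hs_letter B i j n : (n < B)%N -> hs B 1 (ell n (delta_mx i j)) (xi (i,j,n)).
Proof.
move=> nB; have := @hs_word B [:: (i,j,n)]; rewrite big_seq1 word_cons word_nil mulr1 /= nB.
by rewrite ell_delta; apply.
Qed.

Section DerSym.
Variable T : {linear A -> A}.
Hypothesis TM : forall P Q, T (P * Q) = T P * Q + P * T Q.
Hypothesis Txi : forall i j n, T (xi (i,j,n)) = n.+1%:R *: xi (i,j,n.+1).

Lemma T1 (S : {linear A -> A}) : (forall P Q, S (P * Q) = S P * Q + P * S Q) -> S 1 = 0.
Proof.
move=> SM; have := SM 1 1; rewrite !mulr1 mul1r => /eqP.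
by rewrite -subr_eq0 opprD addrA subrr add0r oppr_eq0 => /eqP.
Qed.

Lemma hs_der B d u P : hs B d u P -> hs B.+1 d (der u) (T P).
Proof.
apply: hs_map => [|w|w]; first by move=> c x y; rewrite derD derZ.
  by apply: fil_der; apply: fil_word.
elim: w => [|[[i j] n] w IH] aw.
  by rewrite word_nil der1 big_nil (T1 TM); apply: hs0.
move: aw => /= /andP[nB aw].
rewrite word_cons -ell_delta der_ell big_cons TM Txi.
apply: hsD; last exact: hsM (hs_letter _ _ (leqW nB)) (IH aw).
rewrite -scalerAl; apply/hsZ; apply: (@hsM _ 1 (size w)); first exact: hs_letter.
by apply: (hs_mono (leqnSn B)); apply: hs_word.
Qed.
End DerSym.

Section OpSym.
Variable Dr : nat -> 'I_N -> 'I_N -> {linear A -> A}.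
Hypothesis DM : forall r i j P Q, Dr r i j (P * Q) = Dr r i j P * Q + P * Dr r i j Q.
Variable B : nat.
Hypothesis Dxi : forall r i j k l n, (n < B)%N -> Dr r i j (xi (k,l,n)) =
  if (r <= n)%N then (k == j)%:R *: xi (i,l,(n - r)%N) - (i == l)%:R *: xi (k,j,(n - r)%N) else 0.

(** A bracket that lands in a non-negative mode, like the central term, loses a letter and is
    invisible in the symbol. *)
Lemma hs_op d u P r i j : hs B d u P ->
  hs B d (op (Posz r) (delta_mx i j) u) (Dr r i j P).
Proof.
apply: hs_map => [|w|w]; first by move=> c x y; rewrite opD opZ.
  by apply: fil_op; apply: fil_word.
elim: w r i j => [|[[k l] n] w IH] r i j aw.
  by rewrite word_nil op_vac big_nil (T1 (DM r i j)); apply: hs0.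
move: aw => /= /andP[nB aw].
have opmB m A' D u' : op m (A' - D) u' = op m A' u' - op m D u' :> V.
  by rewrite addrC -scaleN1r op_linear_mx scaleN1r addrC.
have opmZ m c A' u' : op m (c *: A') u' = c *: op m A' u' :> V.
  rewrite -[c *: A']addr0 op_linear_mx -[in X in _ + X](subrr (0 : 'M[C]_N)) opmB subrr.
  by rewrite addr0.
rewrite word_cons -ell_delta op_ell big_cons DM Dxi // delta_brk opmB !opmZ.
rewrite -[X in hs _ _ _ X]addr0; apply: hsD; last first.
  by apply: hsZ0; apply: hs_lower (fil_word w).
rewrite [X in hs _ _ _ X]addrC; apply: hsD.
  exact: hsM (hs_letter _ _ nB) (IH _ _ _ aw).
case: leqP => rn.
  have -> : Posz r + Negz n = Negz (n - r) by rewrite !NegzE; lia.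
  have nrB : (n - r < B)%N by apply: leq_ltn_trans nB; rewrite leq_subr.
  rewrite !op_neg mulrBl -!scalerAl.
  by apply: hsB; apply: hsZ; exact: hsM (hs_letter _ _ nrB) (hs_word aw).
have -> : Posz r + Negz n = Posz (r - n.+1) by rewrite NegzE subzn.
rewrite mul0r -[X in hs _ _ _ X](subrr 0).
by apply: hsB; apply: hsZ0; apply: hs_lower (fil_op _ _ (fil_word w)).
Qed.
End OpSym.
End Symbols.

(** * Multivariate polynomials *)

Section MPolyTools.
Variables (C : fieldType) (n : nat).
Local Notation A := {mpoly C[n]}.
Implicit Types (p q : A) (m : 'X_{1..n}) (v : 'I_n).

Lemma mpoly_ring_ind (P : A -> Prop) : (forall c, P c%:MP) -> (forall v, P 'X_v) ->
  (forall p q, P p -> P q -> P (p + q)) -> (forall p q, P p -> P q -> P (p * q)) ->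
  forall p, P p.
Proof.
move=> hC hX hD hM p; rewrite [p]mpolyE.
apply: (big_ind P) => [||m _]; [by rewrite -(mpolyC0 n C); apply: hC | exact: hD |].
rewrite -mul_mpolyC; apply: (hM); first exact: hC.
rewrite mpolyXE_id; apply: (big_ind P) => [||v _]; [by rewrite -(mpolyC1 n C); apply: hC | exact: hM |].
elim: (m v) => [|k IH]; first by rewrite expr0 -(mpolyC1 n C); apply: hC.
by rewrite exprS; apply: (hM).
Qed.

Section Lift.
Variables (W : lmodType C) (h : 'X_{1..n} -> W).
Definition mlift p : W := \sum_(m <- msupp p) p@_m *: h m.

Lemma mlift_sup p (s : seq 'X_{1..n}) : uniq s -> {subset msupp p <= s} ->
  mlift p = \sum_(m <- s) p@_m *: h m.
Proof.
move=> us sub; rewrite [RHS](bigID (mem (msupp p))) /= [X in _ + X]big1 ?addr0; last first.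
  by move=> m /memN_msupp_eq0 ->; rewrite scale0r.
rewrite -big_filter; apply: perm_big; apply: uniq_perm; rewrite ?filter_uniq ?msupp_uniq // => m.
by rewrite mem_filter; case hm: (m \in msupp p); rewrite //= sub.
Qed.

Lemma mlift_linear : linear mlift.
Proof.
move=> c p q; pose s := undup (msupp p ++ msupp q ++ msupp (c *: p + q)).
have hs (r : A) : {subset msupp r <= msupp p ++ msupp q ++ msupp (c *: p + q)} ->
    mlift r = \sum_(m <- s) r@_m *: h m.
  by move=> hr; apply: mlift_sup; [exact: undup_uniq | move=> m /hr; rewrite mem_undup].
rewrite !hs; try (by move=> m hm; rewrite !mem_cat hm ?orbT).
rewrite scaler_sumr -big_split; apply: eq_bigr => m _ /=.
by rewrite mcoeffD mcoeffZ scalerDl scalerA.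
Qed.
HB.instance Definition _ := GRing.isLinear.Build C A W _ mlift mlift_linear.

Lemma mliftX m : mlift 'X_[m] = h m.
Proof. by rewrite /mlift msuppX big_seq1 mcoeffX eqxx scale1r. Qed.
End Lift.

Section Hom.
Variables (B : comAlgType C) (h : 'I_n -> B).
Definition ahom p : B := mmap (in_alg B) h p.
Lemma ahomD p q : ahom (p + q) = ahom p + ahom q. Proof. by rewrite /ahom mmapD. Qed.
Lemma ahomM p q : ahom (p * q) = ahom p * ahom q. Proof. by rewrite /ahom rmorphM. Qed.
Lemma ahomZ c p : ahom (c *: p) = c *: ahom p.
Proof. by rewrite /ahom mmapZ /= mulr_algl. Qed.
Lemma ahomC c : ahom c%:MP = c%:A. Proof. by rewrite /ahom mmapC. Qed.
Lemma ahomX v : ahom 'X_v = h v. Proof. by rewrite /ahom mmapX mmap1U. Qed.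
Lemma ahom1 : ahom 1 = 1. Proof. by rewrite /ahom rmorph1. Qed.
Lemma ahom0 : ahom 0 = 0. Proof. by rewrite /ahom mmap0. Qed.
Lemma ahom_sum (J : Type) (r : seq J) (F : J -> A) :
  ahom (\sum_(j <- r) F j) = \sum_(j <- r) ahom (F j).
Proof. by elim: r => [|j r IH]; rewrite ?big_nil ?ahom0 // !big_cons ahomD IH. Qed.
End Hom.

Lemma mderivXU v w : mderiv v 'X_w = (w == v)%:R :> A.
Proof.
rewrite mderivX mnm1E; case: eqVneq => [->|_]; last by rewrite scale0r.
have -> : (U_(v) - U_(v))%MM = 0%MM by apply/mnmP => i; rewrite mnmBE subnn mnm0E.
by rewrite mpolyX0 scale1r.
Qed.

Section Derivation.
Variable g : 'I_n -> A.
Definition derv p : A := \sum_v g v * mderiv v p.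
Lemma derv_linear : linear derv.
Proof.
move=> c p q; rewrite /derv scaler_sumr -big_split; apply: eq_bigr => v _ /=.
by rewrite mderivD mderivZ mulrDr -scalerAr.
Qed.
HB.instance Definition _ := GRing.isLinear.Build C A A _ derv derv_linear.
Lemma dervM p q : derv (p * q) = derv p * q + p * derv q.
Proof.
rewrite /derv mulr_suml mulr_sumr -big_split; apply: eq_bigr => v _ /=.
by rewrite mderivM; ring.
Qed.
Lemma dervX v : derv 'X_v = g v.
Proof.
rewrite /derv (bigD1 v) //= big1 ?addr0 => [|w wv]; rewrite mderivXU ?eqxx ?mulr1 //.
by rewrite eq_sym (negPf wv) mulr0.
Qed.
Lemma dervC c : derv c%:MP = 0.
Proof. by rewrite /derv big1 // => v _; rewrite mderivC mulr0. Qed.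
End Derivation.

Lemma ahom_derv (B : comAlgType C) (h : 'I_n -> B) (g : 'I_n -> A) (d : B -> B) :
  linear d -> (forall x y, d (x * y) = d x * y + x * d y) ->
  (forall v, ahom h (g v) = d (h v)) -> forall p, ahom h (derv g p) = d (ahom h p).
Proof.
move=> dl dM hg.
have dD x y : d (x + y) = d x + d y by rewrite -{1}[x]scale1r dl scale1r.
have d0 : d 0 = 0 by have := dl (-1) 0 0; rewrite scaler0 addr0 scaleN1r addNr.
have d1 : d 1 = 0.
  have := dM 1 1; rewrite !mulr1 mul1r => /eqP.
  by rewrite -subr_eq0 opprD addrA subrr add0r oppr_eq0 => /eqP.
move=> r; elim/mpoly_ring_ind: r => [c|v|p q hp hq|p q hp hq].
- by rewrite dervC ahom0 ahomC -[c%:A]addr0 dl d1 d0 scaler0 addr0.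
- by rewrite dervX ahomX hg.
- by rewrite (linearD (derv g)) !ahomD dD hp hq.
- by rewrite dervM ahomD !ahomM dM hp hq.
Qed.

Section AtPoint.
Hypothesis chC : [pchar C] =i pred0.
Variable a : 'I_n -> C.

Definition dlist (s : seq 'I_n) p : A := foldl (fun q v => mderiv v q) p s.

Lemma dlistD s p q : dlist s (p + q) = dlist s p + dlist s q.
Proof. by elim: s p q => //= v s IH p q; rewrite mderivD IH. Qed.
Lemma dlist0 s : dlist s 0 = 0.
Proof. by elim: s => //= v s IH; rewrite mderiv0. Qed.
Lemma dlist_sum s (J : Type) (r : seq J) (F : J -> A) :
  dlist s (\sum_(j <- r) F j) = \sum_(j <- r) dlist s (F j).
Proof.
elim: r => [|j r IH]; first by rewrite !big_nil dlist0.
by rewrite !big_cons dlistD IH.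
Qed.
Lemma dlist_mderiv s v p : dlist s (mderiv v p) = mderiv v (dlist s p).
Proof. by elim: s p => //= w s IH p; rewrite mderiv_comm IH. Qed.

Lemma dlist_mul_vanish s g p :
  (forall t, (size t <= size s)%N -> meval a (dlist t p) = 0) -> meval a (dlist s (g * p)) = 0.
Proof.
elim: s g p => [|v s IH] g p h; first by rewrite /= mevalM (h [::]) // mulr0.
rewrite /= mderivM dlistD mevalD !IH ?addr0 // => t ht; last by apply: (h (v :: t)).
by apply: h; apply: leqW.
Qed.

(** In the Leibniz expansion only the term with all derivatives on [p] survives, as [p] vanishes at
    [a] to the order of [s]. *)
Lemma dlist_mul_lead s g p :
  (forall t, (size t < size s)%N -> meval a (dlist t p) = 0) ->
  meval a (dlist s (g * p)) = meval a g * meval a (dlist s p).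
Proof.
elim: s g p => [|v s IH] g p h; first by rewrite /= mevalM.
rewrite /= mderivM dlistD mevalD [X in X + _]dlist_mul_vanish ?add0r ?IH // => t ht.
by apply: (h (v :: t)).
Qed.

Lemma dlist_zero p : (forall s, meval a (dlist s p) = 0) -> p = 0.
Proof.
suff H k : (forall m, (k <= mdeg m)%N -> p@_m = 0) -> (forall s, meval a (dlist s p) = 0) -> p = 0.
  by apply: (H (msize p)) => m hm; apply: memN_msupp_eq0; apply: msize_mdeg_ge.
elim: k p => [|k IH] p hk h; first by apply/mpolyP => m; rewrite hk // mcoeff0.
have dp v : mderiv v p = 0.
  apply: IH => [m hm|s]; last exact: (h (v :: s)).
  by rewrite mcoeff_mderiv hk ?mul0rn // mdegD mdeg1 addn1 ltnS.
have pc : p = (p@_0)%:MP.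
  apply/mpolyP => m; rewrite mcoeffC; case: eqVneq => [->|m0]; rewrite ?mulr1 ?mulr0 //.
  have [v hv] : exists v, m v != 0%N.
    apply/existsP; apply: contraR m0; rewrite negb_exists => /forallP h0.
    by apply/eqP/mnmP => v; rewrite mnm0E; apply/eqP; have := h0 v; rewrite negbK.
  have := mcoeff_mderiv v p (m - U_(v)); rewrite dp mcoeff0 submK ?lep1mP //.
  move/esym/eqP; rewrite -mulr_natr mulf_eq0 => /orP[/eqP //|].
  by move/pcharf0P: chC => ->.
by have := h [::]; rewrite /= pc mevalC => ->; rewrite mpolyC0.
Qed.
End AtPoint.
End MPolyTools.

(** * Symmetric functions of a matrix *)

Section Commutative.
Variables (C : fieldType) (N : nat) (A : comAlgType C).
Local Notation I := 'I_N.
Local Notation M := (seq I -> seq I -> A).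
Implicit Types (f g : M) (i j k l : I) (Y Z : 'M[A]_N).

Definition mulL Y i j (u : A) : A := Y i j * u.
Lemma mulL_linear Y i j : linear (mulL Y i j).
Proof. by move=> c u v; rewrite /mulL mulrDr scalerAr. Qed.
HB.instance Definition _ Y i j := GRing.isLinear.Build C A A _ (mulL Y i j) (mulL_linear Y i j).

Lemma sum_pick (W : lmodType C) (k : I) (F : I -> W) : \sum_i (i == k)%:R *: F i = F k.
Proof.
rewrite (bigD1 k) //= eqxx scale1r big1 ?addr0 // => i /negPf ->.
by rewrite scale0r.
Qed.

Section Eps.
Variable eps : C.
Hypothesis eps2 : eps * eps = 1.

Local Notation ca := (@ca C I eps A).
Local Notation cb := (@cb C I eps A).
Local Notation da := (@da C I A).
Local Notation db := (@db C I A).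
Local Notation LL Y := (LL eps (fun i j => mulL Y i j : {linear A -> A})).
Local Notation LZ Y := (LZ eps (fun i j => mulL Y i j : {linear A -> A})).
Local Notation FF Y := (FF eps (fun i j => mulL Y i j : {linear A -> A}) 1).
Local Notation kp := (kp eps).
Definition tau Y n : A := pr n (FF Y n).

Lemma lf_mulL Y Z i j k l f : lf (mulL Y i j) (lf (mulL Z k l) f) = lf (mulL Z k l) (lf (mulL Y i j) f).
Proof. by apply/funext => s; apply/funext => t; rewrite /lf /mulL mulrCA. Qed.

Lemma LL_mulL_comm Y Z f : LL Y (LL Z f) = LL Z (LL Y f).
Proof. by apply: LL_comm => // i j k l u; rewrite /= /mulL mulrCA. Qed.

Lemma LL_LZ Y l f : LL Y (LZ Y l f) = eps *: LZ Y l (LL Y f).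
Proof.
rewrite /Submission.LZ !LL_sum scaler_sumr.
under eq_bigr => i _ do under eq_bigr => j _ do rewrite lf_sum cb_sum ca_sum.
under eq_bigr => i _ do rewrite exchange_big /=.
rewrite exchange_big /=; apply: eq_bigr => k _.
rewrite lf_sum ca_sum scaler_sumr; apply: eq_bigr => i _.
rewrite lf_sum ca_sum scaler_sumr; apply: eq_bigr => j _.
by rewrite !lf_ca lf_cb lf_mulL -!ca_cb (ca_ca eps2 i k).
Qed.

Lemma db_FFc Y l n : db l (FF Y n.+1) = n.+1%:R *: LZ Y l (FF Y n).
Proof.
elim: n => [|n IH]; first by rewrite /= db_LL db_vac LL0 scaler0 addr0 scale1r.
rewrite -[FF Y n.+2]/(LL Y (FF Y n.+1)) db_LL IH LLZ LL_LZ -[LL Y (FF Y n)]/(FF Y n.+1).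
transitivity (LZ Y l (FF Y n.+1) + (eps * eps * n.+1%:R) *: LZ Y l (FF Y n.+1)); first by lmod.
by rewrite eps2 [in RHS]mulrS; lmod.
Qed.

(** A polarisation of [tau]: one factor [Y] is replaced by [Z]. *)
Definition mixed Y Z n : A := pr n.+1 (LL Z (FF Y n)).

(** In the contraction the factor [Z] either closes up into its trace or is linked to one of the
    factors [Y], with which it merges into [Y *m Z]. *)
Lemma mixedE Y Z n : mixed Y Z n = n.+1%:R *: (\tr Z * tau Y n) +
  (eps * (n * n.+1)%:R) *: mixed Y (Y *m Z) n.-1.
Proof.
have sF m := symf_FF eps2 (fun i j => mulL Y i j : {linear A -> A}) 1 m.
rewrite /mixed LL_sum.
have prs m (J : Type) (r : seq J) (F : J -> M) : pr m (\sum_(x <- r) F x) = \sum_(x <- r) pr m (F x).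
  exact: linear_sum.
rewrite prs (eq_bigr (fun i => \sum_j (n.+1%:R *: ((j == i)%:R *: (Z i j * tau Y n)) +
   (eps * n.+1%:R) *: pr n (cb j (lf (mulL Z i j) (db i (FF Y n))))))); last first.
  move=> i _; rewrite prs; apply: eq_bigr => j _.
  rewrite (pr_ca eps2); last by apply/(symf_cb eps2)/symf_lf.
  have e : pr n (lf (mulL Z i j) (FF Y n)) = Z i j * tau Y n.
    exact: (pr_lf (mulL Z i j)).
  rewrite db_cb prD !prZ e (eq_sym i) -lf_db.
  by move: (pr n (cb j _)) (Z i j * _) => a b; lmod.
under eq_bigr => i _ do rewrite big_split /= -!scaler_sumr sum_pick.
rewrite big_split /= -!scaler_sumr -mulr_suml; congr (_ + _).
case: n => [|n].
  by rewrite mul0n mulr0 scale0r big1 ?scaler0 // => i _; rewrite big1.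
rewrite (eq_bigr (fun i => n.+1%:R *: \sum_j \sum_a pr n.+1 (ca a (cb j (lf (mulL Z i j) (lf (mulL Y a i) (FF Y n))))))).
  rewrite -scaler_sumr scalerA LL_sum. rewrite prs.
  congr (_ *: _); first by rewrite natrM; ring.
  under eq_bigr => i _ do rewrite exchange_big /=.
  rewrite exchange_big /=; apply: eq_bigr => a _; rewrite prs.
  rewrite exchange_big /=; apply: eq_bigr => j _; rewrite -prs -ca_sum -cb_sum.
  congr (pr _ (ca _ (cb _ _))); apply/funext => s; apply/funext => t.
  rewrite /lf /mulL mxE mulr_suml.
  have ev : forall F : I -> M, (\sum_i F i) s t = \sum_i F i s t.
    by move=> F; elim/big_rec2: _ => [//|i x y _ <-].
  by rewrite ev; apply: eq_bigr => i _; rewrite mulrCA mulrA.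
move=> i _; rewrite scaler_sumr; apply: eq_bigr => j _.
rewrite db_FFc lfZ cbZ prZ /Submission.LZ lf_sum cb_sum prs; congr (_ *: _).
by apply: eq_bigr => a _; rewrite lf_ca -ca_cb.
Qed.

Hypothesis chC : [pchar C] =i pred0.
Let natC n : (n.+1)%:R != 0 :> C.
Proof. by move/pcharf0P: chC => ->. Qed.
Let factC n : (n`!)%:R != 0 :> C.
Proof. by rewrite -(prednK (fact_gt0 n)). Qed.

(* The n-th elementary (eps = -1) or complete (eps = 1) symmetric function of *)
(* the eigenvalues of Y.                                                      *)
Definition sy_ Y n : A := ((n`!%:R)^-1 ^+ 2) *: tau Y n.

Lemma sy0 Y : sy_ Y 0 = 1.
Proof. by rewrite /sy_ invr1 expr1n scale1r. Qed.

Definition rr Y Z n : A := ((n.+1)`!%:R * n`!%:R)^-1 *: mixed Y Z n.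

Lemma rrE Y Z n : rr Y Z n = \sum_(j < n.+1) eps ^+ j *: (\tr (iter j (mulmx Y) Z) * sy_ Y (n - j)).
Proof.
elim: n Z => [|n IH] Z; rewrite /rr mixedE.
  rewrite big_ord1 mul0n mulr0 scale0r addr0 /sy_ !expr0 !scale1r !invr1 mulr1.
  by rewrite invr1 expr1n !scale1r.
rewrite big_ord_recl /= expr0 scale1r subn0 scalerDr; congr (_ + _).
  rewrite /sy_ scalerA -scalerAr; congr (_ *: _).
  rewrite factS natrM; move: (factC n.+1) (natC n.+1).
  move: ((n.+1)`!%:R) (n.+2%:R) => a b ha hb; field.
  by rewrite ?ha ?hb.
rewrite scalerA.
transitivity (eps *: rr Y (Y *m Z) n).
  rewrite /rr scalerA; congr (_ *: _); rewrite !factS !natrM.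
  move: (factC n) (natC n) (natC n.+1).
  move: (n`!%:R) (n.+1%:R) (n.+2%:R) => a b c ha hb hc; field.
  by rewrite ?ha ?hb ?hc.
rewrite IH scaler_sumr; apply: eq_bigr => j _.
by rewrite scalerA -exprS -iterSr /bump /= add1n subSS.
Qed.

(** Newton's identities are the case [Z = Y] of [rrE], since [mixed Y Y n] is [tau Y n.+1]. *)
Lemma newton Y n : n.+1%:R *: sy_ Y n.+1 =
  \sum_(j < n.+1) eps ^+ j *: (\tr (iter j (mulmx Y) Y) * sy_ Y (n - j)).
Proof.
rewrite -rrE /rr /sy_ /mixed -[pr n.+1 _]/(tau Y n.+1) scalerA; congr (_ *: _).
rewrite factS natrM; move: (factC n) (natC n).
move: (n`!%:R) (n.+1%:R) => a b ha hb; field.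
by rewrite ?ha ?hb.
Qed.
End Eps.

Section ElementaryComplete.
Hypothesis chC : [pchar C] =i pred0.

Lemma coefM_low (K : nzRingType) n (p q p' q' : {poly K}) :
  (forall a, (a <= n)%N -> p`_a = p'`_a) -> (forall a, (a <= n)%N -> q`_a = q'`_a) ->
  (p * q)`_n = (p' * q')`_n.
Proof.
move=> hp hq; rewrite !coefM; apply: eq_bigr => j _.
by congr (_ * _); [apply: hp; rewrite -ltnS | apply: hq; rewrite leq_subr].
Qed.

(** For the generating functions, Newton's identities read [E' = - P E] and [H' = P H], so [E H] has
    zero derivative. All series are truncated beyond the degree that matters. *)
Lemma elem_complete Y m : \sum_(k < m.+2) (-1) ^+ k *: (sy_ (-1) Y k * sy_ 1 Y (m.+1 - k)) = 0.
Proof.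
pose P : {poly A} := \poly_(a < m.+2) \tr (iter a (mulmx Y) Y).
pose E : {poly A} := \poly_(a < m.+2) ((-1) ^+ a *: sy_ (-1) Y a).
pose H : {poly A} := \poly_(a < m.+2) sy_ 1 Y a.
have h1 : (1 : C) * 1 = 1 by rewrite mulr1.
have hN : (-1 : C) * -1 = 1 by rewrite mulrNN mulr1.
have dE n : (n <= m)%N -> (E^`())`_n = (- (P * E))`_n.
  move=> nm; rewrite coef_deriv coefN coefM coef_poly ltnS ltnS nm -scaler_nat.
  rewrite scalerA mulrC -scalerA (newton hN) // scaler_sumr -sumrN; apply: eq_bigr => j _.
  have jn : (j <= n)%N by rewrite -ltnS.
  rewrite !coef_poly ifT; last by lia.
  rewrite ifT; last by lia.
  rewrite scalerA -[in RHS]scalerAr -[in RHS]scaleNr; congr (_ *: _).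
  rewrite exprS mulN1r mulNr; congr (- _).
  by rewrite -{1}(subnK jn) exprD -mulrA -exprD addnn -mul2n exprM sqrrN expr1n expr1n mulr1.
have dH n : (n <= m)%N -> (H^`())`_n = (P * H)`_n.
  move=> nm; rewrite coef_deriv coefM coef_poly ltnS ltnS nm -scaler_nat.
  rewrite (newton h1) //; apply: eq_bigr => j _.
  have jn : (j <= n)%N by rewrite -ltnS.
  rewrite !coef_poly ifT; last by lia.
  rewrite ifT; last by lia.
  by rewrite expr1n scale1r.
have : ((E * H)^`())`_m = 0.
  rewrite derivM coefD (@coefM_low _ m E^`() H (- (P * E)) H) //.
  rewrite (@coefM_low _ m E H^`() E (P * H)) // -coefD.
  by rewrite mulNr mulrCA mulrA addNr coef0.
rewrite coef_deriv -scaler_nat => /eqP; rewrite scaler_eq0.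
have /negPf -> /= : (m.+1)%:R != 0 :> C by move/pcharf0P: chC => ->.
move/eqP => e0; rewrite -[RHS]e0 coefM; apply: eq_bigr => j _.
by rewrite !coef_poly ltn_ord ltnS leq_subr scalerAl.
Qed.
End ElementaryComplete.
End Commutative.

(** * Characteristic polynomials *)

Definition dl (T : Type) p (s : seq T) := take p s ++ drop p.+1 s.

Lemma size_dl (T : Type) p n (s : seq T) : size s = n.+1 -> (p < n.+1)%N -> size (dl p s) = n.
Proof. by move=> sn pn; rewrite /dl size_cat size_take size_drop sn pn; lia. Qed.

Lemma nth_dl (T : Type) d p (s : seq T) q : (p < size s)%N -> nth d (dl p s) q = nth d s (bump p q).
Proof.
move=> ps; rewrite /dl nth_cat size_take ps /bump; case: ltnP => h.
  by rewrite nth_take.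
by rewrite nth_drop; congr nth; lia.
Qed.

Lemma crE (C : comNzRingType) (T : eqType) (eps : C) (W : lmodType C) (d i : T)
  (g : seq T -> W) s : cr eps i g s =
  \sum_(p < size s) (eps ^+ p * (nth d s p == i)%:R) *: g (dl p s).
Proof.
elim: s g => [|x s IH] g; first by rewrite big_ord0.
rewrite -[LHS]/((x == i)%:R *: g s + eps *: cr eps i (fun t => g (x :: t)) s) IH.
rewrite big_ord_recl /= expr0 mul1r /dl /= drop0; congr (_ + _).
rewrite scaler_sumr; apply: eq_bigr => p _; rewrite scalerA exprS mulrA.
by rewrite /bump /= add1n.
Qed.

Section Determinant.
Variables (C : fieldType) (N : nat) (A : comAlgType C).
Local Notation I := 'I_N.
Implicit Types (Y Z : 'M[A]_N).
Let eN2 : (-1 : C) * -1 = 1. Proof. by rewrite mulrNN mulr1. Qed.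
Local Notation LL Y := (LL (-1 : C) (fun i j => mulL Y i j : {linear A -> A})).
Local Notation FF Y := (FF (-1 : C) (fun i j => mulL Y i j : {linear A -> A}) 1).

Local Notation kpN := (@kp C I (-1) A).

Lemma sumfE (T J : Type) (V : lmodType C) (r : seq J) (F : J -> T -> V) x :
  (\sum_(j <- r) F j) x = \sum_(j <- r) F j x.
Proof. by elim/big_rec2: _ => [//|j y z _ <-]. Qed.

Lemma LL_minor Y (d : I) f s t : LL Y f s t = \sum_(p < size s) \sum_(q < size t)
  (-1) ^+ (p + q) *: (Y (nth d s p) (nth d t q) * f (dl p s) (dl q t)).
Proof.
rewrite LL_sum sumfE sumfE.
transitivity (\sum_i \sum_j \sum_(p < size s) \sum_(q < size t)
   (nth d s p == i)%:R *: ((nth d t q == j)%:R *: ((-1) ^+ (p + q) *: (Y i j * f (dl p s) (dl q t))))).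
  apply: eq_bigr => i _; rewrite !sumfE; apply: eq_bigr => j _.
  rewrite /ca (crE (-1) d i) sumfE; apply: eq_bigr => p _.
  rewrite -[LHS]/(_ *: (cr (-1) j (lf (mulL Y i j) f (dl p s)) t)) (crE (-1) d j).
  rewrite scaler_sumr; apply: eq_bigr => q _; rewrite /lf /mulL !scalerA; congr (_ *: _).
  by rewrite exprD; ring.
under eq_bigr => i _ do rewrite exchange_big /=.
rewrite exchange_big /=; apply: eq_bigr => p _.
under eq_bigr => i _ do rewrite exchange_big /=.
rewrite exchange_big /=; apply: eq_bigr => q _.
under eq_bigr => i _.
  rewrite -scaler_sumr.
  under eq_bigr => j _ do rewrite eq_sym.
  rewrite (sum_pick (nth d t q) (fun j => (-1) ^+ (p + q) *: (Y i j * f (dl p s) (dl q t)))) eq_sym.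
over.
by rewrite (sum_pick (nth d s p) (fun i => (-1) ^+ (p + q) *: (Y i _ * f (dl p s) (dl q t)))).
Qed.

Definition mnr Y d n (s t : seq I) : A :=
  \det (\matrix_(p < n, q < n) Y (nth d s p) (nth d t q)).

(** For each fixed [p], the sum over [q] in [LL_minor] is the Laplace expansion along row [p]; the
    [n] rows account for the factor [n] in the factorial. *)
Lemma FF_minor Y d n s t : size s = n -> size t = n ->
  FF Y n s t = n`!%:R *: mnr Y d n s t.
Proof.
elim: n s t => [|n IH] s t ss st.
  by case: s ss => // _; case: t st => // _; rewrite /mnr det_mx00 scale1r.
rewrite -[FF Y n.+1]/(LL Y (FF Y n)) (LL_minor Y d) ss st.
rewrite (eq_bigr (fun=> n`!%:R *: mnr Y d n.+1 s t)) => [|p _].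
  by rewrite sumr_const card_ord -scaler_nat scalerA -natrM factS.
rewrite /mnr (expand_det_row _ p) scaler_sumr; apply: eq_bigr => q _.
have sgn k (x : A) : (-1 : C) ^+ k *: x = (-1) ^+ k * x.
  elim: k => [|k IHk]; first by rewrite !expr0 scale1r mul1r.
  by rewrite !exprS -scalerA IHk scaleN1r mulN1r mulNr.
have e : mnr Y d n (dl p s) (dl q t) =
    \det (row' p (col' q (\matrix_(a < n.+1, b < n.+1) Y (nth d s a) (nth d t b)))).
  by congr (\det _); apply/matrixP => a b; rewrite !mxE !nth_dl ?ss ?st.
rewrite IH ?(size_dl ss) ?(size_dl st) // sgn e mxE /cofactor -scalerAr -scalerAr.
by congr (_ *: _); rewrite mulrCA.
Qed.

Lemma sum_tuple_cons (J : finType) (W : zmodType) n (F : seq J -> W) :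
  \sum_(t : n.+1.-tuple J) F t = \sum_x \sum_(t : n.-tuple J) F (x :: t).
Proof.
rewrite pair_big (reindex (fun p : J * n.-tuple J => [tuple of p.1 :: p.2])) //=.
exists (fun t : n.+1.-tuple J => (thead t, [tuple of behead t])) => [[x t]|t] _.
  by rewrite /= theadE; congr (_, _); apply: val_inj.
by rewrite [in RHS](tuple_eta t); apply: val_inj.
Qed.

Lemma pr_tuple (V : lmodType C) n (f : seq I -> seq I -> V) :
  pr n f = \sum_(t : n.-tuple I) f t t.
Proof.
elim: n f => [|n IH] f.
  rewrite (big_pred1 [tuple]) // => t; apply/esym/eqP; exact: tuple0.
rewrite prS (sum_tuple_cons n (fun t => f t t)).
by apply: eq_bigr => x _; rewrite IH.
Qed.

(** A repeated index gives two equal rows; each of the [N!] tuples without repetition permutes rows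
    and columns alike and gives the determinant. *)
Lemma sum_minors Y d : \sum_(t : N.-tuple I) mnr Y d N t t = N`!%:R * \det Y.
Proof.
have h (t : N.-tuple I) : mnr Y d N t t = if uniq t then \det Y else 0.
  have e : mnr Y d N t t = \det (\matrix_(p, q) Y (tnth t p) (tnth t q)).
    by congr (\det _); apply/matrixP => p q; rewrite !mxE -!tnth_nth.
  rewrite e; case: ifP => ut.
    have inj : injective (tnth t) by apply/tuple_uniqP.
    have -> : \matrix_(p, q) Y (tnth t p) (tnth t q) = row_perm (perm inj) (col_perm (perm inj) Y).
      by apply/matrixP => p q; rewrite !mxE !permE.
    rewrite row_permE col_permE !det_mulmx !det_perm mulrCA -signr_addb.
    by rewrite odd_permV addbb mulr1.
  have [p [q [pq e2]]] : exists p q, p != q /\ tnth t p = tnth t q.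
    apply: contrapT => hn; move/negP: ut; apply; apply/tuple_uniqP => p q epq.
    by apply: contrapT => npq; apply: hn; exists p, q; split=> //; apply/eqP.
  by apply: (determinant_alternate pq) => b; rewrite !mxE e2.
rewrite (eq_bigr _ (fun t _ => h t)) -big_mkcond /= sumr_const.
have := card_uniq_tuples N [pred x : I | true].
rewrite card_ord ffactnn => <-; rewrite mulr_natl; congr (_ *+ _).
by apply: eq_card => t; rewrite !inE; rewrite all_predT.
Qed.

Lemma tau_det Y : (0 < N)%N -> tau (-1 : C) Y N = (N`!%:R ^+ 2) *: \det Y.
Proof.
move=> N0; pose d : I := Ordinal N0.
rewrite /tau pr_tuple (eq_bigr (fun t : N.-tuple I => N`!%:R *: mnr Y d N t t)).
  by rewrite -scaler_sumr sum_minors expr2 -scalerA; congr (_ *: _); rewrite scaler_nat mulr_natl.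
by move=> t _; rewrite (FF_minor Y d) ?size_tuple.
Qed.

Definition lincomb (al be : C) Y : 'M[A]_N := \matrix_(i, j) (((i == j)%:R * al)%:A + be *: Y i j).

Lemma LL_lincomb al be Y f : LL (lincomb al be Y) f = al *: kpN f + be *: LL Y f.
Proof.
rewrite !LL_sum /kp !scaler_sumr -big_split; apply: eq_bigr => i _ /=.
transitivity (\sum_j ((j == i)%:R *: (al *: ca (-1) i (cb (-1) j f)) +
   be *: ca (-1) i (cb (-1) j (lf (mulL Y i j) f)))).
  apply: eq_bigr => j _; rewrite scalerA -!caZ -!cbZ -caD -cbD; congr (ca _ _ (cb _ _ _)).
  apply/funext => s; apply/funext => t; rewrite /lf /mulL mxE mulrDl mulr_algl eq_sym.
  by rewrite -scalerAl.
by rewrite big_split /= (sum_pick i (fun j => al *: ca (-1) i (cb (-1) j f))) -scaler_sumr.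
Qed.

(** The binomial theorem, as [kp] and [LL Y] commute. *)
Lemma FF_lincomb al be Y n : FF (lincomb al be Y) n =
  \sum_(k < n.+1) ('C(n, k)%:R * al ^+ (n - k) * be ^+ k) *: iter (n - k) (kpN) (FF Y k).
Proof.
elim: n => [|n IH]; first by rewrite big_ord1 bin0 !expr0 !mulr1 scale1r.
rewrite -[FF _ n.+1]/(LL (lincomb al be Y) (FF (lincomb al be Y) n)) LL_lincomb IH.
have kps (r : seq 'I_n.+1) (F : 'I_n.+1 -> seq I -> seq I -> A) :
    kpN (\sum_(x <- r) F x) = \sum_(x <- r) kpN (F x) by exact: linear_sum.
have lls (r : seq 'I_n.+1) (F : 'I_n.+1 -> seq I -> seq I -> A) :
    LL Y (\sum_(x <- r) F x) = \sum_(x <- r) LL Y (F x) by exact: linear_sum.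
have llk m f : LL Y (iter m (kpN) f) = iter m (kpN) (LL Y f).
  by elim: m => //= m IHm; rewrite LL_kp // IHm.
rewrite kps lls !scaler_sumr.
pose G k := iter (n.+1 - k) (kpN) (FF Y k) : seq I -> seq I -> A.
rewrite (eq_bigr (fun k : 'I_n.+1 => ('C(n, k)%:R * al ^+ (n.+1 - k) * be ^+ k) *: G k)); last first.
  move=> k _; rewrite kpZ scalerA /G subSn -1?ltnS //=; congr (_ *: _).
  by rewrite exprS; ring.
rewrite [X in _ + X](eq_bigr (fun k : 'I_n.+1 => ('C(n, k)%:R * al ^+ (n - k) * be ^+ k.+1) *: G k.+1)); last first.
  move=> k _; rewrite LLZ scalerA /G subSS llk; congr (_ *: _).
  by rewrite exprS; ring.
rewrite big_ord_recl [X in _ + X]big_ord_recr [RHS]big_ord_recl [X in _ = _ + X]big_ord_recr /=.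
rewrite !bin0 !binn addrA -(addrA (_ *: G 0%N)) -big_split /= !addrA subSS.
congr (_ + _ + _); apply: eq_bigr => k _ /=.
rewrite /bump /= !add1n subSS binS natrD -scalerDl; congr (_ *: _).
by ring.
Qed.

(** Each [pr_kp] at [eps = -1] contributes dimension minus degree, and these factors build the
    falling factorial of [N - k]. *)
Lemma pr_iter_kp f k s : symf (-1 : C) f -> (k + s <= N)%N ->
  k`!%:R *: pr (k + s) (iter s (kpN) f) = ((k + s)`! * (N - k) ^_ s)%:R *: pr k f.
Proof.
move=> sf; elim: s => [|s IH] ks; first by rewrite addn0 ffactn0 muln1.
have sfi : symf (-1 : C) (iter s (kpN) f) by elim: s {IH ks} => //= s IHs; apply: symf_kp.
rewrite addnS /= (pr_kp eN2) // card_ord scalerA mulrC -scalerA IH; last by lia.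
rewrite scalerA; congr (_ *: _); rewrite factS ffactnSr mulN1r.
have -> : N%:R - (k + s)%:R = ((N - k) - s)%:R :> C by rewrite -subnDA natrB //; lia.
by rewrite -!natrM; congr (_%:R); lia.
Qed.

(** This identifies [sy_ (-1) Y] with the coefficients of the characteristic polynomial: the
    determinant is a contraction by [tau_det], and [FF_lincomb] expands it. *)
Lemma det_lincomb al be Y : [pchar C] =i pred0 -> (0 < N)%N ->
  \det (lincomb al be Y) = \sum_(k < N.+1) (al ^+ (N - k) * be ^+ k) *: sy_ (-1) Y k.
Proof.
move=> chC N0.
have factC n : (n`!)%:R != 0 :> C.
  by move/pcharf0P: chC => ->; rewrite -lt0n fact_gt0.
have e2 : \det (lincomb al be Y) = (N`!%:R ^+ 2)^-1 *: tau (-1) (lincomb al be Y) N.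
  by rewrite tau_det // scalerA mulVf ?scale1r // expf_neq0.
have prs (J : Type) (r : seq J) (F : J -> seq I -> seq I -> A) :
    pr N (\sum_(x <- r) F x) = \sum_(x <- r) pr N (F x) by exact: linear_sum.
rewrite e2 /tau FF_lincomb prs scaler_sumr; apply: eq_bigr => k _.
have kN : (k <= N)%N by rewrite -ltnS.
rewrite prZ.
have := @pr_iter_kp (FF Y k) k (N - k) (symf_FF eN2 _ _ _).
rewrite subnKC // ffactnn => /(_ (leqnn N)) => /(congr1 (fun x => (k`!%:R)^-1 *: x)).
rewrite !scalerA mulVf // scale1r => ->.
rewrite /sy_ /tau !scalerA; congr (_ *: _).
have := bin_fact kN => /(congr1 (fun x => x%:R : C)); rewrite !natrM => eb.
have f1 := factC N; have f2 := factC k; have f3 := factC (N - k)%N.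
move: eb f1 f2 f3; move: (N`!%:R) (k`!%:R) ((N - k)`!%:R) ('C(N, k)%:R) => a b c x <- f1 f2 f3.
field; rewrite ?f1 ?f2 ?f3 /=; by move: f1; rewrite mulf_eq0 negb_or => /andP[-> _].
Qed.
End Determinant.

(** * A slice for the adjoint action of gl_N[s] *)

Lemma natr_inj (C : fieldType) : [pchar C] =i pred0 -> injective (fun n => n%:R : C).
Proof.
move=> /pcharf0P ch m n; wlog mn : m n / (m <= n)%N.
  by move=> h e; case: (leqP m n) => hmn; [apply: h | apply/esym/h => //; apply: ltnW].
move/eqP; rewrite eq_sym -subr_eq0 -natrB // ch subn_eq0 => nm.
by apply/eqP; rewrite eqn_leq mn.
Qed.

Lemma poly_nat_eq0 (K : idomainType) (q : {poly K}) :
  injective (fun n => n%:R : K) -> (forall n, q.[n%:R] = 0) -> q = 0.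
Proof.
move=> inj h; apply: (@roots_geq_poly_eq0 _ _ [seq n%:R | n <- iota 0 (size q)]).
- by apply/allP => x /mapP[m _ ->]; apply/rootP.
- by rewrite map_inj_uniq ?iota_uniq.
- by rewrite size_map size_iota.
Qed.

Section Slice.
Variables (C : fieldType) (N L : nat).
Local Notation XL := ('I_N * 'I_N * 'I_L)%type.
Local Notation nv := #|{: XL}|.
Local Notation A := {mpoly C[nv]}.

Definition xi (x : LP N) : A :=
  if insub x.2 is Some n then 'X_(enum_rank (x.1.1, x.1.2, n)) else 0.

Lemma xi_ord (v : 'I_nv) : let: (k, l, n) := enum_val v in xi (k, l, n : nat) = 'X_v.
Proof.
by case e: (enum_val v) => [[k l] n]; rewrite /xi /= valK -e enum_valK.
Qed.
Lemma xi_lt k l n (nL : (n < L)%N) : xi (k, l, n) = 'X_(enum_rank (k, l, Ordinal nL)).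
Proof. by rewrite /xi /= insubT. Qed.
Lemma xi_big k l n : (L <= n)%N -> xi (k, l, n) = 0.
Proof. by move=> nL; rewrite /xi /= insubF //; apply/negbTE; rewrite -leqNgt. Qed.

(* The variable xi (i, j, n) is the n-th coefficient of the (i, j) entry of a *)
(* point of gl_N[s]/s^L, and is also the symbol of E_ij[-n-1]; [shiftd] is the*)
(* symbol of the translation and [curr r i j] that of E_ij t^r.               *)
Definition shift_coef (v : 'I_nv) : A := let: (k, l, n) := enum_val v in n.+1%:R *: xi (k, l, n.+1).
Definition shiftd : {linear A -> A} := derv shift_coef.
Lemma shiftd_xi k l n : shiftd (xi (k, l, n)) = n.+1%:R *: xi (k, l, n.+1).
Proof.
case: (ltnP n L) => nL; last by rewrite !xi_big ?linear0 ?scaler0 // ltnW.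
by rewrite xi_lt /shiftd /= dervX /shift_coef enum_rankK.
Qed.

Definition curr_coef r (i j : 'I_N) (v : 'I_nv) : A := let: (k, l, n) := enum_val v in
  if (r <= n)%N then (k == j)%:R *: xi (i, l, (n - r)%N) - (i == l)%:R *: xi (k, j, (n - r)%N)
  else 0.
Definition curr r i j : {linear A -> A} := derv (curr_coef r i j).
Lemma curr_xi r i j k l n : (n < L)%N -> curr r i j (xi (k, l, n)) =
  if (r <= n)%N then (k == j)%:R *: xi (i, l, (n - r)%N) - (i == l)%:R *: xi (k, j, (n - r)%N)
  else 0.
Proof. by move=> nL; rewrite xi_lt /curr /= dervX /curr_coef enum_rankK. Qed.

Implicit Types (K Y : 'M[{poly C}]_N).
Definition pt K (v : 'I_nv) : C := let: (k, l, n) := enum_val v in (K k l)`_n.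

Lemma meval_pt K k l n : (n < L)%N -> meval (pt K) (xi (k, l, n)) = (K k l)`_n.
Proof. by move=> nL; rewrite xi_lt mevalXU /pt enum_rankK. Qed.

Definition compan (c : 'I_N -> {poly C}) : 'M[{poly C}]_N :=
  \matrix_(i, j) if i == N.-1 :> nat then c j else (i.+1 == j :> nat)%:R.

(* The current Y acts at the point K by the commutator [Y, K]. *)
Lemma curr_pt K Y v : \sum_(r < L) \sum_i \sum_j (Y j i)`_r * meval (pt K) (curr_coef r i j v) =
  let: (k, l, n) := enum_val v in ((Y *m K) k l - (K *m Y) k l)`_n.
Proof.
rewrite /curr_coef; case: (enum_val v) => [[k l] n].
have nrL r : (n - r < L)%N by apply: leq_ltn_trans (leq_subr _ _) (ltn_ord n).
pose F r : C := \sum_i (Y k i)`_r * (K i l)`_(n - r) - \sum_j (Y j l)`_r * (K k j)`_(n - r).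
transitivity (\sum_(r < L | (r <= n)%N) F r).
  rewrite /F [RHS]big_mkcond; apply: eq_bigr => r _; case: ifP => rn; last first.
    by rewrite big1 // => i _; rewrite big1 // => j _; rewrite meval0 mulr0.
  transitivity (\sum_i ((Y k i)`_r * (K i l)`_(n - r) -
      \sum_j (i == l)%:R * ((Y j i)`_r * (K k j)`_(n - r)))).
    apply: eq_bigr => i _.
    transitivity (\sum_j ((j == k)%:R * ((Y j i)`_r * (K i l)`_(n - r)) -
      (i == l)%:R * ((Y j i)`_r * (K k j)`_(n - r)))).
      apply: eq_bigr => j _; rewrite mevalB !mevalZ !meval_pt // (eq_sym k); ring.
    rewrite sumrB (bigD1 k) //= eqxx mul1r big1 ?addr0 // => j /negPf ->; exact: mul0r.
  rewrite sumrB; congr (_ - _); rewrite (bigD1 l) //= [X in _ + X]big1 ?addr0.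
    by apply: eq_bigr => j _; rewrite eqxx mul1r.
  by move=> i /negPf ->; apply: big1 => j _; rewrite mul0r.
transitivity (\sum_(r < n.+1) F r); first by rewrite (big_ord_widen L F (ltn_ord n)).
rewrite /F !mxE coefB !coef_sum sumrB; congr (_ - _).
  by rewrite exchange_big; apply: eq_bigr => i _; rewrite coefM.
rewrite exchange_big; apply: eq_bigr => j _; rewrite mulrC coefM.
by apply: eq_bigr => r _; rewrite mulrC.
Qed.

Hypothesis chC : [pchar C] =i pred0.

(** Restricted to the line, [Q] is a polynomial in one variable that vanishes at all natural
    numbers, hence is zero together with its derivative. *)
Lemma mderiv_line (a : 'I_nv -> C) v0 (Q : A) :
  (forall t : C, meval (fun v => a v + t * (v == v0)%:R) Q = 0) -> meval a (mderiv v0 Q) = 0.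
Proof.
move=> h; pose G := ahom (fun v => (a v)%:P + (v == v0)%:R *: 'X : {poly C}).
have ev t P : (G P).[t] = meval (fun v => a v + t * (v == v0)%:R) P.
  elim/mpoly_ring_ind: P => [c|v|p q hp hq|p q hp hq].
  - by rewrite /G ahomC hornerZ hornerC mulr1 mevalC.
  - by rewrite /G ahomX mevalXU !hornerE mulrC.
  - by rewrite /G ahomD hornerD hp hq mevalD.
  - by rewrite /G ahomM hornerM hp hq mevalM.
have G0 : G Q = 0.
  by apply: poly_nat_eq0 (natr_inj chC) _ => m; rewrite ev h.
have dG P : deriv (G P) = G (mderiv v0 P).
  elim/mpoly_ring_ind: P => [c|v|p q hp hq|p q hp hq].
  - by rewrite mderivC /G ahom0 ahomC derivZ derivC scaler0.
  - rewrite mderivXU /G ahomX derivD derivC add0r derivZ derivX scaler_nat.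
    by case: eqP => _; rewrite ?ahom1 ?ahom0.
  - by rewrite mderivD /G !ahomD derivD hp hq.
  - by rewrite mderivM /G !ahomD !ahomM derivM hp hq.
have := ev 0 (mderiv v0 Q); rewrite -dG G0 deriv0 horner0 => ->.
by apply: meval_eq => v; rewrite mul0r addr0.
Qed.

Hypothesis N0 : (0 < N)%N.

Lemma orbit_solve K (k0 l0 : 'I_N) (n0 : nat) c : K = compan c -> (k0 < N.-1)%N ->
  exists Y, forall k l : 'I_N, (k < N.-1)%N ->
    (Y *m K) k l - (K *m Y) k l = ((k == k0) && (l == l0))%:R *: 'X^n0.
Proof.
move=> eK k0N.
pose W k : 'rV[{poly C}]_N := \row_l (((k == k0 :> nat) && (l == l0))%:R *: 'X^n0).
(* For [k < N - 1], row [k] of [K *m Y] is row [k + 1] of [Y], so the equation determines the rows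
   recursively from a zero first row. *)
have [y yS] : exists y : nat -> 'rV[{poly C}]_N, forall k, y k.+1 = y k *m K - W k.
  by exists (fix y k := if k is k'.+1 then y k' *m K - W k' else 0).
exists (\matrix_(k, l) y k 0 l) => k l kN.
have -> : (\matrix_(k, l) y k 0 l *m K) k l = (y k *m K) 0 l.
  by rewrite !mxE; apply: eq_bigr => j _; rewrite mxE.
have kN1 : (k.+1 < N)%N by lia.
have -> : (K *m \matrix_(k, l) y k 0 l) k l = y k.+1 0 l.
  rewrite mxE (bigD1 (Ordinal kN1)) //= [X in _ + X]big1 ?addr0.
    by rewrite eK !mxE (ltn_eqF kN) /= eqxx mul1r.
  move=> j hj; rewrite eK !mxE (ltn_eqF kN); case: eqP => e; last by rewrite mul0r.
  by case/eqP: hj; apply: val_inj.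
by rewrite yS !mxE opprB addrCA subrr addr0.
Qed.

(* The companion matrices over C[s] form a slice to the infinitesimal action *)
(* of gl_N[s]: at each of their points, the directions of the slice (last    *)
(* row) and of the orbit (commutators) span the whole tangent space.         *)
Lemma slice_eq0 (R : A) : (forall r i j, curr r i j R = 0) ->
  (forall c : 'I_N -> {poly C}, (forall j, (size (c j) <= L)%N) -> meval (pt (compan c)) R = 0) -> R = 0.
Proof.
move=> inv van.
(* By Taylor's formula it is enough that all derivatives of [R] vanish on the slice; the induction
   is on their order, at all points of the slice together. *)
suff H k s (c : 'I_N -> {poly C}) : (size s < k)%N -> (forall j, (size (c j) <= L)%N) ->
    meval (pt (compan c)) (dlist s R) = 0.
  by apply: (dlist_zero chC (a := pt (compan (fun=> 0)))) => s; apply: H (leqnn _) _ => j;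
     rewrite size_poly0.
elim: k s c => // k IH s c; rewrite ltnS leq_eqVlt => /orP[|/IH]; last by apply.
case/lastP: s => [_|s v /eqP]; first exact: van.
rewrite size_rcons => sk hc; subst k; rewrite /dlist foldl_rcons -/(dlist s R).
set a := pt (compan c); set Q := dlist s R.
(* Changing an entry of the last row stays inside the slice, where [Q] vanishes by induction. *)
have tang (v0 : 'I_nv) : ((enum_val v0).1.1 : nat) = N.-1 -> meval a (mderiv v0 Q) = 0.
  case e0: (enum_val v0) => [[i0 j0] n0] /= hi; apply: mderiv_line => t.
  pose c' j := c j + (t * (j == j0)%:R) *: 'X^n0.
  have hc' j : (size (c' j) <= L)%N.
    apply: leq_trans (size_polyD _ _) _; rewrite geq_max hc /=.
    by apply: leq_trans (size_scale_leq _ _) _; rewrite size_polyXn.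
  rewrite -[RHS](IH s c' (leqnn _) hc'); apply: meval_eq => w; rewrite /a /pt.
  have -> : (w == v0) = (enum_val w == (i0, j0, n0)) by rewrite -e0 (inj_eq enum_val_inj).
  case: (enum_val w) => [[i j] n]; rewrite !mxE.
  case: eqP => e; last first.
    have -> : ((i, j, n) == (i0, j0, n0)) = false.
      by apply/eqP => -[ei _ _]; apply: e; rewrite ei.
    by rewrite mulr0 addr0.
  have -> : ((i, j, n) == (i0, j0, n0)) = (j == j0) && (n == n0 :> nat).
    rewrite !xpair_eqE.
    have -> : i == i0 by apply/eqP/val_inj; rewrite /= e hi.
    by [].
  by rewrite coefD coefZ coefXn -mulrA -natrM mulnb.
(* Differentiating [curr r i j R = 0] along [s] leaves only the terms of top order, since all
   derivatives of lower order vanish at the point. *)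
have orb Y : \sum_(w : 'I_nv) (let: (k, l, n) := enum_val w in
      ((Y *m compan c) k l - (compan c *m Y) k l)`_n) * meval a (mderiv w Q) = 0.
  under eq_bigr => w _ do rewrite -curr_pt mulr_suml.
  rewrite exchange_big big1 //= => r _.
  under eq_bigr => w _ do rewrite mulr_suml.
  rewrite exchange_big big1 //= => i _.
  under eq_bigr => w _ do rewrite mulr_suml.
  rewrite exchange_big big1 //= => j _.
  under eq_bigr => w _ do rewrite -mulrA.
  rewrite -mulr_sumr; apply/eqP; rewrite mulf_eq0; apply/orP; right; apply/eqP.
  have := congr1 (fun P => meval a (dlist s P)) (inv r i j).
  rewrite /= dlist0 meval0 /curr /= /derv dlist_sum raddf_sum /= => h0.
  rewrite -[RHS]h0; apply: eq_bigr => w _; rewrite dlist_mul_lead ?dlist_mderiv // => t ht.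
  by rewrite -[dlist t _]/(dlist (w :: t) R); apply: IH.
case: (ltnP (enum_val v).1.1 N.-1) => hv; last first.
  by apply: tang; apply/eqP; rewrite eqn_leq hv andbT -ltnS prednK.
case e0: (enum_val v) hv => [[k0 l0] n0] /= hv.
(* The commutator with this [Y] is the direction [v] plus directions in the last row, which [tang]
   has already settled. *)
have [Y hY] := orbit_solve l0 n0 (erefl (compan c)) hv.
rewrite -[RHS](orb Y) (bigD1 v) //= e0 hY // !eqxx scale1r coefXn eqxx mul1r big1 ?addr0 //.
move=> w; rewrite -(inj_eq enum_val_inj) e0.
case ew: (enum_val w) => [[k l] n] hw.
case: (ltnP k N.-1) => hk; last first.
  by rewrite tang ?mulr0 // ew /=; apply/eqP; rewrite eqn_leq hk andbT -ltnS prednK.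
rewrite hY // coefZ coefXn -natrM mulnb.
have h0 : ((k == k0) && (l == l0)) && (n == n0 :> nat) = false.
  by apply/negP => /andP[/andP[/eqP e1 /eqP e2] /eqP/val_inj e3]; move: hw; rewrite e1 e2 e3 eqxx.
by rewrite h0 mul0r.
Qed.
End Slice.

(** * Invariants of gl_N[s] *)

(** In characteristic 0 Newton's identities express [sy_] through traces of powers, which
    homomorphisms respect. *)
Lemma sy_ahom (C : fieldType) (n N : nat) (B : comAlgType C) (h : 'I_n -> B) (eps : C)
    (Y : 'M[{mpoly C[n]}]_N) k : [pchar C] =i pred0 -> eps * eps = 1 ->
  ahom h (sy_ eps Y k) = sy_ eps (map_mx (ahom h) Y) k.
Proof.
move=> chC eps2; have [m] := ubnP k; elim: m k => // m IH [|k] km.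
  by rewrite !sy0 ahom1.
have k0 : k.+1%:R != 0 :> C by move/pcharf0P: chC => ->.
apply: (scalerI k0); rewrite -ahomZ !newton // ahom_sum; apply: eq_bigr => j _.
rewrite ahomZ ahomM IH; last by move: (ltn_ord j); lia.
congr (_ *: (_ * _)); rewrite /mxtrace ahom_sum; apply: eq_bigr => i _.
suff -> : iter j (mulmx (map_mx (ahom h) Y)) (map_mx (ahom h) Y) =
    map_mx (ahom h) (iter j (mulmx Y) Y) by rewrite mxE.
elim: (j : nat) => //= a ->; apply/matrixP => p q; rewrite !mxE ahom_sum.
by apply: eq_bigr => r _; rewrite ahomM !mxE.
Qed.

Lemma char_poly_compan (R : comNzRingType) (p : {poly R}) n (K : 'M[R]_n) :
  p \is monic -> size p = n.+1 ->
  (forall i j : 'I_n, K i j = if i == n.-1 :> nat then - p`_j else (i.+1 == j :> nat)%:R) ->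
  char_poly K = p.
Proof.
move=> mp sp; have e : (size p).-1 = n by rewrite sp.
subst n => hK; rewrite -[RHS](companionmxK mp); congr char_poly.
by apply/matrixP => i j; rewrite hK mxE.
Qed.

Section Elementary.
Variables (C : fieldType) (N L : nat).
Hypotheses (chC : [pchar C] =i pred0) (N0 : (0 < N)%N).
Local Notation XL := ('I_N * 'I_N * 'I_L)%type.
Local Notation nv := #|{: XL}|.
Local Notation A := {mpoly C[nv]}.
Local Notation xi := (@xi C N L).
Local Notation shiftd := (@shiftd C N L).
Implicit Types (K : 'M[{poly C}]_N).
Local Notation curr := (@curr C N L).

Definition Xmx : 'M[A]_N := \matrix_(i, j) xi (i, j, 0%N).
Definition elem k n : A := (n`!%:R)^-1 *: iter n shiftd (sy_ (-1) Xmx k).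

(** A polynomial function evaluated along the translates of [K] in [s]: coordinates become Hasse
    derivatives of the entries. Thus [shiftd] turns into d/ds, and the value at 0 is evaluation at
    [K]. *)
Definition Ehom (K : 'M[{poly C}]_N) : A -> {poly C} :=
  ahom (fun v : 'I_nv => let: (k, l, n) := enum_val v in nderivn n (K k l)).

Lemma Ehom_xi K k l n : (forall i j, (size (K i j) <= L)%N) -> Ehom K (xi (k, l, n)) = nderivn n (K k l).
Proof.
move=> hK; case: (ltnP n L) => nL; first by rewrite xi_lt /Ehom ahomX enum_rankK.
by rewrite xi_big // /Ehom ahom0 nderivn_poly0 // (leq_trans (hK k l)).
Qed.

Lemma nderivnS (q : {poly C}) n : deriv (nderivn n q) = n.+1%:R *: nderivn n.+1 q.
Proof.
apply/polyP => i; rewrite coef_deriv coefZ !coef_nderivn -mulrnA mulr_natl -mulrnA addSnnS.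
by congr (_ *+ _); have := mul_bin_left (n + i.+1) n; rewrite addKn; lia.
Qed.

Lemma Ehom_shiftd K p : (forall i j, (size (K i j) <= L)%N) -> Ehom K (shiftd p) = deriv (Ehom K p).
Proof.
move=> hK; apply: ahom_derv.
- by move=> c x y; rewrite derivD derivZ.
- by move=> x y; rewrite derivM.
move=> v; rewrite /shift_coef; case: (enum_val v) => [[k l] n].
by rewrite ahomZ -/(Ehom K _) Ehom_xi // nderivnS.
Qed.

Lemma Ehom_pt K p : (Ehom K p).[0] = meval (pt K) p.
Proof.
rewrite /Ehom; elim/mpoly_ring_ind: p => [c|v|p q hp hq|p q hp hq].
- by rewrite ahomC hornerZ hornerC mulr1 mevalC.
- rewrite ahomX mevalXU /pt; case: (enum_val v) => [[k l] n].
  by rewrite horner_coef0 coef_nderivn addn0 binn.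
- by rewrite ahomD hornerD hp hq mevalD.
- by rewrite ahomM hornerM hp hq mevalM.
Qed.

Lemma meval_elem K k n : (0 < L)%N -> (forall i j, (size (K i j) <= L)%N) ->
  meval (pt K) (elem k n) = (sy_ (-1) K k)`_n.
Proof.
move=> L0 hK; rewrite /elem mevalZ -Ehom_pt.
have -> : Ehom K (iter n shiftd (sy_ (-1) Xmx k)) = derivn n (sy_ (-1) K k).
  rewrite /derivn; elim: n => [|n IH] /=; last by rewrite Ehom_shiftd // IH.
  rewrite /Ehom sy_ahom ?mulrNN ?mulr1 //; congr (sy_ _ _ _).
  by apply/matrixP => i j; rewrite !mxE -/(Ehom K _) Ehom_xi // nderivn0.
rewrite horner_coef0 coef_derivn addn0 ffactnn -(mulr_natl _`_n) mulrA mulVf ?mul1r //.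
by move/pcharf0P: chC => ->; rewrite -lt0n fact_gt0.
Qed.

Lemma char_poly_sy K : char_poly K =
  \poly_(j < N.+1) ((-1) ^+ (N - j) *: sy_ (-1 : C) K (N - j)%N).
Proof.
apply/eqP; rewrite -subr_eq0; apply/eqP; apply: poly_nat_eq0 => [a b|m].
  by rewrite /= -!polyC_natr => /polyC_inj/(natr_inj chC).
rewrite hornerD hornerN; apply/eqP; rewrite subr_eq0; apply/eqP.
transitivity (\det (lincomb (m%:R : C) (-1) K)).
  rewrite /char_poly -[LHS]/(horner_eval m%:R (\det _)) -det_map_mx; congr (\det _).
  apply/matrixP => i j; rewrite !mxE /= /horner_eval hornerD hornerN hornerMn hornerX hornerC.
  rewrite scaleN1r; congr (_ - _); case: (i == j); rewrite ?mul0r ?scale0r //.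
  by rewrite mul1r scaler_nat.
rewrite det_lincomb // horner_poly (reindex_inj rev_ord_inj) /=; apply: eq_bigr => j _.
have jN : (j <= N)%N by rewrite -ltnS.
rewrite subSS subKn // mulrC -scalerA -scalerAl; congr (_ *: _).
by rewrite -!natrX scaler_nat mulr_natr.
Qed.

Lemma sy_compan (c : 'I_N -> {poly C}) (l : 'I_N) :
  c l = - (-1) ^+ (N - l) *: sy_ (-1 : C) (compan c) (N - l).
Proof.
have factC n : (n`!)%:R != 0 :> C by move/pcharf0P: chC => ->; rewrite -lt0n fact_gt0.
set K := compan c; pose s k := sy_ (-1 : C) K k.
pose r : {poly {poly C}} := \poly_(j < N) (if insub j is Some j' then c j' else 0).
pose p : {poly {poly C}} := 'X^N - r.
have sp : (size r <= N)%N by apply: size_poly.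
have szp : size p = N.+1.
  by rewrite /p size_polyDl ?size_polyXn // size_polyN ltnS.
have mp : p \is monic.
  by rewrite monicE /p lead_coefDl ?lead_coefXn // size_polyXn size_polyN ltnS.
have cp : char_poly K = p.
  apply: (char_poly_compan mp szp) => i j; rewrite mxE; case: ifP => // _.
  by rewrite /p /r coefB coefXn coef_poly (ltn_eqF (ltn_ord j)) ltn_ord sub0r valK opprK.
have := congr1 (fun r : {poly {poly C}} => r`_l) (etrans (esym cp) (char_poly_sy K)).
rewrite /p /r coefB coefXn !coef_poly (ltn_eqF (ltn_ord l)) (leqW (ltn_ord l) : (l < N.+1)%N) ltn_ord sub0r valK => h.
by rewrite scaleNr -/K -/(s _) -h opprK.
Qed.

Hypothesis L0 : (0 < L)%N.
Hypothesis curr_elem : forall r i j k n, (0 < k <= N)%N -> (n < L)%N -> curr r i j (elem k n) = 0.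

(* Substitution of the companion matrix with the same characteristic          *)
(* polynomial.                                                                *)
Definition to_elem : A -> A := ahom (fun v : 'I_nv => let: (k, l, n) := enum_val v in
  if k == N.-1 :> nat then - (-1) ^+ (N - l) *: elem (N - l)%N n
  else (if n == 0%N :> nat then (k.+1 == l :> nat)%:R else 0)%:A).

Lemma to_elem_ind (Q : A -> Prop) : (forall c, Q c%:MP) ->
  (forall k n, (0 < k <= N)%N -> (n < L)%N -> Q (elem k n)) ->
  (forall p q, Q p -> Q q -> Q (p + q)) -> (forall p q, Q p -> Q q -> Q (p * q)) ->
  forall p, Q (to_elem p).
Proof.
move=> hC hE hD hM p; rewrite /to_elem; elim/mpoly_ring_ind: p => [c|v|p q hp hq|p q hp hq].
- by rewrite ahomC -mul_mpolyC mulr1; apply: hC.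
- rewrite ahomX; case: (enum_val v) => [[k l] n]; case: ifP => _.
    rewrite -mul_mpolyC; apply: (hM); first exact: hC.
    by apply: hE => //; move: (ltn_ord l); lia.
  by rewrite -mul_mpolyC mulr1; apply: hC.
- by rewrite ahomD; apply: (hD).
- by rewrite ahomM; apply: (hM).
Qed.

Lemma curr_to_elem r i j p : curr r i j (to_elem p) = 0.
Proof.
move: p; apply: (to_elem_ind (Q := fun p => curr r i j p = 0)) => [c|k n|p q hp hq|p q hp hq]; first exact: dervC.
- exact: curr_elem.
- by rewrite linearD hp hq addr0.
- by rewrite [LHS]dervM -!/(derv _ _) (hp : derv _ _ = 0) (hq : derv _ _ = 0) mulr0 mul0r addr0.
Qed.

Lemma pt_to_elem (c : 'I_N -> {poly C}) p : (forall j, (size (c j) <= L)%N) ->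
  meval (pt (compan c)) (to_elem p) = meval (pt (compan c)) p.
Proof.
move=> hc; have hK i j : (size (compan c i j) <= L)%N.
  rewrite mxE; case: ifP => // _; rewrite -polyC_natr.
  by apply: leq_trans (size_polyC_leq1 _) _.
rewrite /to_elem; elim/mpoly_ring_ind: p => [a|v|p q hp hq|p q hp hq].
- by rewrite ahomC mevalC mevalZ meval1 mulr1.
- rewrite ahomX mevalXU /pt; case: (enum_val v) => [[k l] n]; rewrite mxE.
  case: ifP => _; first by rewrite mevalZ meval_elem // (sy_compan c l) [RHS]coefZ.
  rewrite mevalZ meval1 mulr1 -polyC_natr coefC.
  by case: (n == 0%N :> nat).
- by rewrite ahomD !mevalD hp hq.
- by rewrite ahomM !mevalM hp hq.
Qed.

(** Both sides are invariant and agree on companion matrices, whose last row consists of signed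
    values of the [elem]. *)
Lemma invariant_to_elem p : (forall r i j, curr r i j p = 0) -> p = to_elem p.
Proof.
move=> inv; apply/eqP; rewrite -subr_eq0; apply/eqP; apply: (slice_eq0 chC N0) => [r i j|c hc].
  by rewrite linearB inv curr_to_elem subrr.
by rewrite mevalB pt_to_elem // subrr.
Qed.
End Elementary.

(** * Generators of the centre *)

Section FockRelation.
Variables (C : fieldType) (N : nat) (eps : C) (V W : lmodType C).

(** A relation stable under linear combinations passes through all Fock operators and the
    contraction. This transports computations from words to symbols, to coefficients in zeta, and
    through symmetrisation. *)
Definition stable_rel (H : V -> W -> Prop) := H 0 0 /\
  (forall c u v p q, H u p -> H v q -> H (c *: u + v) (c *: p + q)).
Definition fock_rel (H : V -> W -> Prop) f g := forall s t : seq 'I_N, H (f s t) (g s t).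

Variable H : V -> W -> Prop.
Hypothesis sH : stable_rel H.

Lemma rel_sum (J : Type) (r : seq J) F G : (forall j, H (F j) (G j)) ->
  H (\sum_(j <- r) F j) (\sum_(j <- r) G j).
Proof.
move=> h; elim: r => [|j r IH]; first by rewrite !big_nil; case: sH.
by rewrite !big_cons -[F j]scale1r -[G j]scale1r; apply: (proj2 sH).
Qed.

Lemma rel_cr i (f : seq 'I_N -> V) g : (forall s, H (f s) (g s)) ->
  forall s, H (cr eps i f s) (cr eps i g s).
Proof.
move=> h s; elim: s f g h => [|x s IH] f g h; first by case: sH.
rewrite -[cr eps i f _]/((x == i)%:R *: f s + eps *: cr eps i (fun t => f (x :: t)) s).
rewrite -[cr eps i g _]/((x == i)%:R *: g s + eps *: cr eps i (fun t => g (x :: t)) s).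
apply: (proj2 sH) => //; rewrite -[eps *: cr _ _ _ s]addr0 -[X in H _ X]addr0.
by apply: (proj2 sH); [apply: IH => t; apply: h | case: sH].
Qed.

Lemma fock_rel_ca i f g : fock_rel H f g -> fock_rel H (ca eps i f) (ca eps i g).
Proof.
move=> h s t; have cre (U : lmodType C) (k : seq 'I_N -> seq 'I_N -> U) :
    cr eps i k s t = cr eps i (fun s => k s t) s.
  elim: s k => // x s IH k.
  by rewrite -[LHS]/((x == i)%:R *: k s t + eps *: cr eps i (fun t => k (x :: t)) s t) IH.
by rewrite /ca !cre; apply: rel_cr.
Qed.
Lemma fock_rel_cb i f g : fock_rel H f g -> fock_rel H (cb eps i f) (cb eps i g).
Proof. by move=> h s t; apply: rel_cr. Qed.
Lemma fock_rel_sum (J : Type) (r : seq J) (F : J -> _) G : (forall j, fock_rel H (F j) (G j)) ->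
  fock_rel H (\sum_(j <- r) F j) (\sum_(j <- r) G j).
Proof. by move=> h s t; rewrite !sumfE; apply: rel_sum => j; apply: h. Qed.
Lemma rel_pr n f g : fock_rel H f g -> H (pr n f) (pr n g).
Proof.
elim: n f g => [|n IH] f g h; first exact: h.
by rewrite !prS; apply: rel_sum => x; apply: IH => s t; apply: h.
Qed.
End FockRelation.

Section MonomialWords.
Variable n : nat.
Implicit Types (s t : seq 'I_n) (m : 'X_{1..n}).
Definition mnw s : 'X_{1..n} := (\sum_(v <- s) U_(v))%MM.
Definition cword m : seq 'I_n := flatten [seq nseq (m k) k | k <- enum 'I_n].

Lemma mnwE s v : mnw s v = count_mem v s.
Proof.
rewrite /mnw; elim: s => [|w s IH]; first by rewrite big_nil mnm0E.
by rewrite big_cons mnmDE mnm1E IH.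
Qed.

Lemma perm_cword s : perm_eq s (cword (mnw s)).
Proof.
apply/allP => v _ /=; apply/eqP; rewrite /cword count_flatten -map_comp.
have -> : [seq (count_mem v \o (fun k => nseq (mnw s k) k)) k | k <- enum 'I_n] =
    [seq (if k == v then mnw s v else 0)%N | k <- enum 'I_n].
  by apply: eq_map => k /=; rewrite count_nseq /=; case: eqP => [->|_]; rewrite ?mul1n ?mul0n.
rewrite -mnwE sumnE big_map big_enum /= -big_mkcond /=.
by rewrite (big_pred1 v).
Qed.

Lemma prod_mnw (C : fieldType) s : \prod_(v <- s) 'X_v = 'X_[mnw s] :> {mpoly C[n]}.
Proof.
rewrite /mnw; elim: s => [|v s IH]; first by rewrite !big_nil mpolyX0.
by rewrite !big_cons mpolyXD IH.
Qed.
End MonomialWords.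

Section ZeroSymbol.
Variables (C : fieldType) (N : nat).
Local Notation V := (Uq (@floop_rel C N)).
Local Notation word := (word (@floop_rel C N)).
Local Notation fil := (@fil C N).

Lemma fil_swap x y w : fil (size w).+1 (word (y :: x :: w) - word (x :: y :: w)).
Proof.
case: x y => [[i j] a] [[k l] b]; rewrite !word_cons -!ell_delta !mulrA -mulrBl.
rewrite ell_comm [X in X - _]addrC addrK -add1n.
by apply: filM (fil_ell _ _) (fil_word _ _).
Qed.

Lemma fil_move x u v : fil (size (u ++ v)) (word (u ++ x :: v) - word (x :: u ++ v)).
Proof.
elim: u => [|y u IH]; first by rewrite subrr; apply: fil0.
have -> : word ((y :: u) ++ x :: v) - word (x :: (y :: u) ++ v) =
    let_ (@floop_rel C N) y * (word (u ++ x :: v) - word (x :: u ++ v)) +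
    (word (y :: x :: u ++ v) - word (x :: y :: u ++ v)).
  by rewrite mulrBr -!word_cons addrA subrK.
apply: filD; last exact: fil_swap.
rewrite -[size _]/(1 + size (u ++ v))%N; apply: filM IH.
by have := fil_word C [:: y]; rewrite word_cons word_nil mulr1.
Qed.

Lemma fil_perm w w' : perm_eq w w' -> fil (size w).-1 (word w - word w').
Proof.
elim: w w' => [|x w IH] w' pw.
  by move: pw; rewrite perm_sym => /perm_nilP ->; rewrite subrr; apply: fil0.
have /splitPr e : x \in w' by rewrite -(perm_mem pw) mem_head.
case: e pw => u v; rewrite perm_sym perm_catC cat_cons perm_cons perm_catC perm_sym => pw.
rewrite -(subrK (word (x :: u ++ v)) (word (x :: w))) -addrA; apply: filD.
  rewrite !word_cons -mulrBr; have := IH _ pw.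
  case: (w) pw => [|y w0] pw.
    by move=> _; move: pw; rewrite perm_sym => /perm_nilP ->; rewrite subrr mulr0; apply: fil0.
  rewrite /= => h; rewrite -add1n; apply: filM h.
  by have := fil_word C [:: x]; rewrite word_cons word_nil mulr1.
rewrite /= (perm_size pw) -opprB -scaleN1r; apply/filZ/fil_move.
Qed.

Variable L : nat.
Local Notation XL := ('I_N * 'I_N * 'I_L)%type.
Local Notation nv := #|{: XL}|.
Local Notation A := {mpoly C[nv]}.
Local Notation xi := (@xi C N L).

Definition letter (v : 'I_nv) : LP N := let: (k, l, n) := enum_val v in (k, l, n : nat).
Lemma xi_letter v : xi (letter v) = 'X_v.
Proof. by move: (@xi_ord C N L v); rewrite /letter; case: (enum_val v) => [[k l] n]. Qed.

Lemma word_letters w : all (fun x : LP N => (x.2 < L)%N) w -> exists s, w = map letter s.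
Proof.
elim: w => [|[[k l] n] w IH]; first by exists [::].
rewrite /= => /andP[nL /IH[s ->]]; exists (enum_rank (k, l, Ordinal nL) :: s).
by rewrite /= /letter enum_rankK.
Qed.

Definition lo d (u : V) := exists p : fa C (LP N),
  upi (@floop_rel C N) p = u /\ all (fun cw => (size cw.2 < d)%N) p.
Lemma loD d u v : lo d u -> lo d v -> lo d (u + v).
Proof.
move=> [p [<- a]] [q [<- b]]; exists (p ++ q); split; first by rewrite upi_cat.
by rewrite all_cat a.
Qed.
Lemma loZ d c u : lo d u -> lo d (c *: u).
Proof.
move=> [p [<- a]]; exists (fa_scale c p); split; first by rewrite upi_scale.
by rewrite /fa_scale all_map.
Qed.
Lemma lo0 d : lo d 0. Proof. by exists [::]. Qed.

(* The spanning half of the Poincare-Birkhoff-Witt theorem: modulo lower      *)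
(* degree a word depends only on its monomial.                                *)
Lemma hs_zero d u : hs xi L d u 0 -> lo d u.
Proof.
move=> [p [<- a sp]]; pose h m := word (map letter (cword m)).
rewrite -[upi _ p]subr0 -(linear0 (mlift h)) -sp upi_lin /sy lin_raddf /lin -sumrB.
elim: p a {sp} => [|[c w] p IH] /=; first by rewrite big_nil => _; apply: lo0.
move=> /andP[aw ap]; rewrite big_cons; apply: loD; last exact: IH.
rewrite -scalerBr; apply: loZ; move: aw => /andP[/= sw /implyP aw].
case: eqP aw => [e /(_ isT)/word_letters[s es]|ne _]; last first.
  rewrite linear0 subr0; exists [:: (1, w)]; split; first by rewrite upi_word scale1r.
  by rewrite /= andbT ltn_neqAle sw andbT; apply/eqP.
have -> : \prod_(x <- w) xi x = 'X_[mnw s].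
  by rewrite es big_map -prod_mnw; apply: eq_bigr => v _; rewrite xi_letter.
rewrite [mlift h _]mliftX /h es; have pe : perm_eq w (map letter (cword (mnw s))).
  by rewrite es; apply: perm_map; apply: perm_cword.
have := fil_perm pe; rewrite -es e; case: (d) e => [|d' _ //] /size0nil ew.
by move: pe; rewrite ew perm_sym => /perm_nilP ->; rewrite subrr => _; apply: lo0.
Qed.
End ZeroSymbol.

Section Generation.
Variables (C : fieldType) (N : nat).
Hypotheses (chC : [pchar C] =i pred0) (N0 : (0 < N)%N).
Local Notation V := (Uq (@floop_rel C N)).
Local Notation der := (@der C N).

Inductive Gen (eps : C) : V -> Prop :=
| Gen1 : Gen eps 1
| GenD u v : Gen eps u -> Gen eps v -> Gen eps (u + v)
| GenZ c u : Gen eps u -> Gen eps (c *: u)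
| GenM u v : Gen eps u -> Gen eps v -> Gen eps (u * v)
| Gen_ssv k n : (0 < k <= N)%N -> Gen eps (iter n der (ssv N eps k)).

Lemma Gen_FF eps u : (eps == 1) || (eps == -1) -> Gen eps u -> FFu u.
Proof.
move=> eps1; elim=> [|a b _ ha _ hb|c a _ ha|a b _ ha _ hb|k n _].
- exact: FF1.
- exact: FFD.
- exact: FFZ.
- exact: FFM.
by elim: n => [|n IH] /=; [apply: FF_ssv | apply: FF_der].
Qed.

Section FixL.
Variable L : nat.
Hypothesis L0 : (0 < L)%N.
Local Notation XL := ('I_N * 'I_N * 'I_L)%type.
Local Notation nv := #|{: XL}|.
Local Notation A := {mpoly C[nv]}.
Local Notation xi := (@xi C N L).
Local Notation shiftd := (@shiftd C N L).
Local Notation curr := (@curr C N L).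
Local Notation Xmx := (Xmx C N L).

Lemma hs_stable B d : stable_rel (hs xi B d).
Proof.
split; first exact: hs0.
by move=> c u v p q hu hv; apply: hsD hv; apply: hsZ.
Qed.

(** The translation does not raise the degree, so only [E[-1]] contributes to the symbol of [T +
    E[-1]]. *)
Lemma hs_tau eps B m : (0 < B)%N -> hs xi B m (ssv N eps m) (tau eps Xmx m).
Proof.
move=> B0; apply: (rel_pr (H := hs xi B m)); first exact: hs_stable.
elim: m => [|m IH].
  move=> s t; rewrite /FF /= /vac; case: ifP => _; first exact: hs1.
  by case: (hs_stable B 0).
rewrite /FF !iterS -!/(FF _ _ _ _) !LL_sum.
apply: (fock_rel_sum (hs_stable _ _)) => i; apply: (fock_rel_sum (hs_stable _ _)) => j.
apply: (fock_rel_ca eps (hs_stable _ _)); apply: (fock_rel_cb eps (hs_stable _ _)) => s t.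
rewrite /lf /= /Lop /mulL -[X in hs _ _ _ _ X]add0r; apply: hsD.
  by apply: hsZ0; apply: hs_lower (fil_der (hs_fil (IH s t))).
rewrite -add1n; apply: hsM; last exact: (IH s t).
by rewrite mxE; apply: hs_letter.
Qed.

Lemma shiftdM p q : shiftd (p * q) = shiftd p * q + p * shiftd q.
Proof. exact: dervM. Qed.
Lemma currM r i j p q : curr r i j (p * q) = curr r i j p * q + p * curr r i j q.
Proof. exact: dervM. Qed.

Lemma hs_iter_der eps k n : (n < L)%N ->
  hs xi L k (iter n der (ssv N eps k)) (iter n shiftd (tau eps Xmx k)).
Proof.
move=> nL; apply: (hs_mono nL); elim: n {nL} => [|n IH]; first exact: hs_tau.
by apply: (hs_der shiftdM (@shiftd_xi C N L)); apply: IH.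
Qed.

Lemma hs_inv d u P r i j : FFu u -> hs xi L d u P -> curr r i j P = 0.
Proof.
move=> fu hu; have := hs_op currM (@curr_xi C N L) r i j hu.
by rewrite fu => h; apply: (hs_uniq (B' := L) chC h); apply: hs0.
Qed.

(* Lifts of homogeneous polynomials to [Gen]; [GG] collects the sums of such  *)
(* polynomials, so as to be closed under products.                            *)
Definition lifts eps d P := exists u, Gen eps u /\ hs xi L d u P.
Inductive GG eps : A -> Prop :=
| GGl d P : lifts eps d P -> GG eps P
| GGD P Q : GG eps P -> GG eps Q -> GG eps (P + Q).

Lemma liftsM eps d e P Q : lifts eps d P -> lifts eps e Q -> lifts eps (d + e) (P * Q).
Proof. by move=> [u [gu hu]] [v [gv hv]]; exists (u * v); split; [apply: GenM | apply: hsM]. Qed.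
Lemma GGM eps P Q : GG eps P -> GG eps Q -> GG eps (P * Q).
Proof.
move=> hP hQ; elim: hP => [d P1 l1|P1 P2 _ h1 _ h2]; last by rewrite mulrDl; apply: GGD.
elim: hQ => [e Q1 l2|Q1 Q2 _ h1 _ h2]; last by rewrite mulrDr; apply: GGD.
exact: GGl (liftsM l1 l2).
Qed.
Lemma GGC eps c : GG eps c%:MP.
Proof.
apply: (@GGl eps 0); exists (c *: (1 : V)); split; first exact/GenZ/Gen1.
by rewrite -[c%:MP]mulr1 mul_mpolyC; apply/hsZ/hs1.
Qed.
Lemma GGZ eps c P : GG eps P -> GG eps (c *: P).
Proof. by move=> h; rewrite -mul_mpolyC; apply: GGM (GGC _ _) h. Qed.
Definition TT eps P := forall n, (n < L)%N -> GG eps (iter n shiftd P).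

Lemma TTM eps P Q : TT eps P -> TT eps Q -> TT eps (P * Q).
Proof.
move=> hP hQ n nL.
suff H m a b : (m + a < L)%N -> (m + b < L)%N ->
  GG eps (iter m shiftd (iter a shiftd P * iter b shiftd Q)) by apply: (H n 0 0)%N; rewrite addn0.
elim: m a b => [|m IH] a b ha hb; first by apply: GGM; [apply: hP | apply: hQ].
rewrite iterSr shiftdM -!iterS.
have -> (p q : A) : iter m shiftd (p + q) = iter m shiftd p + iter m shiftd q.
  by elim: (m) => //= k ->; rewrite linearD.
by apply: GGD; apply: IH; lia.
Qed.
Lemma TTD eps P Q : TT eps P -> TT eps Q -> TT eps (P + Q).
Proof.
move=> hP hQ n nL; have -> : iter n shiftd (P + Q) = iter n shiftd P + iter n shiftd Q.
  by elim: (n) => //= k ->; rewrite linearD.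
by apply: GGD; [apply: hP | apply: hQ].
Qed.
Lemma TTZ eps c P : TT eps P -> TT eps (c *: P).
Proof.
move=> hP n nL; have -> : iter n shiftd (c *: P) = c *: iter n shiftd P.
  by elim: (n) => //= k ->; rewrite linearZ.
exact/GGZ/hP.
Qed.

Lemma TT_sy eps k : (0 < k <= N)%N -> TT eps (sy_ eps Xmx k).
Proof.
move=> kN; apply: TTZ => n nL; apply: (@GGl eps k).
by exists (iter n der (ssv N eps k)); split; [apply: Gen_ssv | apply: hs_iter_der].
Qed.

(** By [elem_complete], the elementary functions are polynomials in the complete ones. *)
Lemma TT_elem k : (0 < k <= N)%N -> TT 1 (sy_ (-1) Xmx k).
Proof.
have [m] := ubnP k; elim: m k => // m IH [|k] // km kN.
have := elem_complete chC Xmx k; rewrite big_ord_recr /= subnn sy0 mulr1 => /eqP.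
rewrite addrC addr_eq0 => /eqP e.
have -> : sy_ (-1 : C) Xmx k.+1 = (-1) ^+ k.+1 *: ((-1) ^+ k.+1 *: sy_ (-1 : C) Xmx k.+1).
  by rewrite scalerA -exprD addnn -signr_odd odd_double scale1r.
rewrite e; apply/TTZ; rewrite -scaleN1r; apply: TTZ.
elim/big_ind: _ => [||[j jk] _ /=]; last first.
  apply: TTZ; case: j jk => [|j] jk.
    by rewrite sy0 mul1r subn0; apply: TT_sy.
  by apply: TTM; [apply: IH; lia | apply: TT_sy; lia].
- exact: TTD.
rewrite -(scale0r (sy_ 1 Xmx 1)); apply/TTZ/TT_sy; lia.
Qed.

Lemma GG_elem eps k n : (eps == 1) || (eps == -1) -> (0 < k <= N)%N -> (n < L)%N ->
  GG eps (elem C N L k n).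
Proof.
move=> eps1 kN nL; apply: GGZ; case/orP: eps1 => /eqP ->; first exact: TT_elem.
exact: TT_sy.
Qed.

(** Invariance is inherited from the centrality of the fermionic [ssv], of whose translates these
    are the symbols up to scalars. *)
Lemma curr_elem r i j k n : (0 < k <= N)%N -> (n < L)%N -> curr r i j (elem C N L k n) = 0.
Proof.
move=> kN nL; rewrite /elem linearZ /=.
have e : iter n shiftd (sy_ (-1 : C) Xmx k) =
    ((k`!%:R)^-1 ^+ 2) *: iter n shiftd (tau (-1 : C) Xmx k).
  by elim: (n) => //= m ->; rewrite linearZ.
rewrite e linearZ /= (hs_inv r i j _ (hs_iter_der (-1) k nL)) ?scaler0 //.
by elim: (n) => [|m IH] /=; [apply: FF_ssv; rewrite ?eqxx ?orbT | apply: FF_der].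
Qed.

Lemma hs_homog B d u P : hs xi B d u P -> P \is d.-homog.
Proof.
move=> [p [_ _ <-]]; rewrite /sy /lin; apply: rpred_sum => cw _; apply: rpredZ.
case: eqP => [<-|_]; last exact: rpred0.
elim: (cw.2) => [|[[k l] n] w IH]; first by rewrite big_nil dhomog1.
rewrite big_cons /= -add1n; apply: dhomogM => //.
case: (ltnP n L) => nL; last by rewrite xi_big // rpred0.
by rewrite xi_lt // dhomogX /= mdeg1.
Qed.

(** Sums in [GG] may mix degrees, but symbols are homogeneous, so each component lifts by itself. *)
Lemma lifts_homog eps P d : GG eps P -> lifts eps d (pihomog mdeg d P).
Proof.
elim=> [e Q [u [gu hu]]|Q1 Q2 _ [u [gu hu]] _ [v [gv hv]]]; last first.
  by exists (u + v); split; [apply: GenD | rewrite linearD; apply: hsD].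
have [<-|ne] := eqVneq e d.
  by exists u; split=> //; rewrite pihomog_dE // (hs_homog hu).
exists (0 *: (1 : V)); split; first exact/GenZ/Gen1.
by rewrite (pihomog_ne0 _ (hs_homog hu)) // scale0r; apply: hs0.
Qed.

Lemma FF_lifts eps d u P : (eps == 1) || (eps == -1) -> FFu u -> hs xi L d u P -> lifts eps d P.
Proof.
move=> eps1 fu hu; rewrite -[P](pihomog_dE (hs_homog hu)); apply: lifts_homog.
rewrite (invariant_to_elem chC N0 L0 curr_elem (fun r i j => hs_inv r i j fu hu)).
apply: (@to_elem_ind C N L N0 L0 (GG eps)) => [c|k n kN nL|p q|p q].
- exact: GGC.
- exact: GG_elem.
- exact: GGD.
- exact: GGM.
Qed.
End FixL.

Lemma FF_Gen eps u : (eps == 1) || (eps == -1) -> FFu u -> Gen eps u.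
Proof.
move=> eps1; elim/uqW: u => p fp.
suff H d (q : fa C (LP N)) : all (fun cw => (size cw.2 < d)%N) q ->
    FFu (upi (@floop_rel C N) q) -> Gen eps (upi (@floop_rel C N) q).
  apply: (H (\max_(cw <- p) (size cw.2)).+1) => //; apply/allP => cw hcw.
  by rewrite ltnS; apply: leq_bigmax_seq.
elim: d q {p fp} => [|d IH] p ap fp.
  case: p ap fp => [|//] _ _; rewrite upi_nil -(scale0r (1 : V)); exact/GenZ/Gen1.
(* The truncation exceeds every mode occurring in [p], and is positive. *)
pose L := (\max_(cw <- p) \max_(x <- cw.2) x.2).+1.
have hp : hs (@xi C N L) L d (upi (@floop_rel C N) p) (sy (@xi C N L) d p).
  exists p; split=> //; apply/allP => cw hcw; move/allP: ap => /(_ _ hcw) /= s.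
  rewrite /okw -ltnS s /=; apply/implyP => _; apply/allP => x hx; rewrite ltnS.
  apply: (leq_trans (n := \max_(y <- cw.2) y.2)).
    by apply: (@leq_bigmax_seq _ _ xpredT (fun y : LP N => y.2)).
  by apply: (@leq_bigmax_seq _ _ xpredT (fun cw : C * seq (LP N) => \max_(y <- cw.2) y.2)).
have [u [gu hu]] := FF_lifts (ltn0Sn _) eps1 fp hp.
have h0 : hs (@xi C N L) L d (upi (@floop_rel C N) p - u) 0.
  by rewrite -(subrr (sy (@xi C N L) d p)); apply: hsB.
have [q [eq aq]] := hs_zero h0.
rewrite -(subrK u (upi _ p)) -eq; apply: (GenD _ gu); apply: (IH _ aq); rewrite eq.
by rewrite -scaleN1r; apply: FFD fp (FFZ _ (Gen_FF eps1 gu)).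
Qed.
End Generation.

(** * Homomorphisms and generated subalgebras *)

Section CentreFF.
Variables (C : fieldType) (N : nat).

Definition fvac_lin (x : LP N) (v : fa C (LP N)) : fa C (LP N) :=
  flatten [seq fa_scale cw.1 (fvac_act C cw.2 x) | cw <- v].

Lemma op_fvac_lin k l r v : op (Posz r) (delta_mx k l) (upi (@floop_rel C N) v) =
  upi (@floop_rel C N) (fvac_lin (k, l, r) v).
Proof.
elim: v => [|[c w] v IH]; first by rewrite /fvac_lin /= !upi_nil op0.
rewrite -cat1s upi_cat opD IH /fvac_lin /= upi_cat; congr (_ + _).
by rewrite upi_word opZ op_word opw_delta_pos upi_scale.
Qed.

Lemma FF_centreP v : (forall x, in_ideal (@floop_rel C N) (fvac_lin x v)) <->
  FFu (upi (@floop_rel C N) v).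
Proof.
split=> [h r A|h [[k l] r]]; last by apply/upi_ideal; rewrite -op_fvac_lin h.
apply: (linear_mx_eq (f := fun A => op r A (upi _ v)) (g := fun=> 0)) => [||k l].
- exact: op_linear_mx.
- by move=> c Y Z; rewrite scaler0 addr0.
by rewrite op_fvac_lin; apply/upi_ideal.
Qed.
End CentreFF.

Section AlgebraMaps.
Variables (C : fieldType) (X Y : choiceType) (I J : Type).
Variables (rels : I -> fa C X) (rels' : J -> fa C Y) (f : X -> fa C Y).
Local Notation W := (Uq rels').

Definition ext_word (w : seq X) : W := \prod_(x <- w) upi rels' (f x).
Lemma ext_word_cat u v : ext_word (u ++ v) = ext_word u * ext_word v.
Proof. exact: big_cat. Qed.

Hypothesis ext_rels : forall r, lin ext_word (rels r) = 0.
Lemma ext_kills : kills rels ext_word.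
Proof.
move=> r u v; transitivity (ext_word u * lin ext_word (rels r) * ext_word v).
  rewrite /lin mulr_sumr mulr_suml; apply: eq_bigr => i _.
  by rewrite !ext_word_cat -uscaleAr -uscaleAl mulrA.
by rewrite ext_rels mulr0 mul0r.
Qed.

Definition ext : Uq rels -> W := descend ext_kills.
HB.instance Definition _ := GRing.Linear.on ext.
Lemma extD u v : ext (u + v) = ext u + ext v. Proof. exact: linearD. Qed.
Lemma extZ c u : ext (c *: u) = c *: ext u. Proof. exact: linearZ. Qed.
Lemma ext0 : ext 0 = 0. Proof. exact: linear0. Qed.
Lemma ext_wordE w : ext (word rels w) = ext_word w. Proof. exact: descend_word. Qed.
Lemma ext1 : ext 1 = 1.
Proof. by rewrite -(word_nil rels) ext_wordE /ext_word big_nil. Qed.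
Lemma ext_let x : ext (let_ rels x) = upi rels' (f x).
Proof.
by have := ext_wordE [:: x]; rewrite word_cons word_nil mulr1 /ext_word big_seq1.
Qed.
Lemma extM u v : ext (u * v) = ext u * ext v.
Proof.
elim/uq_ind: u => [c u|u u' hu hu']; last by rewrite mulrDl !extD mulrDl hu hu'.
elim/uq_ind: v => [d v|v v' hv hv']; last by rewrite mulrDr !extD mulrDr hv hv'.
by rewrite -uscaleAl -uscaleAr !extZ -word_cat !ext_wordE ext_word_cat -uscaleAl -uscaleAr.
Qed.
Lemma ext_upi p : ext (upi rels p) = upi rels' (fa_hom f p).
Proof.
elim: p => [|[c w] p IH]; first by rewrite upi_nil ext0 upi_nil.
rewrite -cat1s upi_cat extD IH /fa_hom /= upi_cat; congr (_ + _).
rewrite upi_word extZ ext_wordE upi_scale; congr (_ *: _).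
elim: w => [|x w IHw]; first by rewrite /ext_word big_nil.
by rewrite /= upi_mul -IHw /ext_word big_cons.
Qed.
End AlgebraMaps.

Section GeneratedSubalgebra.
Variables (C : fieldType) (X : choiceType) (I : Type) (rels : I -> fa C X).
Local Notation W := (Uq rels).

Inductive Alg (S : W -> Prop) : W -> Prop :=
| Alg_gen u : S u -> Alg S u
| Alg1 : Alg S 1
| AlgD u v : Alg S u -> Alg S v -> Alg S (u + v)
| AlgZ c u : Alg S u -> Alg S (c *: u)
| AlgM u v : Alg S u -> Alg S v -> Alg S (u * v).

Lemma Alg0 S : Alg S 0.
Proof. by rewrite -(scale0r (1 : W)); apply/AlgZ/Alg1. Qed.
Lemma Alg_sub S S' : (forall u, S u -> Alg S' u) -> forall u, Alg S u -> Alg S' u.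
Proof.
move=> h u; elim=> [v /h //|| a b _ ha _ hb|c a _ ha|a b _ ha _ hb].
- exact: Alg1.
- exact: AlgD.
- exact: AlgZ.
- exact: AlgM.
Qed.
Lemma Alg_sum S (J : Type) (r : seq J) F : (forall j, Alg S (F j)) -> Alg S (\sum_(j <- r) F j).
Proof. by move=> h; apply: (big_ind (Alg S)) => //; [exact: Alg0 | exact: AlgD]. Qed.

Lemma gen_byP (K : choiceType) (F : K -> fa C X) u :
  gen_by rels F u <-> Alg (fun v => exists k, v = upi rels (F k)) (upi rels u).
Proof.
(* The free algebra on the generators is presented by an empty family of relations. *)
pose e (_ : void) : fa C K := [::].
have ke (r : void) : lin (ext_word rels F) (e r) = 0 by case: r.
have hom q : upi rels (fa_hom F q) = ext ke (upi e q) by rewrite ext_upi.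
split=> [[q /upiP ->]|].
  rewrite hom; move: (upi e q); elim/uq_ind => [c w|a b ha hb].
    rewrite extZ ext_wordE; apply: AlgZ; elim: w => [|k w IH].
      by rewrite /ext_word big_nil; apply: Alg1.
    by rewrite /ext_word big_cons; apply: AlgM IH; apply: Alg_gen; exists k.
  by rewrite extD; apply: AlgD.
suff H a : Alg (fun v => exists k, v = upi rels (F k)) a -> exists t, a = ext ke t.
  by move=> /H[t]; elim/uqW: t => q; rewrite -hom => eq; exists q; apply/upiP.
elim=> [v [k ->]||a1 b _ [s ->] _ [t ->]|c a1 _ [s ->]|a1 b _ [s ->] _ [t ->]].
- by exists (let_ e k); rewrite ext_let.
- by exists 1; rewrite ext1.
- by exists (s + t); rewrite extD.
- by exists (c *: s); rewrite extZ.
- by exists (s * t); rewrite extM.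
Qed.
End GeneratedSubalgebra.

(** * The homomorphism rho *)

Section Evaluation.
Variables (C : fieldType) (N : nat) (mu : 'I_N -> 'I_N -> C) (z : C).
Local Notation V := (Uq (@floop_rel C N)).
Local Notation U := (Uq (@fgl_rel C N)).
Local Notation der := (@der C N).

Definition frho (x : LP N) : fa C (GL N) :=
  let: (i, j, n) := x in
  [:: ((z ^+ n.+1)^-1, [:: E i j]); ((n == 0)%:R * mu i j, [::])].

Definition gE (i j : 'I_N) : U := let_ (@fgl_rel C N) (E i j).

Lemma frhoE i j n : upi (@fgl_rel C N) (frho (i, j, n)) =
  (z^-1 ^+ n.+1) *: gE i j + ((n == 0%N)%:R * mu i j) *: (1 : U).
Proof.
rewrite /frho -cat1s upi_cat !upi_word word_nil word_cons word_nil mulr1 exprVn.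
by case: n.
Qed.

Lemma gE_comm i j k l : gE i j * gE k l - gE k l * gE i j =
  (k == j)%:R *: gE i l - (i == l)%:R *: gE k j.
Proof.
have := upi_rel (@fgl_rel C N) (i, j, k, l); rewrite /fgl_rel upi_lin !lin_cons lin_nil.
rewrite !word_cons !word_nil !mulr1 scale1r -/(gE i j) -/(gE k l) -/(gE i l) -/(gE k j) addr0.
by move=> /= h; apply/eqP; rewrite -subr_eq0; apply/eqP; rewrite -[RHS]h; lmod.
Qed.

(** The terms with [mu] are scalars and drop out of commutators, and a bracket lies in [t^(-2)] or
    lower, where [mu] does not appear. *)
Lemma rho_rels r : lin (ext_word (@fgl_rel C N) frho) (@floop_rel C N r) = 0.
Proof.
case: r => [[[i j] a] [[k l] b]]; rewrite /floop_rel !lin_cons lin_nil /= /ext_word.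
rewrite !big_cons !big_nil !mulr1 !frhoE /= !mul0r !scale0r !addr0 scale1r scaleN1r.
set x := z^-1.
have e : (x ^+ a.+1 *: gE i j + ((a == 0)%N%:R * mu i j) *: (1 : U)) * (x ^+ b.+1 *: gE k l + ((b == 0)%N%:R * mu k l) *: (1 : U))
  - (x ^+ b.+1 *: gE k l + ((b == 0)%N%:R * mu k l) *: (1 : U)) * (x ^+ a.+1 *: gE i j + ((a == 0)%N%:R * mu i j) *: (1 : U))
  = x ^+ (a + b).+2 *: (gE i j * gE k l - gE k l * gE i j).
  have -> : (a + b).+2 = (a.+1 + b.+1)%N by lia.
  rewrite exprD !mulrDl !mulrDr -!uscaleAl -!uscaleAr !mul1r !mulr1.
  by move: (x ^+ a.+1) (x ^+ b.+1) => p q; lmod.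
rewrite gE_comm in e; rewrite addrA e; lmod.
Qed.

Definition rhom : V -> U := ext rho_rels.
HB.instance Definition _ := GRing.Linear.on rhom.
Local Notation x := (z^-1).

Lemma rhom_ell n i j u : rhom (ell n (delta_mx i j) * u) =
  (x ^+ n.+1) *: (gE i j * rhom u) + ((n == 0%N)%:R * mu i j) *: rhom u.
Proof.
rewrite /rhom extM ell_delta ext_let frhoE mulrDl -!uscaleAl mul1r; by [].
Qed.

(* [rf y s] is the rising factorial y (y+1) ... (y+s-1), the coefficient in  *)
(* the s-th iterate of zeta^2 d/dzeta on zeta^y, where zeta = 1/z; rhom      *)
(* turns the derivation der into this operator.                              *)
Fixpoint rf (y s : nat) : C := if s is s'.+1 then y%:R * rf y.+1 s' else 1.
Lemma rfS y s : rf y s.+1 = rf y s * (y + s)%:R.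
Proof.
elim: s y => [|s IH] y; first by rewrite /= mulr1 mul1r addn0.
by rewrite -[LHS]/(y%:R * rf y.+1 s.+1) IH -[rf y s.+1]/(y%:R * rf y.+1 s) mulrA addnS addSn.
Qed.

(* [g] lists the coefficients of the polynomial rhom u in zeta, of degree     *)
(* less than M.                                                               *)
Definition Rep M (u : V) (g : nat -> U) := (forall y, (M <= y)%N -> g y = 0) /\
  forall s, rhom (iter s der u) = \sum_(y < M) (rf y s * x ^+ (y + s)) *: g y.

Lemma der_iterD s u v : iter s der (u + v) = iter s der u + iter s der v.
Proof. by elim: s => //= s ->; rewrite derD. Qed.
Lemma der_iterZ s c u : iter s der (c *: u) = c *: iter s der u.
Proof. by elim: s => //= s ->; rewrite derZ. Qed.

Lemma Rep_stable M : stable_rel (Rep M).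
Proof.
split.
  split=> // s; rewrite big1 => [|y _]; last by rewrite scaler0.
  by rewrite -(scale0r (0 : V)) der_iterZ scale0r linear0.
move=> c u v p q [hp ep] [hq eq]; split=> [y My|s].
  by rewrite -[LHS]/(c *: p y + q y) hp // hq // scaler0 addr0.
rewrite der_iterD der_iterZ linearD linearZ /= ep eq scaler_sumr -big_split /=.
apply: eq_bigr => y _; rewrite -[(c *: p + q) _]/(c *: p y + q y).
by move: (rf y s * _) => a; lmod.
Qed.

(** The operator [zeta^2 d/dzeta] on coefficients. *)
Definition shiftW (g : nat -> U) y : U := if y is y'.+1 then y'%:R *: g y' else 0.

Lemma Rep_der M u g : Rep M u g -> Rep M.+1 (der u) (shiftW g).
Proof.
move=> [hg eg]; split=> [[|y] // My|s]; first by rewrite /= hg // scaler0.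
rewrite -iterSr eg big_ord_recl scaler0 add0r; apply: eq_bigr => y _.
by rewrite /shiftW /= scalerA addnS addSn; congr (_ *: _); rewrite /=; ring.
Qed.

(** Induction on [s] for all [n] at once, because [der] raises the mode. *)
Lemma Rep_ell_gen s n i j M u g : Rep M u g -> rhom (iter s der (ell n (delta_mx i j) * u)) =
  \sum_(y < M) (rf (y + n.+1) s * x ^+ (y + n.+1 + s)) *: (gE i j * g y) +
  (n == 0%N)%:R *: \sum_(y < M) (rf y s * x ^+ (y + s)) *: (mu i j *: g y).
Proof.
elim: s n M u g => [|s IH] n M u g ru.
  rewrite /= rhom_ell; have := ru.2 0%N; rewrite /= => ->; congr (_ + _).
    rewrite mulr_sumr scaler_sumr; apply: eq_bigr => y _.
    by rewrite -uscaleAr scalerA !addn0 !mul1r -exprD addnC.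
  rewrite -scalerA scaler_sumr; congr (_ *: _); apply: eq_bigr => y _; rewrite !scalerA; congr (_ *: _); ring.
rewrite iterSr der_ell der_iterD der_iterZ linearD linearZ /= (IH _ _ _ _ ru).
rewrite (IH _ _ _ _ (Rep_der ru)) /= scale0r addr0 !big_ord_recl /= mulr0 !scaler0 !add0r.
rewrite addrA; congr (_ + _ *: _).
  rewrite scaler_sumr -big_split /=; apply: eq_bigr => y _.
  rewrite /bump /= add1n addSn !addnS !addSn -!uscaleAr !scalerA -scalerDl; congr (_ *: _).
  rewrite -[(y + n).+1%:R]natr1 natrD -[n.+1%:R]natr1; ring.
apply: eq_bigr => y _; rewrite /bump /= add1n addSn addnS !scalerA; congr (_ *: _); ring.
Qed.

Variable eps : C.

(* [Lop] acting on the coefficients of a polynomial in zeta *)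
Definition LW (i j : 'I_N) (g : nat -> U) : nat -> U := fun y =>
  (i == j)%:R *: shiftW g y + (if y is y'.+1 then gE i j * g y' else 0) + mu i j *: g y.
Lemma LW_linear i j : linear (LW i j).
Proof.
move=> c g h; apply/funext => y.
rewrite -[RHS]/(c *: LW i j g y + LW i j h y) /LW.
case: y => [|y] /=; rewrite -![(c *: g + h) _]/(c *: g _ + h _); first by lmod.
by rewrite mulrDr -uscaleAr; lmod.
Qed.
HB.instance Definition _ i j :=
  GRing.isLinear.Build C (nat -> U) (nat -> U) _ (LW i j) (LW_linear i j).

Lemma Rep_Lop M i j u g : Rep M u g -> Rep M.+1 (Lop i j u) (LW i j g).
Proof.
move=> ru; split=> [[|y] // My|s].
  by rewrite /LW (Rep_der ru).1 // (ru.1 y) // (ru.1 y.+1) 1?ltnW // mulr0 !scaler0 !addr0.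
rewrite /Lop der_iterD der_iterZ linearD linearZ /= (Rep_der ru).2 (Rep_ell_gen _ _ _ _ ru) eqxx.
pose a y := rf y s * x ^+ (y + s).
transitivity (\sum_(y < M.+1) a y *: ((i == j)%:R *: shiftW g y) +
  (\sum_(y < M.+1) a y *: (if (y : nat) is y'.+1 then gE i j * g y' else 0) +
   \sum_(y < M.+1) a y *: (mu i j *: g y))); last first.
  by rewrite -!big_split; apply: eq_bigr => y _; rewrite /LW /= !scalerDr addrA.
rewrite scale1r; congr (_ + (_ + _)).
- by rewrite scaler_sumr; apply: eq_bigr => y _; rewrite !scalerA mulrC.
- rewrite big_ord_recl scaler0 add0r; apply: eq_bigr => y _.
  by rewrite /a /= /bump /= addn1; congr (_ *: _); rewrite ?add1n.
by rewrite big_ord_recr /= (ru.1 M) // !scaler0 addr0.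
Qed.

Definition oneW : nat -> U := fun y => (y == 0%N)%:R *: (1 : U).
Definition Hm m : nat -> U := pr m (FF eps (fun i j => LW i j) oneW m).

Lemma Rep_ssv m : Rep m.+1 (ssv N eps m) (Hm m).
Proof.
apply: (rel_pr (H := Rep m.+1)); first exact: Rep_stable.
elim: m => [|m IH].
  move=> s t; rewrite /FF /= /vac; case: ifP => _; last by case: (Rep_stable 1).
  split=> [[|y] // _|k]; first by rewrite /oneW scale0r.
  rewrite big_ord1 /oneW eqxx scale1r; case: k => [|k].
    by rewrite /= mulr1 scale1r /rhom ext1.
  rewrite iterSr der1 /= mul0r mul0r scale0r.
  by rewrite -(scale0r (0 : V)) der_iterZ scale0r linear0.
rewrite /FF !iterS -!/(FF _ _ _ _) !LL_sum.
apply: (fock_rel_sum (Rep_stable _)) => i; apply: (fock_rel_sum (Rep_stable _)) => j.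
apply: (fock_rel_ca eps (Rep_stable _)); apply: (fock_rel_cb eps (Rep_stable _)) => s t.
exact: Rep_Lop.
Qed.
End Evaluation.

(** * Coefficients of the evaluated Segal-Sugawara vectors *)

Section Components.
Variables (C : fieldType) (N : nat) (mu : 'I_N -> 'I_N -> C) (eps : C).
Hypothesis eps2 : eps * eps = 1.
Local Notation U := (Uq (@fgl_rel C N)).
Local Notation gE := (@gE C N).
Local Notation M := (seq 'I_N -> seq 'I_N -> U).
Local Notation ca := (@ca C 'I_N eps U).
Local Notation cb := (@cb C 'I_N eps U).
Local Notation kp := (@kp C 'I_N eps U).
Implicit Types (f g : M).

Definition LE (i j : 'I_N) (u : U) : U := gE i j * u.
Lemma LE_linear i j : linear (LE i j).
Proof. by move=> c u v; rewrite /LE mulrDr -uscaleAr. Qed.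
HB.instance Definition _ i j := GRing.isLinear.Build C U U _ (LE i j) (LE_linear i j).
Definition LM (i j : 'I_N) (u : U) : U := mu i j *: u.
Lemma LM_linear i j : linear (LM i j).
Proof. by move=> c u v; rewrite /LM; lmod. Qed.
HB.instance Definition _ i j := GRing.isLinear.Build C U U _ (LM i j) (LM_linear i j).

Local Notation EE := (LL eps (fun i j => LE i j : {linear U -> U})).
Local Notation MM := (LL eps (fun i j => LM i j : {linear U -> U})).
Definition Bpq p q : M := iter p MM (iter q EE (vac (1 : U))).
Definition Gpq p q : U := pr (p + q) (Bpq p q).

Lemma EE_MM f : EE (MM f) = MM (EE f).
Proof. by apply: LL_comm => // i j k l u; rewrite /= /LE /LM uscaleAr. Qed.

Lemma EE_iterM p f : EE (iter p MM f) = iter p MM (EE f).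
Proof. by elim: p => //= p IH; rewrite EE_MM IH. Qed.
Lemma EE_iterk p f : EE (iter p kp f) = iter p kp (EE f).
Proof. by elim: p => //= p IH; rewrite (LL_kp eps2) IH. Qed.
Lemma MM_iterk p f : MM (iter p kp f) = iter p kp (MM f).
Proof. by elim: p => //= p IH; rewrite (LL_kp eps2) IH. Qed.

Lemma EE_Bpq p q : EE (Bpq p q) = Bpq p q.+1. Proof. by rewrite /Bpq EE_iterM. Qed.

Lemma symf_Bpq p q : symf eps (Bpq p q).
Proof.
rewrite /Bpq; elim: p => [|p IH] /=; last by apply: symf_LL.
by elim: q => [|q IH] /=; [apply: symf_vac | apply: symf_LL].
Qed.

(** The terms of degree [p + y] in which some translation was chosen: it leaves a [kp] and raises
    the power of zeta without supplying an [E]. *)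
Inductive lowsp (y p : nat) : M -> Prop :=
| low0 : lowsp y p 0
| lowD f g : lowsp y p f -> lowsp y p g -> lowsp y p (f + g)
| low_base c q : (q < y)%N -> lowsp y p (c *: iter (y - q) kp (Bpq p q)).

Lemma lowZ y p c f : lowsp y p f -> lowsp y p (c *: f).
Proof.
elim=> [|f1 f2 _ h1 _ h2|d q qy]; first by rewrite scaler0; apply: low0.
- by rewrite scalerDr; apply: lowD.
by rewrite scalerA; apply: low_base.
Qed.
Lemma low_kp y p f : lowsp y p f -> lowsp y.+1 p (kp f).
Proof.
elim=> [|f1 f2 _ h1 _ h2|d q qy]; first by rewrite kp0; apply: low0.
- by rewrite kpD; apply: lowD.
by rewrite kpZ -iterS -subSn ?(ltnW qy) //; apply: low_base; apply: leqW.
Qed.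
Lemma low_EE y p f : lowsp y p f -> lowsp y.+1 p (EE f).
Proof.
elim=> [|f1 f2 _ h1 _ h2|d q qy]; first by rewrite LL0; apply: low0.
- by rewrite LLD; apply: lowD.
by rewrite LLZ EE_iterk EE_Bpq -subSS; apply: low_base.
Qed.
Lemma low_MM y p f : lowsp y p f -> lowsp y p.+1 (MM f).
Proof.
elim=> [|f1 f2 _ h1 _ h2|d q qy]; first by rewrite LL0; apply: low0.
- by rewrite LLD; apply: lowD.
by rewrite LLZ MM_iterk; apply: low_base.
Qed.

Definition at_ (W : lmodType C) y (F : seq 'I_N -> seq 'I_N -> nat -> W) :
  seq 'I_N -> seq 'I_N -> W := fun s t => F s t y.
Lemma at_stable y : stable_rel (fun (g : nat -> U) (u : U) => g y = u).
Proof. by split=> // c u v p q <- <-. Qed.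

Local Notation FW := (FF eps (fun i j => LW mu i j : {linear (nat -> U) -> (nat -> U)}) (@oneW C N)).

Lemma at_LL y (F : seq 'I_N -> seq 'I_N -> nat -> U) :
  at_ y (LL eps (fun i j => LW mu i j : {linear (nat -> U) -> (nat -> U)}) F) =
  (if y is y'.+1 then y'%:R *: kp (at_ y' F) + EE (at_ y' F) else 0) + MM (at_ y F).
Proof.
transitivity (\sum_i \sum_j ca i (cb j (fun s t => LW mu i j (F s t) y))).
  apply/funext => s; apply/funext => t; rewrite LL_sum.
  apply: (fock_rel_sum (at_stable y)) => i; apply: (fock_rel_sum (at_stable y)) => j.
  by apply: (fock_rel_ca eps (at_stable y)); apply: (fock_rel_cb eps (at_stable y)) => ? ?.
rewrite !LL_sum; case: y => [|y].
  rewrite add0r; apply: eq_bigr => i _; apply: eq_bigr => j _; congr (ca _ (cb _ _)).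
  apply/funext => s; apply/funext => t; rewrite /LW /=.
  by rewrite scaler0 !add0r.
have -> : kp (at_ y F) = \sum_i \sum_j (i == j)%:R *: ca i (cb j (at_ y F)).
  rewrite /Submission.kp; apply: eq_bigr => i _; rewrite (bigD1 i) //= eqxx scale1r big1 ?addr0 //.
  by move=> j /negPf; rewrite eq_sym => ->; rewrite scale0r.
rewrite LL_sum scaler_sumr -!big_split; apply: eq_bigr => i _ /=.
rewrite scaler_sumr -!big_split; apply: eq_bigr => j _ /=.
rewrite scalerA -caZ -cbZ -!caD -!cbD; congr (ca _ (cb _ _)).
apply/funext => s; apply/funext => t; rewrite /LW /=.
rewrite -[RHS]/((y%:R * (i == j)%:R) *: F s t y + gE i j * F s t y + mu i j *: F s t y.+1).
by lmod.
Qed.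

(** In [L^m] a factor [M] keeps the power of zeta, while [E] and the translation raise it by one. So
    [zeta^y] takes [m - y] factors [M], and taking [E] for all the others gives the leading term. *)
Lemma at_FW m y : if (y <= m)%N then
    lowsp y (m - y) (at_ y (FW m) - 'C(m, y)%:R *: Bpq (m - y) y)
  else at_ y (FW m) = 0.
Proof.
elim: m y => [|m IH] y.
  have e0 : at_ y (FW 0) = (y == 0%N)%:R *: vac (1 : U).
    apply/funext => s; apply/funext => t; rewrite /at_ /FF /= /vac.
    rewrite -[RHS]/((y == 0%N)%:R *: (if nilp s && nilp t then 1 else 0 : U)).
    by case: ifP => _; rewrite /oneW ?scaler0.
  rewrite e0; case: y {e0} => [|y]; last by rewrite scale0r.
  by rewrite /= ?bin0 !scale1r subrr; apply: low0.
rewrite /FF iterS -/(FW m) at_LL; case: y => [|y].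
  have := IH 0%N; rewrite !subn0 !bin0 add0r => h.
  by rewrite -[Bpq m.+1 0]/(MM (Bpq m 0)) scale1r -LLB; apply: low_MM; rewrite -[Bpq _ _]scale1r.
rewrite ltnS; have := IH y; case: leqP => ym; last first.
  by move=> ->; have := IH y.+1; rewrite leqNgt ltnS (ltnW ym) /= => ->; rewrite kp0 !LL0 scaler0 !addr0.
move=> hy; rewrite subSS binS natrD scalerDl.
rewrite [X in lowsp _ _ (X - _)](_ : _ = y%:R *: kp (at_ y (FW m)) + (EE (at_ y (FW m)) + MM (at_ y.+1 (FW m)))); last by rewrite addrA.
rewrite [X in _ - X]addrC -addrA opprD addrACA; apply: lowD; last apply: lowD.
- apply: lowZ; rewrite -[at_ y _](subrK ('C(m, y)%:R *: Bpq (m - y) y)) kpD kpZ.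
  apply: lowD; first exact: low_kp.
  by have := @low_base y.+1 (m - y) 'C(m, y)%:R y (leqnn _); rewrite subSnn.
- by rewrite -EE_Bpq -LLZ -LLB; apply: low_EE.
have := IH y.+1; case: ltnP => ym1.
  move=> h; have e : (m - y = (m - y.+1).+1)%N by lia.
  by rewrite e -[Bpq _.+1 _]/(MM (Bpq (m - y.+1) y.+1)) -LLZ -LLB; apply: low_MM.
by move=> ->; rewrite bin_small // scale0r LL0 subrr; apply: low0.
Qed.

Lemma pr_iterk p q r : exists c : C, pr (p + q + r) (iter r kp (Bpq p q)) = c *: Gpq p q.
Proof.
have sk r' : symf eps (iter r' kp (Bpq p q)).
  by elim: r' => [|r' IH] /=; [apply: symf_Bpq | apply: symf_kp].
elim: r => [|r [c e]]; first by exists 1; rewrite addn0 scale1r.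
by rewrite addnS /= (pr_kp eps2 _ (sk r)) e; eexists; rewrite scalerA.
Qed.

Lemma pr_lowsp (S : U -> Prop) y p f : (forall q, (q < y)%N -> Alg S (Gpq p q)) ->
  lowsp y p f -> Alg S (pr (p + y) f).
Proof.
move=> h; elim=> [|f1 f2 _ h1 _ h2|d q qy].
- by rewrite -(scale0r (0 : M)) prZ scale0r; apply: Alg0.
- by rewrite prD; apply: AlgD.
have -> : (p + y = p + q + (y - q))%N by lia.
by rewrite prZ; have [c ->] := pr_iterk p q (y - q); do 2 apply: AlgZ; apply: h.
Qed.

Lemma Hm_at m y : Hm mu eps m y = pr m (at_ y (FW m)).
Proof. exact: (rel_pr (at_stable y)). Qed.

Lemma Gpq0_scalar p : exists c : C, Gpq p 0 = c *: (1 : U).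
Proof.
pose H (u v : U) := u = v /\ exists c : C, u = c *: (1 : U).
have sH : stable_rel H.
  split; first by split=> //; exists 0; rewrite scale0r.
  by move=> c u v _ _ [<- [a ->]] [<- [b ->]]; split=> //; exists (c * a + b); lmod.
suff h : fock_rel H (Bpq p 0) (Bpq p 0) by have [_] := rel_pr sH (p + 0)%N h.
rewrite /Bpq; elim: p => [|p IH].
  move=> s t; rewrite /= /vac; case: ifP => _; split=> //; [exists 1 | exists 0].
    by rewrite scale1r.
  by rewrite scale0r.
rewrite iterS !LL_sum.
apply: (fock_rel_sum sH) => i; apply: (fock_rel_sum sH) => j.
apply: (fock_rel_ca eps sH); apply: (fock_rel_cb eps sH) => s t.
by case: (IH s t) => _ [c e]; split=> //; exists (mu i j * c); rewrite /lf /= /LM e scalerA.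
Qed.
End Components.

Section Separation.
Variables (C : fieldType) (W : lmodType C) (T : W -> Prop) (x : C) (M : nat) (h : nat -> W).
Hypothesis chC : [pchar C] =i pred0.
Hypothesis x0 : x != 0.
Hypotheses (TD : forall u v, T u -> T v -> T (u + v)) (TZ : forall c u, T u -> T (c *: u)).
Hypothesis Trf : forall s, T (\sum_(y < M) (rf C y s * x ^+ (y + s)) *: h y).

(* The rising factorials span all polynomial functions, in particular those  *)
(* vanishing at all points 0, ..., M - 1 but one.                            *)
Lemma separate y0 : (y0 < M)%N -> T (h y0).
Proof.
move=> yM; pose S (f : nat -> C) := T (\sum_(y < M) (f y * x ^+ y) *: h y).
have lincomb2 f g a b : S f -> S g -> S (fun y => a * f y + b * g y).
  move=> hf hg; rewrite /S; have := TD (TZ a hf) (TZ b hg); rewrite !scaler_sumr -big_split.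
  by congr T; apply: eq_bigr => y _ /=; rewrite !scalerA -scalerDl; congr (_ *: _); ring.
(* The recursion [rfS] gives [(y - k) rf y s = rf y (s+1) - (s + k) rf y s], so linear factors can
   be added one at a time. *)
have H l s : S (fun y => \prod_(k <- l) (y%:R - k) * rf C y s).
  elim: l s => [|k l IH] s.
    rewrite /S; have := TZ (x ^+ s)^-1 (Trf s); rewrite scaler_sumr; congr T.
    apply: eq_bigr => y _; rewrite scalerA big_nil mul1r exprD; congr (_ *: _).
    by rewrite !mulrA mulrC !mulrA mulfV ?expf_neq0 // mul1r.
  have := lincomb2 _ _ 1 (- (s%:R + k)) (IH s.+1) (IH s).
  rewrite /S; congr T; apply: eq_bigr => y _; congr (_ *: _); rewrite big_cons rfS natrD.
  by move: (\prod_(j <- l) _) => P; ring.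
pose l : seq C := [seq (k : nat)%:R | k <- iota 0 M & k != y0].
have := H l 0%N; rewrite /S (bigD1 (Ordinal yM)) //= [X in _ + X]big1 ?addr0 => [|y hy]; last first.
  have hl : (y : nat)%:R \in l.
    apply: map_f; rewrite mem_filter mem_iota /= ltn_ord andbT.
    by apply: contra hy => /eqP e; apply/eqP/val_inj.
  by rewrite (big_rem _ hl) /= subrr !mul0r scale0r.
rewrite mulr1; set c := (X in X *: _) => hc.
have c0 : c != 0.
  rewrite /c mulf_neq0 ?expf_neq0 // prodf_seq_neq0; apply/allP => k /mapP[j].
  rewrite mem_filter => /andP[hj _] ->; rewrite subr_eq0; apply: contra hj => /eqP/(natr_inj chC) ->.
  exact: eqxx.
by have := TZ c^-1 hc; rewrite scalerA mulVf // scale1r.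
Qed.
End Separation.

(** * The image of the centre under evaluation *)

Section ImageOfCentre.
Variables (C : fieldType) (N : nat) (mu : 'I_N -> 'I_N -> C) (z eps : C).
Hypothesis chC : [pchar C] =i pred0.
Hypothesis N0 : (0 < N)%N.
Hypothesis z0 : z != 0.
Hypothesis eps1 : (eps == 1) || (eps == -1).
Local Notation V := (Uq (@floop_rel C N)).
Local Notation U := (Uq (@fgl_rel C N)).
Local Notation Gpq := (Gpq mu eps).
Local Notation Hm := (Hm mu eps).
Local Notation rhom := (rhom mu z).

Let eps2 : eps * eps = 1.
Proof. by case/orP: eps1 => /eqP ->; rewrite ?mulrNN mulr1. Qed.

Definition Gset (u : U) := exists p q, [/\ (0 < q)%N, (p + q <= N)%N & u = Gpq p q].

Lemma Hm_low (S : U -> Prop) m y : (y <= m)%N ->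
  (forall q, (q < y)%N -> Alg S (Gpq (m - y) q)) ->
  exists2 l, Alg S l & Hm m y = 'C(m, y)%:R *: Gpq (m - y) y + l.
Proof.
move=> ym hS; have := at_FW mu eps2 m y; rewrite ym => hl.
have := pr_lowsp eps2 hS hl; rewrite (subnK ym) prB prZ -Hm_at => h.
by eexists; [exact: h|]; rewrite /Submission.Gpq (subnK ym) addrC subrK.
Qed.

Lemma rhom_Alg t : FFu t -> Alg Gset (rhom t).
Proof.
move/(FF_Gen chC N0 eps1); elim=> [|a b _ ha _ hb|c a _ ha|a b _ ha _ hb|k n kN].
- by rewrite /Submission.rhom ext1; apply: Alg1.
- by rewrite /Submission.rhom extD; apply: AlgD.
- by rewrite /Submission.rhom extZ; apply: AlgZ.
- by rewrite /Submission.rhom extM; apply: AlgM.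
rewrite (Rep_ssv mu z eps k).2; apply: Alg_sum => y; apply: AlgZ.
have yk : (y <= k)%N by rewrite -ltnS.
have G p q : (p + q <= N)%N -> Alg Gset (Gpq p q).
  case: q => [|q] hq; last by apply: Alg_gen; exists p, q.+1.
  by have [c ->] := Gpq0_scalar mu eps p; apply/AlgZ/Alg1.
have [|l hl ->] := @Hm_low Gset k y yk; first by move=> q qy; apply: G; lia.
by apply: AlgD hl; apply/AlgZ/G; rewrite subnK //; case/andP: kN.
Qed.

Definition image (u : U) := exists t, FFu t /\ u = rhom t.
Lemma image_Alg u : Alg image u -> image u.
Proof.
elim=> [//||a b _ [s [fs ->]] _ [t [ft ->]]|c a _ [s [fs ->]]|a b _ [s [fs ->]] _ [t [ft ->]]].
- by exists 1; split; [apply: FF1 | rewrite /Submission.rhom ext1].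
- by exists (s + t); split; [apply: FFD | rewrite /Submission.rhom extD].
- by exists (c *: s); split; [apply: FFZ | rewrite /Submission.rhom extZ].
- by exists (s * t); split; [apply: FFM | rewrite /Submission.rhom extM].
Qed.

Lemma image_Hm m y : (y <= m)%N -> image (Hm m y).
Proof.
rewrite -ltnS; apply: (@separate _ _ image z^-1 m.+1) => [|||c u|s].
- exact: chC.
- by rewrite invr_neq0.
- by move=> u v hu hv; apply: image_Alg; apply: AlgD; apply: Alg_gen.
- by move=> hu; apply: image_Alg; apply: AlgZ; apply: Alg_gen.
exists (iter s (@der C N) (ssv N eps m)); split; last by rewrite (Rep_ssv mu z eps m).2.
by elim: s => [|s IH] /=; [apply: FF_ssv | apply: FF_der].
Qed.

(** Induction on [q]: the relation in [Hm_low] is triangular, with an invertible binomial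
    coefficient in front of [Gpq p q]. *)
Lemma image_G p q : image (Gpq p q).
Proof.
have [n] := ubnP q; elim: n q => // n IH q qn.
have e : (p + q - q = p)%N by rewrite addnK.
have [|l /image_Alg hl] := @Hm_low image (p + q) q (leq_addl _ _).
  by rewrite e => r rq; apply: Alg_gen; apply: IH; apply: leq_trans rq _.
rewrite e => h.
have b0 : 'C(p + q, q)%:R != 0 :> C by move/pcharf0P: chC => ->; rewrite -lt0n bin_gt0 leq_addl.
have -> : Gpq p q = ('C(p + q, q)%:R)^-1 *: (Hm (p + q) q - l).
  by rewrite h addrK scalerA mulVf // scale1r.
apply: image_Alg; apply: AlgZ; rewrite -scaleN1r; apply: AlgD; last by apply/AlgZ/Alg_gen.
by apply/Alg_gen/image_Hm; rewrite leq_addl.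
Qed.

Lemma imageP u : image u <-> Alg Gset u.
Proof.
split=> [[t [ft ->]]|h]; first exact: rhom_Alg.
by apply: image_Alg; apply: Alg_sub h => _ [p [q [_ _ ->]]]; apply/Alg_gen/image_G.
Qed.

End ImageOfCentre.

(** * Derivatives and symmetrisation *)

Lemma mx_letter_inj N (i j k l : 'I_N) : E i j = E k l -> i = k /\ j = l.
Proof. by move=> /cast_ord_inj/enum_rank_inj[-> ->]. Qed.

(* [Smx], [Phi], [Psi] and [dmu] over an arbitrary field. *)
Section OverField.
Variables (C : fieldType) (N : nat).
Local Notation A := {mpoly C[N * N]}.

Definition fSmx : 'M[A]_N := \matrix_(i, j) 'X_(E i j).
Definition fdet_uE : {poly A} := \det (\matrix_(i, j) ('X *+ (i == j) + (fSmx i j)%:P)).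
Definition fdet_1qE : {poly A} := \det (\matrix_(i, j) ((i == j)%:R%:P - 'X * (fSmx i j)%:P)).
Definition fpsi_next (s : seq A) : seq A :=
  rcons s (- \sum_(k < size s) fdet_1qE`_(size s - k) * s`_k).
Definition fPhi m : A := fdet_uE`_(N - m)%N.
Definition fPsi m : A := (iter m fpsi_next [:: 1])`_m.
Definition fdmu (mu : 'I_N -> 'I_N -> C) (H : A) : A :=
  \sum_(i < N) \sum_(j < N) mu i j *: mderiv (E i j) H.

Hypothesis chC : [pchar C] =i pred0.
Hypothesis N0 : (0 < N)%N.

Lemma mpoly_natr_inj : injective (fun n => n%:R : A).
Proof.
by move=> a b /= /(congr1 (mcoeff 0)); rewrite !mcoeffMn !mcoeff1 eqxx => /(natr_inj chC).
Qed.

Lemma det_horner_eq (P Q : {poly A}) : (forall n, P.[n%:R] = Q.[n%:R]) -> P = Q.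
Proof.
move=> h; apply/eqP; rewrite -subr_eq0; apply/eqP; apply: (poly_nat_eq0 mpoly_natr_inj) => n.
by rewrite hornerD hornerN h subrr.
Qed.

Lemma fdet_uE_sy : fdet_uE = \poly_(j < N.+1) sy_ (-1 : C) fSmx (N - j)%N.
Proof.
apply: det_horner_eq => m.
transitivity (\det (lincomb (m%:R : C) 1 fSmx)).
  rewrite -[LHS]/(horner_eval m%:R (\det _)) -det_map_mx; congr (\det _).
  apply/matrixP => i j; rewrite !mxE /= /horner_eval hornerD hornerMn hornerX hornerC scale1r.
  congr (_ + _); case: (i == j); rewrite ?mul0r ?scale0r //.
  by rewrite mul1r scaler_nat.
rewrite det_lincomb // horner_poly (reindex_inj rev_ord_inj) /=; apply: eq_bigr => j _.
have jN : (j <= N)%N by rewrite -ltnS.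
by rewrite subSS subKn // expr1n mulr1 -!natrX scaler_nat mulr_natr.
Qed.

Lemma fdet_1qE_sy : fdet_1qE = \poly_(j < N.+1) ((-1) ^+ j *: sy_ (-1 : C) fSmx j).
Proof.
apply: det_horner_eq => m.
transitivity (\det (lincomb 1 (- m%:R : C) fSmx)).
  rewrite -[LHS]/(horner_eval m%:R (\det _)) -det_map_mx; congr (\det _).
  apply/matrixP => i j; rewrite !mxE /= /horner_eval hornerD hornerN hornerM hornerX !hornerC.
  rewrite scaleNr scaler_nat; congr (_ - _); last exact: mulr_natl.
  by case: (i == j); rewrite ?mul0r ?scale0r ?mul1r ?scale1r.
rewrite det_lincomb // horner_poly; apply: eq_bigr => j _.
rewrite expr1n mul1r -[- m%:R]mulN1r exprMn -scalerA -scalerAl; congr (_ *: _).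
by rewrite -!natrX scaler_nat mulr_natr.
Qed.

Lemma fPhiE m : (m <= N)%N -> fPhi m = sy_ (-1) fSmx m.
Proof. by move=> mN; rewrite /fPhi fdet_uE_sy coef_poly ltnS leq_subr subKn. Qed.

(** The recursion that inverts the power series is [elem_complete]. *)
Lemma fPsi_iter m : (m <= N)%N ->
  iter m fpsi_next [:: 1] = [seq sy_ 1 fSmx k | k <- iota 0 m.+1].
Proof.
elim: m => [|m IH] mN; first by rewrite /= sy0.
have -> : iota 0 m.+2 = rcons (iota 0 m.+1) m.+1 by rewrite -(addn1 m.+1) iotaD cats1.
rewrite iterS (IH (ltnW mN)) map_rcons /fpsi_next size_map size_iota; congr (rcons _ _).
have := elem_complete chC fSmx m; rewrite big_ord_recl /= expr0 scale1r sy0 mul1r subn0.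
move/eqP; rewrite addr_eq0 => /eqP ->; congr (- _).
rewrite (reindex_inj rev_ord_inj) /=; apply: eq_bigr => k _.
have km : (k <= m)%N by rewrite -ltnS.
have -> : (m.+1 - (m.+1 - k.+1) = k.+1)%N by lia.
rewrite fdet_1qE_sy coef_poly ifT; last by lia.
rewrite -[_ :: _]/([seq sy_ 1 fSmx k0 | k0 <- iota 0 m.+1]) (nth_map 0%N) ?size_iota; last by lia.
by rewrite nth_iota ?add0n -?scalerAl //; lia.
Qed.

Lemma fPsiE m : (m <= N)%N -> fPsi m = sy_ 1 fSmx m.
Proof.
by move=> mN; rewrite /fPsi fPsi_iter // (nth_map 0%N) ?size_iota // nth_iota.
Qed.

Section Derivatives.
Variables (mu : 'I_N -> 'I_N -> C) (eps : C).
Hypothesis eps2 : eps * eps = 1.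
Local Notation dmu := (fdmu mu).
Implicit Types (Y : 'M[A]_N) (f : seq 'I_N -> seq 'I_N -> A).

Lemma fdmu_linear : linear dmu.
Proof.
move=> c p q; rewrite /fdmu scaler_sumr -big_split; apply: eq_bigr => i _ /=.
rewrite scaler_sumr -big_split; apply: eq_bigr => j _ /=.
by rewrite mderivD mderivZ; move: (mderiv _ p) (mderiv _ q) => a b; lmod.
Qed.
HB.instance Definition _ := GRing.isLinear.Build C A A _ dmu fdmu_linear.

Lemma fdmuM p q : dmu (p * q) = dmu p * q + p * dmu q.
Proof.
rewrite /fdmu mulr_suml mulr_sumr -big_split; apply: eq_bigr => i _ /=.
rewrite mulr_suml mulr_sumr -big_split; apply: eq_bigr => j _ /=.
by rewrite mderivM scalerDr scalerAl scalerAr.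
Qed.

Definition muA : 'M[A]_N := \matrix_(i, j) (mu i j)%:MP.
Lemma fdmu_Smx i j : dmu (fSmx i j) = muA i j.
Proof.
rewrite !mxE /fdmu (bigD1 i) //= [X in _ + X]big1 => [|k ki]; last first.
  apply: big1 => l _; rewrite mderivXU; case: eqP => [/mx_letter_inj[e _]|_]; last exact: scaler0.
  by rewrite e eqxx in ki.
rewrite addr0 (bigD1 j) //= [X in _ + X]big1 => [|l lj]; last first.
  rewrite mderivXU; case: eqP => [/mx_letter_inj[_ e]|_]; last exact: scaler0.
  by rewrite e eqxx in lj.
by rewrite mderivXU eqxx addr0 -mul_mpolyC mulr1.
Qed.

Local Notation EA := (LL eps (fun i j => mulL fSmx i j : {linear A -> A})).
Local Notation MA := (LL eps (fun i j => mulL muA i j : {linear A -> A})).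
Definition BA p q := iter p MA (iter q EA (vac (1 : A))).

Lemma lf_dmu_LL (Y Z : 'M[A]_N) f : (forall i j, dmu (Y i j) = Z i j) ->
  lf dmu (LL eps (fun i j => mulL Y i j : {linear A -> A}) f) =
  LL eps (fun i j => mulL Y i j : {linear A -> A}) (lf dmu f) +
  LL eps (fun i j => mulL Z i j : {linear A -> A}) f.
Proof.
move=> hZ; rewrite !LL_sum lf_sum -big_split; apply: eq_bigr => i _ /=.
rewrite lf_sum -big_split; apply: eq_bigr => j _ /=.
rewrite (lf_ca eps dmu) (lf_cb eps dmu) -caD -cbD; congr (ca _ _ (cb _ _ _)).
apply/funext => s; apply/funext => t; rewrite /lf /mulL /= fdmuM hZ.
by rewrite -[RHS]/(Y i j * dmu (f s t) + Z i j * f s t) addrC.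
Qed.

Lemma lf_dmu_EA f : lf dmu (EA f) = EA (lf dmu f) + MA f.
Proof. exact: lf_dmu_LL fdmu_Smx. Qed.
Lemma lf_dmu_MA f : lf dmu (MA f) = MA (lf dmu f).
Proof.
rewrite (lf_dmu_LL (Z := 0)) => [|i j]; last first.
  by rewrite !mxE /fdmu big1 // => k _; rewrite big1 // => l _; rewrite mderivC scaler0.
rewrite -[RHS]addr0; congr (_ + _); rewrite LL_sum big1 // => i _; rewrite big1 // => j _.
have -> : lf (mulL (0 : 'M[A]_N) i j) f = 0.
  by apply/funext => s; apply/funext => t; rewrite /lf /mulL /= mxE mul0r.
by rewrite cb0 ca0.
Qed.

(** The derivative replaces one factor [E] by [M]; as the factors commute, the [q] choices give the
    same result. *)
Lemma lf_dmu_BA p q : lf dmu (BA p q) = q%:R *: BA p.+1 q.-1.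
Proof.
elim: p => [|p IH]; last by rewrite /BA iterS lf_dmu_MA -/(BA p q) IH LLZ.
rewrite /BA /=; elim: q => [|q IH].
  rewrite scale0r; apply/funext => s; apply/funext => t; rewrite /lf /vac /=.
  case: (nilp s && nilp t); last exact: linear0.
  by rewrite /fdmu big1 // => k _; rewrite big1 // => l _; rewrite -mpolyC1 mderivC scaler0.
rewrite iterS lf_dmu_EA IH /= LLZ; case: q {IH} => [|q] /=.
  by rewrite scale0r add0r scale1r.
rewrite (LL_mulL_comm eps2) -{2}[MA _]scale1r -scalerDl; by rewrite natr1.
Qed.

Lemma iter_dmu_sy k m : (k <= m)%N -> exists2 c : C, c != 0 &
  iter k dmu (sy_ eps fSmx m) = c *: pr m (BA k (m - k)).
Proof.
have nz n : (0 < n)%N -> n%:R != 0 :> C by move/pcharf0P: chC => ->; rewrite -lt0n.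
elim: k => [|k IH] km.
  by rewrite subn0; exists ((m`!%:R)^-1 ^+ 2) => //; rewrite expf_neq0 // invr_neq0 // nz ?fact_gt0.
have [c c0 /= ->] := IH (ltnW km).
exists (c * (m - k)%:R); first by rewrite mulf_neq0 // nz // subn_gt0.
by rewrite linearZ /= -(pr_lf dmu) lf_dmu_BA prZ scalerA subnS.
Qed.
End Derivatives.
End OverField.

Section Iterates.
Variables (C : fieldType) (N : nat) (eps : C) (V : lmodType C).
Hypothesis eps2 : eps * eps = 1.
Local Notation I := 'I_N.
Local Notation M := (seq I -> seq I -> V).
Implicit Types (f g : M) (t : seq (I * I)).

Definition AB t f : M := foldr (fun p g => ca eps p.1 (cb eps p.2 g)) f t.

Lemma AB_sum t (J : Type) (r : seq J) (F : J -> M) :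
  AB t (\sum_(j <- r) F j) = \sum_(j <- r) AB t (F j).
Proof. by elim: t => //= p t ->; rewrite cb_sum ca_sum. Qed.
Lemma ABZ t c f : AB t (c *: f) = c *: AB t f.
Proof. by elim: t => //= p t ->; rewrite cbZ caZ. Qed.
Lemma AB_lf t (h : {linear V -> V}) f : lf h (AB t f) = AB t (lf h f).
Proof. by elim: t => //= p t IH; rewrite lf_ca lf_cb IH. Qed.

Lemma AB_move p s t f : AB (s ++ p :: t) f = AB (p :: s ++ t) f.
Proof.
by elim: s => //= q s ->; rewrite /= (ab_comm eps2).
Qed.
Lemma AB_perm s t f : perm_eq s t -> AB s f = AB t f.
Proof.
elim: s t => [|p s IH] t pst; first by move: pst; rewrite perm_sym => /perm_nilP ->.
have /splitPr e : p \in t by rewrite -(perm_mem pst) mem_head.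
case: e pst => u v; rewrite perm_sym perm_catC cat_cons perm_cons perm_catC perm_sym => pst.
by rewrite AB_move /= (IH _ pst).
Qed.

Lemma vac_sum (J : Type) (r : seq J) (F : J -> V) :
  vac (\sum_(j <- r) F j) = \sum_(j <- r) vac (F j) :> M.
Proof.
apply/funext => s; apply/funext => t; rewrite !sumfE /vac.
by case: (nilp s && nilp t) => //; rewrite big1.
Qed.
Lemma vacZ c (v : V) : vac (c *: v) = c *: vac v :> M.
Proof.
apply/funext => s; apply/funext => t; rewrite -[RHS]/(c *: vac v s t) /vac.
by case: (nilp s && nilp t); rewrite ?scaler0.
Qed.

Variable L : I -> I -> {linear V -> V}.
Lemma iter_LL n v : iter n (LL eps L) (vac v) =
  \sum_(t : n.-tuple (I * I)) AB t (vac (foldr (fun p u => L p.1 p.2 u) v t)).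
Proof.
elim: n => [|n IH].
  by rewrite (big_pred1 [tuple]) // => t; apply/esym/eqP; exact: tuple0.
rewrite iterS IH LL_sum pair_bigA /=.
rewrite (sum_tuple_cons n (fun t => AB t (vac (foldr (fun p u => L p.1 p.2 u) v t)))).
apply: eq_bigr => p _; rewrite lf_sum cb_sum ca_sum; apply: eq_bigr => t _.
rewrite AB_lf /=; congr (ca _ _ (cb _ _ (AB _ _))).
apply/funext => s; apply/funext => s'; rewrite /lf /vac.
by case: (nilp s && nilp s') => //; rewrite linear0.
Qed.
End Iterates.

Section Symmetrisation.
Variables (C : fieldType) (N : nat).
Hypothesis chC : [pchar C] =i pred0.
Local Notation A := {mpoly C[N * N]}.
Local Notation U := (Uq (@fgl_rel C N)).
Local Notation word := (word (@fgl_rel C N)).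

Definition fsym_mon (c : C) (m : 'X_{1.. N * N}) : fa C (GL N) :=
  let w := mon_word m in
  [seq (((size w)`!%:R)^-1 * c, [seq tnth (in_tuple w) (s i) | i <- enum 'I_(size w)])
  | s : {perm 'I_(size w)} <- enum [set: {perm 'I_(size w)}]].
Definition fvarpi (p : A) : fa C (GL N) := flatten [seq fsym_mon (p@_m) m | m <- msupp p].

Variable x0 : GL N.
Definition symsum n (w : seq (GL N)) : U :=
  \sum_(s : 'S_n) word [seq nth x0 w (s i) | i <- enum 'I_n].

Lemma symsum_perm n s w : size w = n -> perm_eq s w -> symsum n s = symsum n w.
Proof.
move=> /eqP sw psw; pose t := Tuple sw.
have /tuple_permP[p es] : perm_eq s t by [].
rewrite /symsum [RHS](reindex_inj (mulIg p)); apply: eq_bigr => s' _.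
congr word; apply: eq_map => i; rewrite permM es (nth_map (s' i)) ?size_enum_ord //.
by rewrite nth_ord_enum (tnth_nth x0).
Qed.

Definition hsym (m : 'X_{1.. N * N}) : U :=
  ((size (cword m))`!%:R)^-1 *: symsum (size (cword m)) (cword m).

Lemma upi_fvarpi p : upi (@fgl_rel C N) (fvarpi p) = mlift hsym p.
Proof.
rewrite /fvarpi /mlift; elim: (msupp p) => [|m r IH]; first by rewrite big_nil.
rewrite big_cons /= upi_cat IH; congr (_ + _); rewrite /fsym_mon -[mon_word m]/(cword m).
rewrite upi_lin /lin big_map /hsym /symsum; set w := cword m.
rewrite -[index_enum _]/(index_enum {perm 'I_(size w)}) big_enum /= !scaler_sumr.
apply: eq_big => [s|s _]; first by rewrite in_setT.
rewrite scalerA mulrC; congr (_ *: word _); apply: eq_map => i.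
by rewrite (tnth_nth x0).
Qed.

Lemma mlift_prod n (s : seq (GL N)) : size s = n ->
  mlift hsym (\prod_(v <- s) 'X_v) = (n`!%:R)^-1 *: symsum n s.
Proof.
move=> sn; rewrite prod_mnw mliftX /hsym; have ps := perm_cword s.
rewrite -(perm_size ps) sn; congr (_ *: _); rewrite (symsum_perm _ ps) //.
by rewrite -(perm_size ps).
Qed.

Variables (mu : 'I_N -> 'I_N -> C) (eps : C).
Hypothesis eps2 : eps * eps = 1.
Let H (a : A) (u : U) := mlift hsym a = u.
Let sH : stable_rel H.
Proof.
by split; [exact: linear0 | move=> c u v _ _ <- <-; rewrite /H linearP].
Qed.

Let tperm_act n (s : 'S_n) (t : n.-tuple ('I_N * 'I_N)) := [tuple tnth t (s i) | i < n].

(* As the products a_i b_j commute, averaging over the orderings of the E_ij  *)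
(* changes nothing.                                                           *)
Lemma EE_iter_sym q : iter q (LL eps (fun i j => @LE C N i j : {linear U -> U})) (vac (1 : U)) =
  \sum_(t : q.-tuple ('I_N * 'I_N))
    AB eps t (vac ((q`!%:R)^-1 *: symsum q [seq E p.1 p.2 | p <- t])).
Proof.
pose F (t : q.-tuple ('I_N * 'I_N)) := AB eps t (vac (word [seq E p.1 p.2 | p <- t])).
have -> : iter q (LL eps (fun i j => @LE C N i j : {linear U -> U})) (vac (1 : U)) = \sum_t F t.
  rewrite iter_LL; apply: eq_bigr => t _; congr (AB _ _ (vac _)).
  elim: (tval t) => [|p s IH] /=; first by rewrite word_nil.
  by rewrite IH word_cons.
have Fs (s : 'S_q) : \sum_t F t = \sum_t F (tperm_act s t).
  apply: reindex; exists (tperm_act s^-1) => t _; apply: eq_from_tnth => i;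
  by rewrite !tnth_mktuple ?permK ?permKV.
have fq : q`!%:R != 0 :> C by move/pcharf0P: chC => ->; rewrite -lt0n fact_gt0.
transitivity ((q`!%:R)^-1 *: \sum_(s : 'S_q) \sum_t F t).
  by rewrite sumr_const card_Sn -scaler_nat scalerA mulVf // scale1r.
under eq_bigr => s _ do rewrite (Fs s).
rewrite exchange_big scaler_sumr; apply: eq_bigr => t _ /=.
rewrite vacZ ABZ; congr (_ *: _); rewrite vac_sum AB_sum; apply: eq_bigr => s _.
rewrite /F; have pt : perm_eq (tperm_act s t) t by apply/tuple_permP; exists s.
rewrite (AB_perm eps2 _ pt); congr (AB _ _ (vac (word _))).
rewrite -map_comp; apply: eq_map => i /=.
by rewrite (nth_map (tnth t i)) ?size_tuple // -tnth_nth.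
Qed.

(** For [k = 0] this is the symmetry in [EE_iter_sym]. The factors [M] have scalar entries, with
    which symmetrisation commutes. *)
Lemma BA_Bpq k q : fock_rel H (BA mu eps k q) (Bpq mu eps k q).
Proof.
rewrite /BA /Bpq; elim: k => [|k IH].
  rewrite /= EE_iter_sym iter_LL; apply: (fock_rel_sum sH) => t.
  have AB_rel l f g : fock_rel H f g -> fock_rel H (AB eps l f) (AB eps l g).
    by move=> h; elim: l => //= p l IH; apply: (fock_rel_ca eps sH); apply: (fock_rel_cb eps sH).
  apply: AB_rel => s s'; rewrite /vac; case: (nilp s && nilp s'); last by case: sH.
  rewrite /H -(mlift_prod (s := [seq E p.1 p.2 | p <- t])) ?size_map ?size_tuple //.
  congr mlift; elim: (tval t) => [|p r IHr] /=; first by rewrite big_nil.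
  by rewrite big_cons IHr /mulL mxE.
rewrite !iterS !LL_sum; apply: (fock_rel_sum sH) => i; apply: (fock_rel_sum sH) => j.
apply: (fock_rel_ca eps sH); apply: (fock_rel_cb eps sH) => s t.
by rewrite /H /lf /= /mulL mxE mul_mpolyC linearZ /= (IH s t).
Qed.

Lemma varpi_dmu_sy k m : (k <= m)%N -> exists2 c : C, c != 0 &
  upi (@fgl_rel C N) (fvarpi (iter k (fdmu mu) (sy_ eps (fSmx C N) m))) = c *: Gpq mu eps k (m - k).
Proof.
move=> km; have [c c0 ->] := iter_dmu_sy chC mu eps2 km; exists c => //.
rewrite upi_fvarpi linearZ /=; congr (_ *: _); rewrite /Gpq subnKC //.
exact: (rel_pr sH m (BA_Bpq k (m - k))).
Qed.
End Symmetrisation.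

(** * The two generating families *)

Section Generators.
Variables (C : fieldType) (N : nat) (mu : 'I_N -> 'I_N -> C) (z : C).
Hypothesis chC : [pchar C] =i pred0.
Hypothesis N0 : (0 < N)%N.
Hypothesis z0 : z != 0.
Local Notation A := {mpoly C[N * N]}.

Definition fA_mu (u : fa C (GL N)) : Prop :=
  exists v, (forall x, in_ideal (@floop_rel C N) (fvac_lin x v)) /\
    fa_equiv (@fgl_rel C N) u (fa_hom (frho mu z) v).

Lemma fA_muP u : fA_mu u <-> image mu z (upi (@fgl_rel C N) u).
Proof.
split=> [[v [/FF_centreP fv /upiP ->]]|[t]].
  by exists (upi (@floop_rel C N) v); split=> //; rewrite /rhom ext_upi.
elim/uqW: t => v [/FF_centreP fv e]; exists v; split=> //; apply/upiP.
by rewrite e /rhom ext_upi.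
Qed.

Lemma fA_mu_gen_by (eps : C) (f : nat -> A) : (eps == 1) || (eps == -1) ->
  (forall m, (m <= N)%N -> f m = sy_ eps (fSmx C N) m) ->
  forall u, fA_mu u <-> gen_by (@fgl_rel C N)
    (fun a : MK N => fvarpi (iter (val a).2 (fdmu mu) (f (val a).1.+1))) u.
Proof.
move=> eps1 ef u; have eps2 : eps * eps = 1 by case/orP: eps1 => /eqP ->; rewrite ?mulrNN mulr1.
pose x0 : GL N := E (Ordinal N0) (Ordinal N0).
have fam (m k : 'I_N) : (k <= m)%N -> exists2 c : C, c != 0 &
    upi (@fgl_rel C N) (fvarpi (iter k (fdmu mu) (f m.+1))) = c *: Gpq mu eps k (m.+1 - k).
  by move=> km; rewrite ef //; apply: (varpi_dmu_sy chC x0) => //; apply: leqW.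
have eA : fA_mu u <-> Alg (Gset mu eps) (upi (@fgl_rel C N) u).
  by apply: iff_trans (fA_muP u) _; apply: imageP.
apply: iff_trans eA _; apply: iff_trans (iff_sym (gen_byP _ _ _)).
split; apply: Alg_sub.
  move=> _ [p [q [q0 pq ->]]].
  (* [Gpq p q] belongs to [m = p + q] and [k = p]. The index stores [m - 1], so its condition
     [k <= m - 1] says [q > 0]. *)
  have hm : ((p + q).-1 < N)%N by lia.
  have hk : (p < N)%N by lia.
  have km : ((Ordinal hm, Ordinal hk).2 <= (Ordinal hm, Ordinal hk).1)%N by rewrite /=; lia.
  have [c c0 e] := fam (Ordinal hm) (Ordinal hk) km.
  have eG : Gpq mu eps p q = c^-1 *: upi (@fgl_rel C N)
      (fvarpi (iter p (fdmu mu) (f (p + q).-1.+1))).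
    rewrite [X in _ *: X]e scalerA mulVf // scale1r /=.
    by congr (Gpq _ _ _ _); lia.
  by rewrite eG; apply/AlgZ/Alg_gen; exists (exist _ (Ordinal hm, Ordinal hk) km).
move=> _ [[[m k] km] ->] /=; have [c _ ->] := fam m k km.
apply/AlgZ/Alg_gen; exists k, (m.+1 - k)%N; split=> //; first by rewrite subn_gt0 ltnS.
by rewrite subnKC // leqW.
Qed.
End Generators.

Theorem theorem3p1 (R : realType) (N : nat) (mu : 'I_N -> 'I_N -> R[i]) (z : R[i]) :
  (0 < N)%N -> z != 0 ->
  (forall u : fa R[i] (GL N),
     A_mu mu z u <-> gen_by (@gl_rel R N) (PhiFam mu) u) /\
  (forall u : fa R[i] (GL N),
     A_mu mu z u <-> gen_by (@gl_rel R N) (PsiFam mu) u).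
Proof.
move=> N0 z0; have chC : [pchar R[i]] =i pred0 by exact: pchar_num.
split.
(* The notions over [R[i]] agree by conversion with their versions over an arbitrary field. *)
- apply: (@fA_mu_gen_by R[i] N mu z chC N0 z0 (-1) (@fPhi R[i] N)); first by rewrite eqxx orbT.
  by move=> m; apply: fPhiE.
apply: (@fA_mu_gen_by R[i] N mu z chC N0 z0 1 (@fPsi R[i] N)); first by rewrite eqxx.
by move=> m; apply: fPsiE.
Qed.
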